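(* Fix $\epsilon>0$ with $\epsilon=o(\sqrt{d/N})$, and $p>0$. There exists a (randomized) algorithm that, given $\mathbf{x}_1,\dots,\mathbf{x}_n\in\mathbb{R}^d$ as in the context, finds with probability at least $1-p$ a unit vector $\mathbf{w}\in\mathbb{R}^d$ such that $\mathbf{w}^{\top}\mathbf{X}\mathbf{w}\ge\lambda_1-\epsilon$, in total time $\tilde{O}\left(\frac{N^{3/4}d^{1/4}}{\sqrt{\epsilon}}\right)$.
   Context: Setting: $\mathbf{x}_1,\dots,\mathbf{x}_n\in\mathbb{R}^d$ with $n>d$ and $\|\mathbf{x}_i\|\le 1$ for all $i$; $\mathbf{X}=\frac1n\sum_{i=1}^n\mathbf{x}_i\mathbf{x}_i^{\top}$, and $\lambda_1$ is the largest eigenvalue of $\mathbf{X}$. No eigengap is assumed. $N$ is the total number of non-zero entries in $\mathbf{x}_1,\dots,\mathbf{x}_n$. Time is measured in elementary (arithmetic) operations. $\tilde O(\cdot)$ hides poly-logarithmic dependencies on $d,\epsilon^{-1},p^{-1}$. *)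

(* Defs.v *)
From HB Require Import structures.
From mathcomp Require Import all_boot all_order all_algebra.
From mathcomp Require Import all_classical all_reals all_analysis.

Set Implicit Arguments.
Unset Strict Implicit.
Unset Printing Implicit Defensive.

Import Order.TTheory GRing.Theory Num.Theory.
Import numFieldNormedType.Exports.

Local Open Scope ring_scope.

(* The library norm on matrices is the sup norm, hence this one. *)
Definition enorm (R : realType) (d : nat) (v : 'cV[R]_d) : R :=
  Num.sqrt (\sum_i v i 0 ^+ 2).

Definition second_moment (R : realType) (d n : nat) (x : 'I_n -> 'cV[R]_d) :
    'M[R]_d :=
  n%:R^-1 *: \sum_i (x i *m (x i)^T).

Definition quad (R : realType) (d : nat) (M : 'M[R]_d) (w : 'cV[R]_d) : R :=
  (w^T *m M *m w) 0 0.

(* [eigenvalue] uses row eigenvectors; this is immaterial for the symmetric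
   matrix [second_moment x]. *)
Definition largest_eigenvalue (R : realType) (d : nat) (M : 'M[R]_d) (l : R) :=
  eigenvalue M l /\ forall a, eigenvalue M a -> a <= l.

(* The non-zero positions, row by row. *)
Definition entries (R : realType) (d n : nat) (x : 'I_n -> 'cV[R]_d) :
    seq ('I_n * 'I_d) :=
  [seq ij <- [seq (i, j) | i <- enum 'I_n, j <- enum 'I_d]
  | x ij.1 ij.2 0 != 0].

Definition nnz (R : realType) (d n : nat) (x : 'I_n -> 'cV[R]_d) : nat :=
  size (entries x).

(* Model of computation: a randomized real RAM with unit costs.  There are
   natural-number registers and real registers, and one unbounded memory of each
   kind, addressed through natural-number registers.  Real numbers are exact,
   the only constants in a program are natural numbers, and there is no map from
   reals to naturals (in particular no rounding); reals influence control flow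
   and addresses through comparisons only.  A program is a finite object that
   depends on neither the instance nor its size. *)

Inductive op : Type :=
| NConst of nat & nat         (* n_a := c *)
| NAdd of nat & nat & nat     (* n_a := n_b + n_c *)
| NSub of nat & nat & nat     (* n_a := n_b - n_c, truncated *)
| NMul of nat & nat & nat     (* n_a := n_b * n_c *)
| NLoad of nat & nat          (* n_a := nmem[n_b] *)
| NStore of nat & nat         (* nmem[n_a] := n_b *)
| ROfNat of nat & nat         (* r_a := n_b *)
| RAdd of nat & nat & nat     (* r_a := r_b + r_c *)
| RSub of nat & nat & nat     (* r_a := r_b - r_c *)
| RMul of nat & nat & nat     (* r_a := r_b * r_c *)
| RDiv of nat & nat & nat     (* r_a := r_b / r_c, with r / 0 = 0 *)
| RSqrt of nat & nat          (* r_a := sqrt r_b, 0 on negative numbers *)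
| RLoad of nat & nat          (* r_a := rmem[n_b] *)
| RStore of nat & nat.        (* rmem[n_a] := r_b *)

Inductive test : Type :=
| NLe of nat & nat            (* n_a <= n_b *)
| RLe of nat & nat.           (* r_a <= r_b *)

Inductive prog : Type :=
| Skip
| Op of op
| Rand of nat & nat           (* n_a := uniform in {0, ..., n_b} *)
| Seq of prog & prog
| If of test & prog & prog
| While of test & prog.

Record state (R : realType) : Type := State {
  nreg : nat -> nat;
  rreg : nat -> R;
  nmem : nat -> nat;
  rmem : nat -> R }.

Definition upd (T : Type) (f : nat -> T) (a : nat) (v : T) : nat -> T :=
  fun b => if b == a then v else f b.

Definition set_nreg (R : realType) (s : state R) (a v : nat) : state R :=
  State (upd (nreg s) a v) (rreg s) (nmem s) (rmem s).

Definition set_rreg (R : realType) (s : state R) (a : nat) (v : R) : state R :=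
  State (nreg s) (upd (rreg s) a v) (nmem s) (rmem s).

Definition exec_op (R : realType) (o : op) (s : state R) : state R :=
  match o with
  | NConst a c => set_nreg s a c
  | NAdd a b c => set_nreg s a (nreg s b + nreg s c)%N
  | NSub a b c => set_nreg s a (nreg s b - nreg s c)%N
  | NMul a b c => set_nreg s a (nreg s b * nreg s c)%N
  | NLoad a b => set_nreg s a (nmem s (nreg s b))
  | NStore a b =>
      State (nreg s) (rreg s) (upd (nmem s) (nreg s a) (nreg s b)) (rmem s)
  | ROfNat a b => set_rreg s a (nreg s b)%:R
  | RAdd a b c => set_rreg s a (rreg s b + rreg s c)
  | RSub a b c => set_rreg s a (rreg s b - rreg s c)
  | RMul a b c => set_rreg s a (rreg s b * rreg s c)
  | RDiv a b c => set_rreg s a (rreg s b / rreg s c)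
  | RSqrt a b => set_rreg s a (Num.sqrt (rreg s b))
  | RLoad a b => set_rreg s a (rmem s (nreg s b))
  | RStore a b =>
      State (nreg s) (rreg s) (nmem s) (upd (rmem s) (nreg s a) (rreg s b))
  end.

Definition eval_test (R : realType) (t : test) (s : state R) : bool :=
  match t with
  | NLe a b => (nreg s a <= nreg s b)%N
  | RLe a b => rreg s a <= rreg s b
  end.

(* [Pr E T K s]: probability that, started in state [s], the programs in [K],
   run one after the other, halt within [T] steps in a state satisfying [E].
   Every command and every evaluation of a test costs one step, and the draws
   of [Rand] are independent. *)
Fixpoint Pr (R : realType) (E : state R -> Prop) (T : nat) (K : seq prog)
    (s : state R) : R :=
  match K, T with
  | [::], _ => (`[< E s >])%:R
  | _ :: _, 0%N => 0
  | c :: K, T.+1 =>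
      match c with
      | Skip => Pr E T K s
      | Op o => Pr E T K (exec_op o s)
      | Rand a b =>
          (\sum_(v < (nreg s b).+1) Pr E T K (set_nreg s a v))
          / (nreg s b).+1%:R
      | Seq c1 c2 => Pr E T [:: c1, c2 & K] s
      | If t c1 c2 => Pr E T ((if eval_test t s then c1 else c2) :: K) s
      | While t c1 =>
          Pr E T (if eval_test t s then [:: c1, While t c1 & K] else K) s
      end
  end.

(* With probability 1; since all draws are from finite sets, this is the same
   as for all outcomes of the draws. *)
Definition halts_within (R : realType) (P : prog) (T : nat) (s : state R) :=
  Pr (fun=> True) T [:: P] s = 1.

(* Sparse input: the registers contain n, d, N and eps, p, and the t-th non-zero
   entry has its position in nmem[2t], nmem[2t+1] and its value in rmem[t];
   everything else is 0. *)
Definition input (R : realType) (d n : nat) (x : 'I_n -> 'cV[R]_d) (eps p : R) :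
    state R :=
  State
    (nth 0%N [:: n; d; nnz x])
    (nth 0 [:: eps; p])
    (nth 0%N (flatten [seq [:: nat_of_ord ij.1; nat_of_ord ij.2]
                      | ij <- entries x]))
    (nth 0 [seq x ij.1 ij.2 0 | ij <- entries x]).

(* The output vector occupies d consecutive cells of the real memory, from the
   address left in the natural-number register 0.  As unused cells are 0, a
   sparse vector can be output in less than d steps. *)
Definition output (R : realType) (d : nat) (s : state R) : 'cV[R]_d :=
  \col_(j < d) rmem s (nreg s 0%N + j)%N.

(* Main.v *)
Require Import Defs.
From HB Require Import structures.
From mathcomp Require Import all_boot all_order all_algebra.
From mathcomp Require Import all_classical all_reals all_analysis.
From mathcomp Require Import ring lra zify.

(** Why the theorem is true.

    A real register holds an arbitrary number at unit cost, so after scaling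
    and truncation the data become bounded integers, and a vector of bounded
    integers fits into a single real, as its digits in a large radix B.  Two
    passes over the entries compute the packed columns of the Gram matrix,
    i.e. for every non-zero column j the number G_j whose digits are the
    coefficients of that column.  From then on a product of the Gram matrix
    with a vector w takes min(N, d) multiplications only: the digits of
    sum_j w_j G_j are the coordinates of the product, because the Gram matrix
    is symmetric ([does_packed_product]).  They are recovered one after the
    other by rounding to nearest integers ([low_digits], [does_unpack]).

    For a guess a of n times the largest eigenvalue, let A be the Gram matrix
    divided by a.  The iteration w' = 2 A w - p, where p precedes w, multiplies
    the component along an eigenvector of eigenvalue at least 1 + th by at
    least 1 + sqrt th in each step ([inner_step]).  On the other hand
    |w|^2 + |p|^2 - 2 (p . A w) is an invariant, which bounds w and p as long
    as their Rayleigh quotients for A stay below 1 - th ([energy_bound]).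
    Hence, if a is a little smaller than n times the largest eigenvalue, a
    vector with Rayleigh quotient above 1 - th shows up within a number of
    steps that is 1 / sqrt th up to a logarithm.  The iterates are kept
    integral by truncating the increment w' - p towards zero.  This can only
    decrease the invariant ([energy_advance]), and it perturbs the component
    along the eigenvector by at most d, which is negligible once that
    component is large ([tau]).  Bisection on a in the interval [0, n], with
    th equal to a quarter of min(eps, 1), then yields a unit vector of the
    required quality ([does_probe], [does_search]).

    The start vector has independent coordinates, uniform on an arithmetic
    progression of more than 1 / p terms whose difference is large.  Normalize
    the eigenvector so that its largest coordinate is 1.  Whatever the other
    coordinates are, at most one value of the coordinate in that place makes
    the component along the eigenvector small, so this happens with
    probability at most p ([near0_le]).

    Up to logarithms of d, N, 1 / eps and 1 / p the time is therefore
    N + min(N, d) / sqrt eps.  Here min(N, d) is at most N^(3/4) d^(1/4).  When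
    eps is at most sqrt (d / N), the same quantity divided by sqrt eps bounds
    N, and N is at most d / eps^2, so that its logarithm is bounded by those of
    d and 1 / eps ([size_exp_le], [time_bound_le]).  As eps is o(sqrt (d / N)),
    finitely many members of the family of instances are left, and they only
    affect the constant. *)

Set Implicit Arguments.
Unset Strict Implicit.
Unset Printing Implicit Defensive.

Import Order.TTheory GRing.Theory Num.Theory.
Import numFieldNormedType.Exports.

Local Open Scope ring_scope.

(** * Timed execution of programs *)

Section Semantics.
Variable R : realType.
Implicit Types (s : state R) (c : prog) (Q : state R -> Prop).

(** A run without random draws, of exactly k steps.  Quantifying over the
    event, the remaining budget and the programs that follow makes runs
    composable without a semantics other than [Pr]. *)
Definition runs c s s' k :=
  forall E T K, Pr E (k + T) (c :: K) s = Pr E T K s'.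

Definition does c s k Q :=
  exists s' k', [/\ (k' <= k)%N, runs c s s' k' & Q s'].

Lemma does_imp c s k k' Q Q' : (k <= k')%N -> (forall s', Q s' -> Q' s') ->
  does c s k Q -> does c s k' Q'.
Proof.
move=> kk' QQ' [s1 [k1 [h1 h2 h3]]]; exists s1, k1; split=> //; last exact: QQ'.
exact: leq_trans kk'.
Qed.

Lemma does_skip s Q k : (0 < k)%N -> Q s -> does Skip s k Q.
Proof. by move=> k0 h; exists s, 1%N; split. Qed.

Lemma does_op o s Q : Q (exec_op o s) -> does (Op o) s 1 Q.
Proof. by move=> h; exists (exec_op o s), 1%N; split. Qed.

Lemma does_seq c1 c2 s k1 k2 Q1 Q : does c1 s k1 Q1 ->
  (forall s1, Q1 s1 -> does c2 s1 k2 Q) -> does (Seq c1 c2) s (k1 + k2).+1 Q.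
Proof.
move=> [s1 [k1' [le1 r1 /[swap] /[apply]]]] [s2 [k2' [le2 r2 q2]]].
exists s2, (k1' + k2').+1; split=> //; first by rewrite ltnS leq_add.
by move=> E T K /=; rewrite -addnA r1 r2.
Qed.

Lemma does_then c1 c2 s k1 k2 Q :
  does c1 s k1 (fun s1 => does c2 s1 k2 Q) -> does (Seq c1 c2) s (k1 + k2).+1 Q.
Proof. by move=> h; apply: (does_seq h). Qed.

Lemma does_if t c1 c2 s k Q :
  (eval_test t s = true -> does c1 s k Q) ->
  (eval_test t s = false -> does c2 s k Q) -> does (If t c1 c2) s k.+1 Q.
Proof.
case: (boolP (eval_test t s)) => [h /(_ erefl) + _|/negbTE h _ /(_ erefl)];
  by move=> [s' [k' [le r q]]]; exists s', k'.+1; split=> // E T K /=;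
     rewrite h r.
Qed.

(** The invariant is indexed by the number of rounds made; termination follows
    from the bound m on the index whenever the test succeeds. *)
Lemma does_while t c s b m (I : nat -> state R -> Prop) :
  I 0%N s ->
  (forall i s', I i s' -> eval_test t s' = true ->
     (i < m)%N /\ does c s' b (I i.+1)) ->
  does (While t c) s (m * b.+1 + 1)
    (fun s' => (exists i, I i s') /\ eval_test t s' = false).
Proof.
move=> I0 step.
suff H j s' : (j <= m)%N -> I (m - j)%N s' -> does (While t c) s' (j * b.+1 + 1)
    (fun s' => (exists i, I i s') /\ eval_test t s' = false).
  by apply: H => //; rewrite subnn.
elim: j s' => [|j IH] s' jm Ij; have [ht|/negbTE ht] := boolP (eval_test t s').
- by case: (step _ _ Ij ht); rewrite subn0 ltnn.
- exists s', 1%N; split=> //; first by move=> E T K /=; rewrite ht.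
  by split=> //; exists (m - 0)%N.
- have [lt [s1 [k1 [le1 r1 q1]]]] := step _ _ Ij ht.
  have [|s2 [k2 [le2 r2 q2]]] := IH s1 (ltnW jm).
    by rewrite (_ : (m - j)%N = (m - j.+1).+1) //; lia.
  exists s2, (k1 + k2).+1; split=> //; first by lia.
  by move=> E T K /=; rewrite ht -addnA r1 r2.
- exists s', 1%N; split=> //.
    by move=> E T K /=; rewrite ht.
  by split=> //; exists (m - j.+1)%N.
Qed.

Lemma updE (T : Type) (f : nat -> T) a v b :
  upd f a v b = if b == a then v else f b.
Proof. by []. Qed.

Fixpoint block (os : seq op) : prog :=
  if os is o :: os' then Seq (Op o) (block os') else Skip.

Lemma does_cons o os s k Q : does (block os) (exec_op o s) k Q ->
  does (block (o :: os)) s k.+2 Q.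
Proof.
move=> h; have -> : (k.+2 = (1 + k).+1)%N by [].
by apply: (does_seq (Q1 := eq (exec_op o s))); [exact: does_op|move=> _ <-].
Qed.

Lemma does_nil s k Q : Q s -> does (block [::]) s k.+1 Q.
Proof. by move=> h; apply: does_skip. Qed.

Fixpoint seqs (cs : seq prog) : prog :=
  if cs is c :: cs' then Seq c (seqs cs') else Skip.

(** Counts register k down from the value of register lim.  Registers 3 and 4
    hold the constants 0 and 1 whenever this is used. *)
Definition down k lim body := Seq (Op (NAdd k lim 3))
  (While (NLe 4 k) (Seq (Op (NSub k k 4)) body)).

Lemma does_down k lim body s m b (I : nat -> state R -> Prop) :
  nreg s lim = m -> nreg s 3%N = 0%N ->
  I m (set_nreg s k m) ->
  (forall i s, I i s -> nreg s k = i /\ nreg s 4%N = 1%N) ->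
  (forall i s, (i < m)%N -> I i.+1 s -> does body (set_nreg s k i) b (I i)) ->
  does (down k lim body) s (m * (b + 3) + 3) (I 0%N).
Proof.
move=> hl h0 Im Ik step.
rewrite (_ : (m * _ + _ = (1 + (m * (b + 3) + 1)).+1)%N); last by lia.
apply: (does_seq (Q1 := fun s1 => s1 = set_nreg s k m)).
  by apply: does_op; rewrite /= hl h0 addn0.
move=> _ ->; set s0 := set_nreg _ _ _.
apply: (@does_imp _ _ (m * (b + 3) + 1) _
   (fun s' => (exists i, (i <= m)%N /\ I (m - i)%N s')
      /\ eval_test (NLe 4 k) s' = false)) => //.
  move=> s' [[i [im Ii]] /=]; have [hk h1] := Ik _ _ Ii.
  by rewrite hk h1 => /negbT; rewrite -leqNgt leqn0 => /eqP e; move: Ii; rewrite e.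
have -> : (m * (b + 3) = m * (b + 2).+1)%N by lia.
apply: (does_while (I := fun i s' => (i <= m)%N /\ I (m - i)%N s')).
  by rewrite subn0.
move=> i s' [im Ii] /=; have [hk h1] := Ik _ _ Ii.
rewrite hk h1 => lt; split; first by lia.
rewrite (_ : (b + 2 = (1 + b).+1)%N); last by lia.
apply: (does_seq (Q1 := fun s1 => s1 = set_nreg s' k (m - i.+1))).
  by apply: does_op; rewrite /= hk h1; congr set_nreg; lia.
move=> _ ->; have : does body (set_nreg s' k (m - i.+1)) b (I (m - i.+1)%N).
  apply: step; first by lia.
  by rewrite (_ : (m - i.+1).+1 = (m - i)%N) //; lia.
by apply: does_imp => // s1 h; split=> //; lia.
Qed.

End Semantics.

Arguments seqs : simpl never.
Arguments block : simpl never.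

(** * Truncation towards zero *)

Section Rounding.
Variable R : realType.
Implicit Types (z y : R) (s : state R).

Definition tr z : R :=
  if 0 <= z then (Num.truncn z)%:R else - (Num.truncn (- z))%:R.

Lemma tr_nat (m : nat) r : 0 <= r < 1 -> tr (m%:R + r) = m%:R.
Proof.
move=> /andP[r0 r1]; have h : 0 <= m%:R + r by rewrite addr_ge0.
rewrite /tr h; congr _%:R; apply: truncn_def.
by rewrite lerDl r0 -natr1 ltrD2l.
Qed.

Lemma trN z : tr (- z) = - tr z.
Proof.
rewrite /tr oppr_ge0 opprK; by case: (ltgtP z 0) => [h|h|->]; rewrite ?opprK // oppr0 truncn0 oppr0.
Qed.

Lemma tr0 : tr 0 = 0.
Proof. by rewrite /tr lexx truncn0. Qed.

Lemma tr_int z : tr z \is a Num.int.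
Proof. by rewrite /tr; case: ifP => _; rewrite ?rpredN natr_int. Qed.

Lemma tr_cases z : (0 <= z /\ 0 <= tr z <= z /\ z - 1 < tr z) \/
  (z <= 0 /\ z <= tr z <= 0 /\ tr z < z + 1).
Proof.
rewrite /tr; case: (leP 0 z) => h; [left|right].
  have /andP := truncn_itv h; rewrite -natr1 => -[h1 h2].
  have h3 : 0 <= (Num.truncn z)%:R :> R by [].
  by split=> //; split; [apply/andP; split|]; lra.
have h' : 0 <= - z by lra.
have /andP := truncn_itv h'; rewrite -natr1 => -[h1 h2].
have h3 : 0 <= (Num.truncn (- z))%:R :> R by [].
by split; [lra|split; [apply/andP; split|]; lra].
Qed.

Lemma tr_dist z : `|tr z - z| <= 1.
Proof.
by case: (tr_cases z) => -[h0 [/andP[h1 h2] h3]]; rewrite ler_norml;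
  apply/andP; split; lra.
Qed.

Lemma tr_le z : `|tr z| <= `|z|.
Proof.
case: (tr_cases z) => -[h0 [/andP[h1 h2] h3]].
  by rewrite !ger0_norm.
by rewrite !ler0_norm // lerN2.
Qed.

(** This sign is the reason for truncating instead of rounding to a nearest
    integer, for which it may be wrong: it is what the energy of the iteration
    loses at one coordinate. *)
Lemma tr_dissip z : tr z * (tr z - z) <= 0.
Proof. by case: (tr_cases z) => -[h0 [/andP[h1 h2] h3]]; nra. Qed.

Lemma tr_nearest z y : y \is a Num.int -> `|z - y| < 2^-1 ->
  tr (if 0 <= z then z + 2^-1 else z - 2^-1) = y.
Proof.
have pos (m : nat) z' : 0 <= z' -> `|z' - m%:R| < 2^-1 -> tr (z' + 2^-1) = m%:R.
  rewrite ltr_norml => z0 /andP[h1 h2].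
  rewrite (_ : z' + 2^-1 = m%:R + (z' + 2^-1 - m%:R)); last by ring.
  by apply: tr_nat; apply/andP; split; lra.
move=> /intrP[m ->]; case: m => m.
  case: ifP => z0; first exact: pos.
  move/negbT: z0; rewrite -ltNge => z0 h.
  have m0 : (m = 0)%N.
    apply/eqP; rewrite -leqn0 leqNgt -(ltr_nat R); apply/negP => m0.
    have m1 : 1 <= m%:R :> R by rewrite ler1n -(ltr_nat R).
    by move: h; rewrite ltr_norml => /andP[h1 h2]; rewrite /= in h1 h2; move: h1; rewrite (_ : (Posz m)%:~R = m%:R) //; lra.
  move: h; rewrite m0 subr0 ltr_norml => /andP[h1 h2].
  have -> : z - 2^-1 = - (0%:R + (2^-1 - z)) by rewrite add0r opprB.
  by rewrite trN tr_nat ?oppr0 //; apply/andP; split; lra.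
rewrite NegzE mulrNz opprK => h.
have m1 : 1 <= m.+1%:R :> R by rewrite ler1n.
have zneg : z < 0.
  by move: h; rewrite ltr_norml => /andP[h1 h2]; move: h2; rewrite -pmulrn; lra.
rewrite leNgt zneg /= (_ : z - 2^-1 = - (- z + 2^-1)); last by ring.
rewrite trN (pos m.+1) //; first by rewrite oppr_ge0 ltW.
by rewrite -normrN opprB opprK addrC.
Qed.

(** Machine truncation of register 50.  The model has no rounding, so the power
    of 2 above |z| is found by doubling (register 51), and the binary digits of
    |z| before the point are subtracted on the way back (register 52 ends with
    the fractional part).  Registers 7, 2 and 8 hold 0, 1 and 2. *)
Definition trunc_prog : prog := seqs [::
  Op (RMul 51 2 2);
  If (RLe 7 50) (Op (RAdd 53 50 7)) (Op (RSub 53 7 50));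
  While (RLe 51 53) (Op (RAdd 51 51 51));
  Op (RAdd 52 53 7);
  While (RLe 8 51)
    (Seq (Op (RDiv 51 51 8)) (If (RLe 51 52) (Op (RSub 52 52 51)) Skip));
  Op (RSub 53 53 52);
  If (RLe 7 50) (Op (RAdd 50 53 7)) (Op (RSub 50 7 53)) ]%N.

(** Truncation overwrites the real registers from 50 on and nothing else. *)
Definition scratch s (rr : nat -> R) s' :=
  s' = State (nreg s) rr (nmem s) (rmem s) /\
  forall r, (r < 50)%N -> rr r = rreg s r.

Lemma scratch_upd s rr s' a v : scratch s rr s' -> (50 <= a)%N ->
  scratch s (upd rr a v) (set_rreg s' a v).
Proof.
move=> [-> h] lea; split=> // r ltr; rewrite updE h //.
by case: eqP => // e; move: ltr; rewrite e ltnNge lea.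
Qed.

Lemma does_trunc s l z : rreg s 7%N = 0 -> rreg s 2%N = 1 -> rreg s 8%N = 2 ->
  rreg s 50%N = z -> `|z| < 2 ^+ l ->
  does trunc_prog s (10 * l + 30) (fun s' => exists2 rr,
    scratch s rr s' & rr 50%N = tr z).
Proof.
move=> h7 h2 h8 hz zl; pose a := `|z|; have a0 : 0 <= a by exact: normr_ge0.
pose J i (s' : state R) := exists2 rr, scratch s rr s' &
  [/\ rr 50%N = z, rr 53%N = a & rr 51%N = 2 ^+ i].
pose K i (s' : state R) := exists2 rr, scratch s rr s' &
  [/\ rr 50%N = z, rr 53%N = a, (i <= l)%N /\ rr 51%N = 2 ^+ (l - i),
      0 <= rr 52%N < rr 51%N & exists m : nat, a - rr 52%N = m%:R].
apply: (@does_imp _ _ _ (1 + (2 + ((l * 2 + 1) + (1 + ((l * 5 + 1) + (1 + (2 + 1)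
  .+1).+1).+1).+1).+1).+1).+1); [by lia|by move=> s'; exact: id|].
have r0 : scratch s (rreg s) s by split=> //; case: (s).
have e8 rr s' : scratch s rr s' -> rr 8%N = 2 by move=> [_ ->].
have e7 rr s' : scratch s rr s' -> rr 7%N = 0 by move=> [_ ->].
have e2 rr s' : scratch s rr s' -> rr 2%N = 1 by move=> [_ ->].
apply: (does_seq (Q1 := fun s' => exists2 rr, scratch s rr s' &
   rr 50%N = z /\ rr 51%N = 1)).
  apply: does_op => /=; exists (upd (rreg s) 51%N 1).
    by rewrite /= h2 mulr1; apply: scratch_upd r0 _.
  by rewrite !updE /= hz.
move=> s1 [rr sc [h50 h51]].
apply: (does_seq (Q1 := J 0%N)).
  have e : rreg s1 = rr by case: sc => ->.
  apply: does_if; rewrite /= e (e7 _ _ sc) h50 => zs; apply: does_op => /=.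
    rewrite e (e7 _ _ sc) h50 addr0; eexists; first by apply: scratch_upd sc _.
    by rewrite !updE /= h50 h51 expr0 /a ger0_norm.
  rewrite e (e7 _ _ sc) h50 sub0r; eexists; first by apply: scratch_upd sc _.
  by rewrite !updE /= h50 h51 expr0 /a ltr0_norm // ltNge zs.
move=> {rr sc h50 h51} {}s1 J0.
apply: (does_seq (Q1 := fun s' => exists2 rr, scratch s rr s' &
  [/\ rr 50%N = z, rr 53%N = a & exists2 i, (i <= l)%N & rr 51%N = 2 ^+ i /\ a < rr 51%N])).
  apply: (@does_imp _ _ _ (l * 2 + 1) _ (fun s' => (exists i, (i <= l)%N /\ J i s') /\
     eval_test (RLe 51 53) s' = false)) => //.
    move=> s' [[i [il [rr sc [h50 h53 h51]]]] /=].
    have e : rreg s' = rr by case: sc => ->.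
    by rewrite e h51 h53 => /negbT; rewrite -ltNge => lt;
       exists rr => //; split=> //; exists i; rewrite ?h51.
  apply: (does_while (I := fun i s' => (i <= l)%N /\ J i s')) => //.
  move=> i s' [il [rr sc [h50 h53 h51]]] /=.
  have e : rreg s' = rr by case: sc => ->.
  rewrite e h51 h53 => le.
  have lt : (i < l)%N.
    rewrite ltnNge; apply/negP => li.
    have : (2 : R) ^+ l <= 2 ^+ i by rewrite ler_eXn2l // ltr1n.
    by rewrite leNgt => /negP; apply; apply: le_lt_trans zl.
  split=> //; apply: does_op => /=; rewrite e h51; split=> //.
  eexists; first by apply: scratch_upd sc _.
  by rewrite !updE /= h50 h53 exprS mulr_natl mulr2n.
move=> {J0} {}s1 [rr sc [h50 h53 [k kl [h51 lta]]]].
apply: (does_seq (Q1 := K (l - k)%N)).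
  have e : rreg s1 = rr by case: sc => ->.
  apply: does_op => /=; rewrite e (e7 _ _ sc) h53 addr0.
  eexists; first by apply: scratch_upd sc _.
  rewrite !updE /= h50 h51 a0 -h51 lta h51 h53 subKn //; split=> //.
    by split=> //; lia.
  by exists 0%N; rewrite subrr.
move=> {rr sc h50 h51 h53 lta} {}s1 K0.
apply: (does_seq (Q1 := fun s' => exists2 rr, scratch s rr s' &
  [/\ rr 50%N = z, rr 53%N = a, 0 <= rr 52%N < 1 & exists m : nat, a - rr 52%N = m%:R])).
  apply: (@does_imp _ _ _ (l * 5 + 1) _ (fun s' => (exists i, K (l - k + i)%N s') /\
     eval_test (RLe 8 51) s' = false)) => //.
    move=> s' [[i [rr sc [h50 h53 [il h51] h52 hm]]] /=].
    have e : rreg s' = rr by case: sc => ->.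
    rewrite e h51 (e8 _ _ sc) => /negbT; rewrite -ltNge => lt.
    exists rr => //; split=> //; move: h52; rewrite h51; case: (_ - _)%N lt => // j.
    by rewrite ltNge ler_eXnr // ler1n.
  apply: (does_while (I := fun i s' => K (l - k + i)%N s')).
    by rewrite addn0.
  move=> i s' [rr sc [h50 h53 [il h51] h52 [m hm]]] /=.
  have e : rreg s' = rr by case: sc => ->.
  rewrite e h51 (e8 _ _ sc) => le.
  have [j hj] : exists j, (l - (l - k + i) = j.+1)%N.
    by case: (l - _)%N le => [|j _]; [rewrite expr0; lra|exists j].
  have hj' : (l - (l - k + i.+1) = j)%N by lia.
  split; first by lia.
  rewrite hj in h51.
  apply: (does_seq (k1 := 1) (k2 := 2) (Q1 := fun s' => exists2 rr, scratch s rr s' &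
     [/\ rr 50%N = z, rr 53%N = a, rr 51%N = 2 ^+ j,
      0 <= rr 52%N < 2 ^+ j.+1 & exists m : nat, a - rr 52%N = m%:R])).
    apply: does_op => /=; rewrite e h51 (e8 _ _ sc).
    eexists; first by apply: scratch_upd sc _.
    rewrite !updE /= h50 h53 -h51; split=> //; last by exists m.
    by rewrite h51 exprS mulrC mulKf // pnatr_eq0.
  move=> {rr sc h50 h51 h53 h52 m hm e le} s2 [rr sc [h50 h53 h51 /andP[h52 h52'] [m hm]]].
  have e : rreg s2 = rr by case: sc => ->.
  apply: does_if; rewrite /= e h51 => le.
    apply: does_op => /=; rewrite e h51.
    eexists; first by apply: scratch_upd sc _.
    rewrite !updE /= h50 h53 h51 hj'; split=> //; first by split=> //; lia.
      rewrite exprS in h52'; apply/andP; split; lra.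
    by exists (m + 2 ^ j)%N; rewrite natrD natrX opprB addrCA hm addrC.
  apply: does_skip => //; exists rr => //; rewrite hj' h50 h53 h51; split=> //.
  - by split=> //; lia.
  - by rewrite h52 ltNge le.
  - by exists m.
move=> {K0} {}s1 [rr sc [h50 h53 /andP[h52 h52'] [m hm]]].
have trE : tr a = m%:R.
  by rewrite (_ : a = m%:R + rr 52%N) ?tr_nat ?h52 // -hm subrK.
apply: (does_seq (Q1 := fun s' => exists2 rr, scratch s rr s' &
   rr 50%N = z /\ rr 53%N = tr a)).
  have e : rreg s1 = rr by case: sc => ->.
  apply: does_op => /=; rewrite e h53 hm -trE.
  by eexists; [by apply: scratch_upd sc _|rewrite !updE /= h50].
move=> {rr sc h50 h53 h52 h52' hm} {}s1 [rr sc [h50 h53]].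
apply: (does_seq (Q1 := fun s' => exists2 rr, scratch s rr s' & rr 50%N = tr z)).
  have e : rreg s1 = rr by case: sc => ->.
  apply: does_if; rewrite /= e (e7 _ _ sc) h50 => zs; apply: does_op => /=.
    rewrite e (e7 _ _ sc) h53 addr0; eexists; first by apply: scratch_upd sc _.
    by rewrite !updE /= /a ger0_norm.
  rewrite e (e7 _ _ sc) h53 sub0r; eexists; first by apply: scratch_upd sc _.
  by rewrite !updE /= /a ltr0_norm ?trN ?opprK // ltNge zs.
by move=> s2 h; apply: does_skip.
Qed.
End Rounding.

(** * Gram forms and the momentum iteration in integers *)

Section Vectors.
Variables (R : realType) (d n : nat).
Implicit Types (v w p u : 'I_d -> R) (f g : 'I_n -> 'I_d -> R).

Definition dot v w : R := \sum_j v j * w j.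

Definition sum_abs v : R := \sum_j `|v j|.

(** F^T F w, where the rows of F are the f i *)
Definition gram f w : 'I_d -> R :=
  fun j => \sum_i f i j * \sum_l f i l * w l.

Lemma dotC v w : dot v w = dot w v.
Proof. by apply: eq_bigr => j _; rewrite mulrC. Qed.

Lemma dot_gram f v w :
  dot v (gram f w) = \sum_i (\sum_l f i l * v l) * (\sum_l f i l * w l).
Proof.
rewrite /dot /gram; under eq_bigr do rewrite mulr_sumr.
rewrite exchange_big; apply: eq_bigr => i _ /=.
by rewrite mulr_suml; apply: eq_bigr => j _; rewrite mulrA [v j * _]mulrC.
Qed.

Lemma gram_sym f v w : dot v (gram f w) = dot w (gram f v).
Proof. by rewrite !dot_gram; apply: eq_bigr => i _; rewrite mulrC. Qed.

(** The Gram form at v - w is non-negative. *)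
Lemma gram_psd f v w :
  2 * dot v (gram f w) <= dot v (gram f v) + dot w (gram f w).
Proof.
rewrite !dot_gram mulr_sumr -big_split /=; apply: ler_sum => i _.
set y := \sum_l _; set z := \sum_l _.
have : 0 <= (y - z) ^+ 2 by exact: sqr_ge0.
by move=> ?; nra.
Qed.

Lemma dot_ge0 v : 0 <= dot v v.
Proof. by apply: sumr_ge0 => j _; rewrite -expr2 sqr_ge0. Qed.

Lemma sqr_le_dot v j : v j ^+ 2 <= dot v v.
Proof.
rewrite /dot (bigD1 j) //= -expr2 lerDl; apply: sumr_ge0 => l _.
by rewrite -expr2 sqr_ge0.
Qed.

Lemma sum_abs_le v b : (forall j, `|v j| <= b) -> sum_abs v <= d%:R * b.
Proof.
move=> h; apply: (@le_trans _ _ (\sum_(j < d) b)); first exact: ler_sum.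
by rewrite sumr_const card_ord mulr_natl.
Qed.

Lemma sum_abs_ge0 v : 0 <= sum_abs v.
Proof. exact: sumr_ge0. Qed.

Lemma sum_abs_sqr v : sum_abs v ^+ 2 <= d%:R * dot v v.
Proof.
have h (i j : 'I_d) : 2 * (`|v i| * `|v j|) <= v i ^+ 2 + v j ^+ 2.
  rewrite -(real_normK (num_real (v i))) -(real_normK (num_real (v j))).
  by have := sqr_ge0 (`|v i| - `|v j|) => ?; nra.
have : 2 * sum_abs v ^+ 2 <= \sum_i \sum_j (v i ^+ 2 + v j ^+ 2).
  rewrite expr2 /sum_abs big_distrlr /= mulr_sumr.
  by apply: ler_sum => i _; rewrite mulr_sumr; apply: ler_sum => j _; exact: h.
have e : \sum_i v i ^+ 2 = dot v v by apply: eq_bigr => i _; rewrite expr2.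
under eq_bigr do rewrite big_split /= sumr_const card_ord e.
rewrite big_split /= sumr_const card_ord sumrMnl e -mulr_natl.
by move=> h2; lra.
Qed.

Lemma dot_abs_le u w b : (forall j, `|u j| <= b) -> `|dot u w| <= b * sum_abs w.
Proof.
move=> h; rewrite /dot mulr_sumr; apply: le_trans (ler_norm_sum _ _ _) _.
by apply: ler_sum => j _; rewrite normrM ler_wpM2r.
Qed.

Lemma gram_coef f w j : gram f w j = \sum_l (\sum_i f i j * f i l) * w l.
Proof.
rewrite /gram; under eq_bigr do rewrite mulr_sumr.
rewrite exchange_big; apply: eq_bigr => l _ /=.
by rewrite mulr_suml; apply: eq_bigr => i _; rewrite mulrA.
Qed.

Lemma gram_le f w b j : (forall l, `|\sum_i f i j * f i l| <= b) ->
  `|gram f w j| <= b * sum_abs w.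
Proof.
move=> h; rewrite gram_coef mulr_sumr; apply: le_trans (ler_norm_sum _ _ _) _.
by apply: ler_sum => l _; rewrite normrM ler_wpM2r.
Qed.

Lemma gram_dist f g c b u w :
  (forall j l, `|\sum_i f i j * f i l - c * \sum_i g i j * g i l| <= b) ->
  `|dot u (gram f w) - c * dot u (gram g w)| <= b * sum_abs u * sum_abs w.
Proof.
move=> h; rewrite /dot mulr_sumr -sumrB.
apply: le_trans (ler_norm_sum _ _ _) _.
have -> : b * sum_abs u * sum_abs w = \sum_j `|u j| * (b * sum_abs w).
  by rewrite -mulr_suml /sum_abs; ring.
apply: ler_sum => j _.
rewrite (_ : _ - _ = u j * (gram f w j - c * gram g w j)); last by ring.
rewrite normrM ler_wpM2l // !gram_coef mulr_sumr -sumrB.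
apply: le_trans (ler_norm_sum _ _ _) _; rewrite mulr_sumr.
by apply: ler_sum => l _; rewrite mulrA -mulrBl normrM ler_wpM2r.
Qed.

Lemma dot_sqr_le v w : dot v w ^+ 2 <= dot v v * dot w w.
Proof.
have [w0|w0] := eqVneq (dot w w) 0.
  suff -> : dot v w = 0 by rewrite expr2 !mul0r mulr_ge0 // dot_ge0.
  apply: big1 => j _; suff -> : w j = 0 by rewrite mulr0.
  apply/eqP; rewrite -sqrf_eq0; apply/eqP/le_anti.
  by rewrite sqr_ge0 -w0 sqr_le_dot.
pose t := dot v w / dot w w.
have : 0 <= dot (fun j => v j - t * w j) (fun j => v j - t * w j) by exact: dot_ge0.
have -> : dot (fun j => v j - t * w j) (fun j => v j - t * w j) =
   dot v v - 2 * t * dot v w + t ^+ 2 * dot w w.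
  rewrite /dot !mulr_sumr -sumrB -big_split /=.
  by apply: eq_bigr => j _; ring.
have wp : 0 < dot w w by rewrite lt_def w0 dot_ge0.
have -> : dot v v - 2 * t * dot v w + t ^+ 2 * dot w w =
  (dot v v * dot w w - dot v w ^+ 2) / dot w w by rewrite /t; field.
by rewrite pmulr_lge0 ?invr_gt0 // subr_ge0.
Qed.

End Vectors.

Section Iteration.
Variables (R : realType) (d n : nat).
Variables (x xh : 'I_n -> 'I_d -> R) (c : R).
Hypothesis c0 : 0 < c.
Implicit Types (v w p u : 'I_d -> R).

(** The step w' = 2 A w - p for A = gram xh / c, truncated: what is truncated is
    the increment w' - p = 2 (A w) - 2 p. *)
Definition advance w p : 'I_d -> R :=
  fun j => p j + tr (2 * (gram xh w j / c) - 2 * p j).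

(** The step w' = 2 A w - p without truncation leaves this unchanged, because A
    is symmetric. *)
Definition energy w p : R := dot w w + dot p p - 2 * (dot p (gram xh w) / c).

(** Write z for the increment before truncation and t = tr z.  By symmetry of A
    the energy changes by the sum of the t_j (t_j - z_j). *)
Lemma energy_advance w p : energy (advance w p) w <= energy w p.
Proof.
rewrite /energy (gram_sym xh w) -subr_ge0.
have -> : dot w w + dot p p - 2 * (dot p (gram xh w) / c) -
   (dot (advance w p) (advance w p) + dot w w -
    2 * (dot (advance w p) (gram xh w) / c)) =
   \sum_j (- (tr (2 * (gram xh w j / c) - 2 * p j) *
     (tr (2 * (gram xh w j / c) - 2 * p j) - (2 * (gram xh w j / c) - 2 * p j)))).
  rewrite [X in X + _ - _]addrC -!addrA [dot w w + _]addrCA.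
  rewrite opprD [dot w w + _]addrC -!addrA.
  rewrite (_ : dot p p + _ = (dot p p - 2 / c * dot p (gram xh w))
     - (dot (advance w p) (advance w p) - 2 / c * dot (advance w p) (gram xh w)));
    last by field; rewrite gt_eqF.
  rewrite /dot !mulr_sumr -!sumrB; apply: eq_bigr => j _; rewrite /advance.
  by field; rewrite gt_eqF.
by apply: sumr_ge0 => j _; rewrite oppr_ge0 tr_dissip.
Qed.

(** By Cauchy-Schwarz for the Gram form the cross term is at most the sum of the
    two quadratic forms, and these are small by hypothesis. *)
Lemma energy_bound th w p :
  dot w (gram xh w) <= (1 - th) * c * dot w w ->
  dot p (gram xh p) <= (1 - th) * c * dot p p ->
  th * (dot w w + dot p p) <= energy w p.
Proof.
move=> hw hp; have := gram_psd xh p w; rewrite /energy => h.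
have -> : th * (dot w w + dot p p) = dot w w + dot p p -
  ((1 - th) * c * dot w w + (1 - th) * c * dot p p) / c by field; rewrite gt_eqF.
rewrite lerD2l lerN2 mulrA ler_pM2r ?invr_gt0 //.
by apply: le_trans h _; lra.
Qed.

Lemma advance_int w p j : p j \is a Num.int -> advance w p j \is a Num.int.
Proof. by move=> h; rewrite rpredD // tr_int. Qed.

Lemma advance_le w p j b b' : `|p j| <= b -> `|gram xh w j / c| <= b' ->
  `|advance w p j| <= 3 * b + 2 * b'.
Proof.
move=> h1 h2; apply: le_trans (ler_normD _ _) _.
have h3 := tr_le (2 * (gram xh w j / c) - 2 * p j).
have h4 : `|2 * (gram xh w j / c) - 2 * p j| <= 2 * b' + 2 * b.
  by apply: le_trans (ler_normB _ _) _; rewrite 2!(normrM 2) (ger0_norm (ler0n R 2)); lra.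
lra.
Qed.

(** Truncation moves each coordinate by at most 1. *)
Lemma advance_dot u w p : (forall j, `|u j| <= 1) ->
  2 * (dot u (gram xh w) / c) - dot u p - d%:R <= dot u (advance w p).
Proof.
move=> hu; rewrite -subr_ge0.
have -> : dot u (advance w p) - (2 * (dot u (gram xh w) / c) - dot u p - d%:R) =
  \sum_j (u j * (tr (2 * (gram xh w j / c) - 2 * p j)
            - (2 * (gram xh w j / c) - 2 * p j)) + 1).
  rewrite big_split /= sumr_const card_ord.
  rewrite (_ : 1 *+ d = d%:R) // (_ : _ - _ = dot u (advance w p) +
     (2 * (-1 * dot u (gram xh w) / c) + dot u p) + d%:R); last by ring.
  congr (_ + _); rewrite /dot mulr_sumr mulr_suml mulr_sumr -!big_split /=.
  by apply: eq_bigr => j _; rewrite /advance; ring.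
apply: sumr_ge0 => j _.
have h := tr_dist (2 * (gram xh w j / c) - 2 * p j).
set t := (X in u j * X).
have : `|u j * t| <= 1 by rewrite normrM -[leRHS]mulr1 ler_pM.
by rewrite ler_norml => /andP[h1 _]; lra.
Qed.

End Iteration.

(** * Growth along an eigenvector *)

Section Analysis.
Variables (R : realType) (d n N : nat) (x : 'I_n -> 'I_d -> R).
Variables (th rho W0 S D : R).
Hypothesis d1 : (0 < d)%N.
Hypothesis n1 : (0 < n)%N.
Hypothesis N1 : (0 < N)%N.
Hypothesis th0 : 0 < th.
Hypothesis th1 : th <= 4^-1.
Hypothesis rhoE : exists s, [/\ 0 < s, s ^+ 2 = th & rho = 1 + s].
Hypothesis W1 : 1 <= W0.
Hypothesis SE : S = 8 * d%:R * N%:R * W0 / th.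
Hypothesis DW : D <= th * W0 ^+ 2.
Hypothesis xle : forall i j, `|x i j| <= 1.
Hypothesis nz : forall j, (\sum_i (x i j != 0)%R <= N)%N.

Definition rounded i j := tr (S * x i j).
Let xh := rounded.

(** A component along u of at least [tau] makes the loss of d by truncation at
    most th / 2 times the component. *)
Definition tau : R := 2 * d%:R / th.

(** No growth factor exceeds [Theta]: the component along u of the last iterate
    that fails the test is at most d * W0, and one more step at most doubles
    the factor. *)
Definition Theta : R := 2 * d%:R * W0.

(** Bounds the coordinates of a Gram product: every column has at most N
    non-zero entries, and vector and data have entries at most S. *)
Definition digit_bound : R := N%:R * d%:R * S ^+ 3.

Let dR : 1 <= d%:R :> R. Proof. by rewrite ler1n. Qed.
Let nR : 1 <= n%:R :> R. Proof. by rewrite ler1n. Qed.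
Let NR : 1 <= N%:R :> R. Proof. by rewrite ler1n. Qed.

Lemma th_S : th * S = 8 * (d%:R * N%:R * W0).
Proof. by rewrite SE; field; rewrite gt_eqF. Qed.

Ltac arith := move: W1 th0 th1 dR nR NR => ? ? ? ? ? ?; first [lra | nra].

Let dNW : 1 <= d%:R * N%:R * W0.
Proof. by apply: mulr_ege1 => //; apply: mulr_ege1. Qed.

Lemma S_ge : 32 * (d%:R * N%:R * W0) <= S.
Proof.
have h : 0 < S by rewrite -(pmulr_rgt0 _ th0) th_S; move: dNW; arith.
have : th * S <= 4^-1 * S by rewrite ler_pM2r.
by rewrite th_S => ?; move: dNW; arith.
Qed.

Let dW : W0 <= d%:R * N%:R * W0.
Proof.
have W00 : 0 <= W0 by arith.
by rewrite ler_peMl //; apply: mulr_ege1.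
Qed.

Ltac arith ::= move: W1 th0 th1 dR nR NR dNW dW => ? ? ? ? ? ? ? ?; first [lra | nra].

Lemma W0_S : W0 <= S.
Proof. have := S_ge; arith. Qed.

Let S0 : 0 < S.
Proof. have := S_ge; arith. Qed.

Ltac arith ::= move: W1 th0 th1 dR nR NR dNW dW S0 => ? ? ? ? ? ? ? ? ?; first [lra | nra].

(** A sum over the rows has at most N non-zero terms; this is what makes the
    rounding errors depend on N and not on n. *)
Lemma coef_bound (f : 'I_n -> R) j b :
  (forall i, `|f i| <= b) -> (forall i, x i j = 0 -> f i = 0) ->
  `|\sum_i f i| <= N%:R * b.
Proof.
move=> h1 h2; apply: le_trans (ler_norm_sum _ _ _) _.
have b0 : 0 <= b by apply: le_trans (h1 (Ordinal n1)).
apply: (@le_trans _ _ (\sum_i (x i j != 0)%:R * b)).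
  apply: ler_sum => i _; case: eqP => [e|_]; rewrite ?mul1r //.
  by rewrite h2 // normr0 mul0r.
by rewrite -mulr_suml ler_wpM2r // -natr_sum ler_nat.
Qed.

Lemma rounded_le i j : `|xh i j| <= S.
Proof.
apply: le_trans (tr_le _) _; rewrite normrM gtr0_norm //.
by rewrite ler_piMr // ltW.
Qed.

Lemma rounded0 i j : x i j = 0 -> xh i j = 0.
Proof. by rewrite /xh /rounded => ->; rewrite mulr0 tr0. Qed.

Lemma coef_le j l : `|\sum_i xh i j * xh i l| <= N%:R * S ^+ 2.
Proof.
apply: coef_bound (j) _ _ _ => i; last by move=> /rounded0 ->; rewrite mul0r.
by rewrite normrM expr2 ler_pM // rounded_le.
Qed.

Lemma coef_dist j l :
  `|\sum_i xh i j * xh i l - S ^+ 2 * \sum_i x i j * x i l| <= N%:R * (2 * S).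
Proof.
rewrite mulr_sumr -sumrB; apply: coef_bound (j) _ _ _ => i; first last.
  by move=> h; rewrite rounded0 // h !mul0r mulr0 subrr.
have -> : xh i j * xh i l - S ^+ 2 * (x i j * x i l) =
  (xh i j - S * x i j) * xh i l + (S * x i j) * (xh i l - S * x i l) by ring.
apply: le_trans (ler_normD _ _) _; rewrite !normrM (gtr0_norm S0).
have h1 := tr_dist (S * x i j); have h2 := tr_dist (S * x i l).
have h3 := rounded_le i l; have h4 := xle i j.
have : `|xh i j - S * x i j| * `|xh i l| <= 1 * S by rewrite ler_pM.
have : S * `|x i j| * `|xh i l - S * x i l| <= S * 1 * 1.
  by rewrite ler_pM // ?ler_pM2l // mulr_ge0 // ltW.
arith.
Qed.

Lemma gram_digit w j : (forall l, `|w l| <= S) -> `|gram xh w j| <= digit_bound.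
Proof.
move=> h; apply: le_trans (gram_le _ (coef_le j)) _.
have := sum_abs_le h; rewrite /digit_bound => hh.
apply: (@le_trans _ _ (N%:R * S ^+ 2 * (d%:R * S))); last by rewrite le_eqVlt; apply/orP; left; apply/eqP; ring.
by rewrite ler_pM2l // mulr_gt0 ?exprn_gt0 //; arith.
Qed.

Variable a : R.
Hypothesis a_lo : th * n%:R / 2 <= a.
Hypothesis a_hi : a <= n%:R.
Let c := a * S ^+ 2.

Let a_th : th / 2 <= a.
Proof.
by apply: le_trans a_lo; rewrite ler_pM2r ?invr_gt0 // ler_peMr // ltW.
Qed.

Let a0 : 0 < a. Proof. move: a_th; arith. Qed.

Let S20 : 0 < S ^+ 2. Proof. by rewrite exprn_gt0. Qed.

Let c0 : 0 < c. Proof. by rewrite mulr_gt0. Qed.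

Ltac arith' := move: W1 th0 th1 dR nR NR dNW dW S0 a_th a0 S20 a_lo a_hi => ? ? ? ? ? ? ? ? ? ? ? ? ? ?; first [lra | nra].

Variables (u : 'I_d -> R) (nu : R).
Hypothesis u_le : forall j, `|u j| <= 1.
Hypothesis u_ev : forall w, dot u (gram x w) = nu * dot u w.

Implicit Types (g : R) (w p : 'I_d -> R) (big : Prop).

(** Here g is the growth factor reached so far, and big stands for the case in
    which the eigenvalue exceeds the guess a by a margin and the start has a
    sufficient component along u.  The other conjuncts hold in any case, since
    the machine must not leave the range of the digits even for a bad start. *)
Definition inner_inv big g w p :=
  [/\ forall j, w j \is a Num.int /\ p j \is a Num.int,
      forall j, `|w j| <= S /\ `|p j| <= S,
      energy xh c w p <= D, dot p (gram xh p) <= (1 - th) * c * dot p p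
    & big -> [/\ a + th * n%:R <= nu, g <= Theta, g * tau <= dot u w,
         0 <= dot u p & rho * dot u p <= dot u w]].

Lemma le_of_sqr w (b : R) j : 0 <= b -> dot w w <= b ^+ 2 -> `|w j| <= b.
Proof.
move=> b0 h; rewrite -(@ler_pXn2r _ 2) ?nnegrE // real_normK ?num_real //.
exact: le_trans (sqr_le_dot _ _) h.
Qed.

Let tau1 : 1 <= tau.
Proof.
rewrite /tau ler_pdivlMr //; arith'.
Qed.

Ltac arith' ::= move: tau1 W1 th0 th1 dR nR NR dNW dW S0 a_th a0 S20 a_lo a_hi => ? ? ? ? ? ? ? ? ? ? ? ? ? ? ?; first [lra | nra].

(** As long as the test fails, energy bounds the iterates by W0.  Their component
    along u grows by rho, because rho = 1 + s with s ^ 2 = th satisfies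
    rho (2 + th - rho) = 1 + s ^ 3, where half of the gain 2 th of the exact
    step has been given up for truncation. *)
Lemma inner_step big g w p : 1 <= g -> inner_inv big g w p ->
  dot w (gram xh w) <= (1 - th) * c * dot w w ->
  inner_inv big (g * rho) (advance xh c w p) w.
Proof.
move=> g1 [wi wS hE hp hb] hw.
have [s [s0 s2 rE]] := rhoE.
have hn : dot w w + dot p p <= W0 ^+ 2.
  rewrite -(ler_pM2l th0); apply: le_trans (energy_bound c0 hw hp) _.
  exact: le_trans DW.
have W00 : 0 <= W0 by arith'.
have hw0 j : `|w j| <= W0.
  by apply: le_of_sqr => //; have := dot_ge0 p; arith'.
have hp0 j : `|p j| <= W0.
  by apply: le_of_sqr => //; have := dot_ge0 w; arith'.
have sw := sum_abs_le hw0.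
have key : big -> rho * dot u w <= dot u (advance xh c w p).
  move=> /hb [h1 h2 h3 h4 h5].
  have hd := gram_dist u w coef_dist.
  have hu : sum_abs u <= d%:R * 1 by exact: sum_abs_le.
  set al := dot u w in h3 h5 *; set ap := dot u p in h4 h5.
  have e1 : N%:R * (2 * S) * sum_abs u * sum_abs w <=
            N%:R * (2 * S) * d%:R * (d%:R * W0).
    rewrite ler_pM ?sum_abs_ge0 ?mulr_ge0 ?sum_abs_ge0 //; try arith'.
    by rewrite ler_wpM2l ?mulr_ge0 //; arith'.
  have e2 : S ^+ 2 * (nu * al) - N%:R * (2 * S) * d%:R * (d%:R * W0) <=
            dot u (gram xh w).
    by move: hd; rewrite u_ev -/al ler_norml => /andP[hd _]; arith'.
  have e3 : nu * al / a - d%:R / 2 <= dot u (gram xh w) / c.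
    rewrite ler_pdivlMr //; apply: le_trans e2.
    rewrite mulrBl /c (_ : nu * al / a * _ = S ^+ 2 * (nu * al)); last by field; rewrite gt_eqF.
    rewrite lerD2l lerN2.
    have e : 4 * (d%:R * N%:R * W0) <= a * S.
      have := th_S; have : th / 2 * S <= a * S by rewrite ler_pM2r.
      lra.
    rewrite (_ : N%:R * _ * _ * _ = 2^-1 * d%:R * S * (4 * (d%:R * N%:R * W0))); last by field.
    rewrite (_ : d%:R / 2 * _ = 2^-1 * d%:R * S * (a * S)); last by ring.
    by rewrite ler_wpM2l // !mulr_ge0 // ltW.
  have al0 : tau <= al by apply: le_trans h3; rewrite ler_peMl //; arith'.
  have al1 : 0 < al by arith'.
  have e4 : (1 + th) * al <= nu * al / a.
    rewrite ler_pdivlMr // mulrAC ler_pM2r //.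
    apply: le_trans h1; rewrite mulrDl mul1r lerD2l ler_pM2l //.
  have e5 : 2 * d%:R <= th * al by rewrite (mulrC th) -ler_pdivrMr.
  have e6 := advance_dot xh c w p u_le; rewrite -/ap in e6.
  have e7 : 2 * ((1 + th) * al) - 2 * d%:R - ap <= dot u (advance xh c w p) by arith'.
  apply: le_trans e7; suff : al <= rho * (2 * ((1 + th) * al) - 2 * d%:R - rho * al).
    move=> e8; have : rho * ap <= rho * (2 * ((1 + th) * al) - 2 * d%:R - rho * al) by arith'.
    by rewrite ler_pM2l; arith'.
  have r0 : 0 <= rho by arith'.
  apply: (@le_trans _ _ (rho * (2 * ((1 + th) * al) - th * al - rho * al))).
    rewrite (_ : rho * _ = (rho * (2 + th - rho)) * al); last by ring.
    rewrite ler_peMl; [by []|arith'|].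
    rewrite rE -s2 (_ : _ * _ = 1 + s ^+ 3); last by ring.
    by rewrite lerDl exprn_ge0 // ltW.
  by rewrite ler_wpM2l //; arith'.
split=> //.
- by move=> j; have [? ?] := wi j; split=> //; apply: advance_int.
- move=> j; split; last by case: (wS j).
  apply: le_trans (advance_le (b := W0) (b' := 2 * (d%:R * N%:R * W0) / th) _ _) _ => //.
    rewrite normrM normfV (gtr0_norm c0) ler_pdivrMr //.
    apply: le_trans (gram_le _ (coef_le j)) _.
    apply: (@le_trans _ _ (N%:R * S ^+ 2 * (d%:R * W0))).
      by rewrite ler_pM2l // mulr_gt0 //; arith'.
    rewrite (_ : N%:R * S ^+ 2 * _ = (d%:R * N%:R * W0) * S ^+ 2); last by ring.
    rewrite (_ : 2 * _ / th * c = (d%:R * N%:R * W0) * (2 * a / th) * S ^+ 2);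
      last by rewrite /c; ring.
    rewrite ler_pM2r //.
    rewrite ler_peMr; [by []|arith'|].
    by rewrite ler_pdivlMr //; arith'.
  rewrite SE (_ : 8 * _ * _ * _ / _ = 8 * ((d%:R * N%:R * W0) / th)); last by ring.
  rewrite (_ : 2 * (_ / th) = 4 * ((d%:R * N%:R * W0) / th)); last by ring.
  have : W0 <= (d%:R * N%:R * W0) / th.
    by rewrite ler_pdivlMr //; arith'.
  by arith'.
- exact: le_trans (energy_advance xh c0 w p) hE.
- move=> hbig; have [h1 h2 h3 h4 h5] := hb hbig; split=> //.
  + have : dot u w <= d%:R * W0.
      apply: le_trans (ler_norm _) _; apply: le_trans (dot_abs_le _ u_le) _.
      by rewrite mul1r.
    rewrite /Theta => h6.
    have h7 : g <= d%:R * W0.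
      by apply: le_trans (_ : g * tau <= _); [rewrite ler_peMr //; arith'|arith'].
    have r2 : rho <= 2 by rewrite rE; arith'.
    rewrite (_ : 2 * _ * _ = (d%:R * W0) * 2); last by ring.
    by rewrite ler_pM //; arith'.
  + rewrite mulrAC; apply: le_trans (key _); last exact: hbig.
    by rewrite mulrC ler_wpM2l //; arith'.
  + by apply: le_trans h3; rewrite mulr_ge0; arith'.
  + exact: key.
Qed.

Lemma inner_init (big : Prop) v : (forall j, v j \is a Num.int) ->
  (forall j, `|v j| <= W0) -> dot v v <= D ->
  (big -> a + th * n%:R <= nu /\ tau <= dot u v) ->
  inner_inv big 1 v (fun=> 0).
Proof.
move=> vi vle vD hb.
have d0 f : dot (fun=> 0) f = 0 by apply: big1 => j _; rewrite mul0r.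
have d0' f : dot f (fun=> 0) = 0 by rewrite dotC d0.
split=> //.
- move=> j; split; first by apply: le_trans (vle j) W0_S.
  by rewrite normr0 ltW.
- by rewrite /energy !d0 mul0r mulr0 subr0 addr0.
- by rewrite !d0 mulr0.
- move=> /hb[h1 h2]; split=> //; rewrite ?d0' ?mulr0 ?mul1r //; last by arith'.
  by rewrite /Theta; arith'.
Qed.

(** The test loses th * a <= th * n; the passage from the truncated to the true
    data loses another th * n, thanks to the choice of S. *)
Lemma pass_quality w :
  (1 - th) * c * dot w w < dot w (gram xh w) ->
  (a - 2 * th * n%:R) * dot w w <= dot w (gram x w).
Proof.
move=> h.
have := gram_dist w w coef_dist; rewrite -mulrA -expr2 => h1.
have h2 := sum_abs_sqr w.
have h3 : N%:R * (2 * S) * sum_abs w ^+ 2 <= N%:R * (2 * S) * (d%:R * dot w w).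
  by rewrite ler_wpM2l // !mulr_ge0 // ltW.
have h4 : dot w (gram xh w) - S ^+ 2 * dot w (gram x w) <= N%:R * (2 * S) * (d%:R * dot w w).
  apply: le_trans h3; apply: le_trans h1; exact: ler_norm.
rewrite -(ler_pM2l S20).
have ww := dot_ge0 w.
have h5 : N%:R * (2 * S) * (d%:R * dot w w) <= th * S ^+ 2 * dot w w.
  rewrite (_ : N%:R * _ * _ = (2 * (d%:R * N%:R)) * S * dot w w); last by ring.
  rewrite (_ : th * S ^+ 2 * _ = th * S * S * dot w w); last by ring.
  rewrite ler_wpM2r // ler_wpM2r ?(ltW S0) //.
  rewrite th_S; apply: (@le_trans _ _ (8 * (d%:R * N%:R))).
    by rewrite ler_pM2r ?mulr_gt0; arith'.
  by rewrite ler_pM2l // ler_peMr // mulr_ge0.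
have h6 : th * a * S ^+ 2 * dot w w <= th * n%:R * S ^+ 2 * dot w w.
  by rewrite !ler_wpM2r // ?ler_wpM2l //; arith'.
have h7 : th * S ^+ 2 * dot w w <= th * n%:R * S ^+ 2 * dot w w.
  by rewrite !ler_wpM2r // ?ler_peMr //; arith'.
rewrite /c in h; arith'.
Qed.

End Analysis.

(** * Parameters of the algorithm and layout of the memory *)

(** The number registers 0 to 12 and the real registers 0 to 19 are filled once
    and for all, as listed in [cN] and [cR] below.  The real memory keeps the N
    entries, followed by arrays of length d: number 0 contains the powers B^k
    attached to the columns, 1 the packed columns of the Gram matrix, 2 the
    start vector, 3 and 4 the current iterate and the previous one, and 5 the
    best unit vector found.  Where array 6 would begin there are the packed
    rows of the data.  The non-zero columns are listed in the number memory
    from address 2 N on. *)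
Definition setup_layout := block [::
  NConst 4 1; NAdd 5 2 1; NAdd 6 5 1; NAdd 7 6 1; NAdd 8 7 1; NAdd 9 8 1;
  NAdd 10 9 1; NAdd 11 2 2;
  ROfNat 2 4; ROfNat 3 2; ROfNat 4 1; ROfNat 5 0; RAdd 8 2 2; RDiv 9 2 8]%N.

Definition setup_clamp := If (RLe 2 0) (Op (RMul 0 2 2)) Skip.

Definition setup_bound := block [::
  RMul 6 0 9; RMul 6 6 9; RDiv 20 2 1; RAdd 21 8 8; RMul 21 21 4; RDiv 21 21 6;
  RAdd 21 21 20; NConst 12 1; RMul 10 2 2]%N.

(** Doubles M, which is kept in number register 12 and in real register 10, until
    it exceeds [start_bound]. *)
Definition setup_double :=
  While (RLe 10 21) (block [:: NAdd 12 12 12; RAdd 10 10 10]%N).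

Definition setup_scales := block [::
  RMul 11 10 10; RMul 11 11 4; RDiv 11 11 6;
  RMul 12 8 4; RMul 12 12 11;
  RAdd 13 8 8; RAdd 13 13 13; RMul 13 13 4; RMul 13 13 3; RMul 13 13 11;
  RDiv 13 13 6; RMul 18 13 13;
  RMul 14 18 13; RMul 14 3 14; RMul 14 4 14; RMul 14 8 14; RAdd 14 14 2;
  RSqrt 15 6; RAdd 15 15 2; RMul 16 6 5; RSub 17 2 6; RAdd 19 12 2;
  RAdd 20 2 7]%N.

Definition setup :=
  seqs [:: setup_layout; setup_clamp; setup_bound; setup_double; setup_scales].

Ltac lookup := repeat match goal with |- context [@upd ?T ?f ?a ?v ?b] =>
  let t := eval cbv beta iota delta [eqn] in (eqn b a) in
  match t with
  | true => change (@upd T f a v b) with v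
  | false => change (@upd T f a v b) with (f b)
  end end.

Ltac step := apply: does_cons;
  cbv beta iota delta [exec_op set_nreg set_rreg]; cbn [nreg rreg nmem rmem];
  lookup.

(** Names the value that has just been computed, before the next instruction is
    executed on it. *)
Lemma does_val (R : realType) (c : prog) (nr : nat -> nat) (rr : nat -> R) nm rm
    a v' v k Q : v = v' -> does c (State nr (upd rr a v') nm rm) k Q ->
  does c (State nr (upd rr a v) nm rm) k Q.
Proof. by move=> ->. Qed.

Section Layout.
Variables (R : realType) (n d N M : nat) (e p : R).

Definition theta : R := e * 2^-1 * 2^-1.

(** The draws range over 0, ..., M with M above this: it exceeds 2 * tau, so that
    at most one value of a draw can be bad, and 1 / p, so that this value is
    unlikely. *)
Definition start_bound : R := 4 * d%:R / theta + p^-1.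

(** The start vector has entries at most M ^ 2, hence energy at most d * M ^ 4,
    and this is at most theta * Wbound ^ 2. *)
Definition Wbound : R := M%:R * M%:R * d%:R / theta.
Definition scale : R := 8 * d%:R * N%:R * Wbound / theta.

(** Digits may be negative, with absolute value at most [digit_bound]. *)
Definition radix : R := 2 * digit_bound d N scale + 1.

Definition cN : nat -> nat := nth 0%N [:: n; d; N; 0; 1; N + 1 * d; N + 2 * d;
  N + 3 * d; N + 4 * d; N + 5 * d; N + 6 * d; N + N; M]%N.

Definition cR : nat -> R := nth 0 [:: e; p; 1; N%:R; d%:R; n%:R; theta; 0; 2;
  2^-1; M%:R; Wbound; Theta d Wbound; scale; radix; 1 + Num.sqrt theta;
  theta * n%:R; 1 - theta; scale ^+ 2; Theta d Wbound + 1].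

Definition regs_ok (s : state R) :=
  (forall r, (r < 20)%N -> nreg s r = cN r) /\
  (forall r, (r < 20)%N -> rreg s r = cR r).
End Layout.

Section Setup.
Variable R : realType.

(** The doubling of M stops below twice the bound, which limits its cost and the
    magnitude of everything derived from M. *)
Lemma does_setup (n d N l : nat) (eps p : R) (s : state R) :
  let e := Num.min eps 1 in
  let bound := start_bound d e p in
  (0 < d)%N -> (0 < N)%N -> 0 < eps -> 0 < p ->
  bound < 2 ^+ l ->
  nreg s =1 nth 0%N [:: n; d; N] -> rreg s =1 nth 0 [:: eps; p] ->
  does setup s (6 * l + 110) (fun s' => exists M : nat,
    [/\ bound < M%:R <= 2 * bound, regs_ok n d N M e p s',
      nreg s' 20%N = 0%N, rreg s' 20%N = 1 & nmem s' = nmem s /\ rmem s' = rmem s]).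
Proof.
move=> e bound d0 N0 eps0 p0 bl hn hr.
have e0 : 0 < e by rewrite /e lt_min eps0 ltr01.
have th0 : 0 < theta e by rewrite /theta !mulr_gt0.
have b1 : 1 <= bound.
  have : 4 <= 4 * d%:R / theta e.
    rewrite ler_pdivlMr // ler_pM2l //.
    have : 1 <= d%:R :> R by rewrite ler1n.
    have : e <= 1 by rewrite ge_min lexx orbT.
    by rewrite /theta; lra.
  have : 0 < p^-1 by rewrite invr_gt0.
  by rewrite /bound /start_bound; lra.
apply: (@does_imp _ _ _ (30 + (2 + (20 + ((l * 6 + 1) + (50 + 1).+1).+1).+1).+1).+1);
  [by lia|by move=> s'; exact: id|].
case: s hn hr => nr rr nm rm /= hn hr.
have Mth b : (2 ^ b)%:R = 2 ^+ b :> R by rewrite natrX.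
apply: does_then; do 14! step; apply: does_nil.
rewrite ?hn ?hr /=.
apply: does_then.
set Q := fun s1 : state R => _.
set nr1 := (X in State X).
suff h rr' : rr' 0%N = e -> (forall r, r != 0%N -> rr' r =
    nth 0 [:: eps; p; 1; N%:R; d%:R; n%:R; 0; 0; 2; 2^-1] r) ->
    Q (State nr1 rr' nm rm).
  set rr1 := (X in State nr1 X).
  have rr1E : rr1 =1 nth 0 [:: eps; p; 1; N%:R; d%:R; n%:R; 0; 0; 2; 2^-1].
    move=> r; rewrite /rr1 !updE hr.
    do 10! (case: r => [|r] /=; rewrite ?div1r //).
    by rewrite !nth_nil.
  have ee : rr1 0%N = eps by rewrite rr1E.
  apply: does_if => /=; rewrite rr1E ee /= => he.
    apply: does_op; rewrite /= /set_rreg /=; apply: h; rewrite ?updE /=.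
      by rewrite rr1E mulr1 /e min_r.
    by move=> r r0; rewrite updE (negbTE r0) rr1E.
  apply: does_skip => //; apply: h => //.
  by rewrite ee /e min_l // ltW // ltNge he.
move=> r0 hr'; rewrite /Q.
have r1 := hr' 1%N isT; have r2 := hr' 2%N isT; have r3 := hr' 3%N isT.
have r4 := hr' 4%N isT; have r5 := hr' 5%N isT; have r7 := hr' 7%N isT.
have r8 := hr' 8%N isT; have r9 := hr' 9%N isT.
rewrite /= in r1 r2 r3 r4 r5 r7 r8 r9.
have nr1E r : (r < 12)%N -> nr1 r = cN n d N 0 r.
  rewrite /nr1 /cN !updE hn.
  by do 12! (case: r => [|r]; first by move=> _ /=; lia).
have nr20 : nr1 20%N = 0%N by rewrite /nr1 !updE hn.
apply: does_then; do 9! step; apply: does_nil.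
rewrite r0 r1 r2 r4 r8 r9 mulr1.
rewrite (_ : (2 + 2) * d%:R / _ + _ = bound); last first.
  by rewrite /bound /start_bound /theta -natrD div1r.
rewrite (_ : e * _ * _ = theta e) // div1r.
set rr2 := (X in upd X 10).
apply: does_then.
apply: (does_imp (leqnn _) _ (does_while (I := fun i s' => s' =
    State (upd nr1 12 (2 ^ i)%N) (upd rr2 10 (2 ^+ i)) nm rm /\
    (2 ^+ i : R) <= 2 * bound) _ _)) => //; first last.
- move=> i s' [-> hi] /=; rewrite !updE /=.
  rewrite [rr2 21%N]/rr2 !updE /= => le.
  split.
    rewrite ltnNge; apply/negP => li.
    have : (2 : R) ^+ l <= 2 ^+ i by rewrite ler_eXn2l // ltr1n.
    by lra.
  do 2! step; apply: does_nil; split; last by rewrite exprS; lra.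
  congr State; apply/funext => r; rewrite !updE; case: eqP => // _.
    by rewrite expnS mul2n addnn.
  by rewrite exprS mulr_natl mulr2n.
- by split=> //; rewrite expr0; lra.
move=> s' [[i [-> hi]] /=]; rewrite !updE /= [rr2 21%N]/rr2 !updE /= => /negbT.
rewrite -ltNge => lti.
have rr2E r : (r < 10)%N -> rr2 r = nth 0 [:: e; p; 1; N%:R; d%:R; n%:R; theta e; 0; 2; 2^-1] r.
  rewrite /rr2 !updE.
  by do 10! (case: r => [|r]; first by move=> _ /=; rewrite ?r0 ?r1 ?r2 ?r3 ?r4 ?r5 ?r7 ?r8 ?r9).
set M := (2 ^ i)%N; have ME : (2 ^+ i : R) = M%:R by rewrite natrX.
rewrite ME in lti hi *.
set rr3 := upd rr2 10 M%:R.
have rr3E r : (r < 11)%N -> rr3 r = nth 0 [:: e; p; 1; N%:R; d%:R; n%:R; theta e; 0; 2; 2^-1; M%:R] r.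
  rewrite /rr3 updE; case: eqP => [->//|].
  do 10! (case: r => [|r]; first by move=> _ _; rewrite rr2E).
  by case: r => [|r].
have q0 := rr3E 0%N isT; have q1 := rr3E 1%N isT; have q2 := rr3E 2%N isT.
have q3 := rr3E 3%N isT; have q4 := rr3E 4%N isT; have q5 := rr3E 5%N isT.
have q6 := rr3E 6%N isT; have q7 := rr3E 7%N isT; have q8 := rr3E 8%N isT.
have q9 := rr3E 9%N isT; have q10 := rr3E 10%N isT.
rewrite /= in q0 q1 q2 q3 q4 q5 q6 q7 q8 q9 q10.
move: rr3 rr3E q0 q1 q2 q3 q4 q5 q6 q7 q8 q9 q10 => rr3 rr3E q0 q1 q2 q3 q4 q5 q6 q7 q8 q9 q10.
apply: does_then.
do 3! step; apply: (does_val (v' := Wbound d M e)); first by rewrite q10 q4 q6.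
do 2! step; apply: (does_val (v' := Theta d (Wbound d M e))).
  by rewrite q8 q4.
do 6! step; apply: (does_val (v' := scale d N M e)).
  by rewrite q8 q4 q3 q6 /scale; congr (_ * _ * _ * _ / _); rewrite -!natrD.
step.
apply: (does_val (v' := scale d N M e ^+ 2)); first by rewrite expr2.
do 5! step.
apply: (does_val (v' := radix d N M e)).
  rewrite q8 q4 q3 q2 /radix /digit_bound exprSr.
  by set S := scale d N M e; ring.
do 2! step; apply: (does_val (v' := 1 + Num.sqrt (theta e))).
  by rewrite q6 q2 addrC.
do 4! step.
apply: does_nil.
apply: does_skip => //.
exists M; split; rewrite ?lti ?hi //.
- split=> r lt /=.
    rewrite updE; case: eqP => [->//|]; move: lt.
    do 12! (case: r => [|r]; first by move=> _ _; rewrite nr1E).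
    by rewrite /nr1 !updE hn; do 8! (case: r => [|r] //).
  rewrite /cR !updE.
  move: lt; do 20! (case: r => [|r]; first by move=> _ /=; rewrite ?q0 ?q1 ?q2 ?q3 ?q4 ?q5 ?q6 ?q7 ?q8 ?q9 ?q10 ?addr0) => //.
- by rewrite /= updE /= q2 q7 addr0.
Qed.
End Setup.

(** * Packed tables of the data *)

Definition load_entry :=
  [:: NAdd 22 21 21; NLoad 23 22; NAdd 22 22 4; NLoad 24 22]%N.

Definition rows_body := seqs [::
  block (load_entry ++ [:: NAdd 25 2 24; RLoad 30 25]);
  If (RLe 30 7)
    (block [:: RStore 25 20; NAdd 26 11 20; NStore 26 24; NAdd 20 20 4;
               RAdd 30 20 7; RMul 20 20 14])
    Skip;
  block [:: RLoad 31 21; RMul 50 31 13];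
  trunc_prog;
  block [:: RStore 21 50; NAdd 25 10 23; RLoad 32 25; RMul 33 50 30;
            RAdd 32 32 33; RStore 25 32] ]%N.

Definition gram_body := block (load_entry ++
  [:: RLoad 31 21; NAdd 25 10 23; RLoad 32 25; NAdd 26 5 24; RLoad 33 26;
      RMul 34 31 32; RAdd 33 33 34; RStore 26 33])%N.

Definition tables := seqs [:: down 21 2 rows_body; down 21 2 gram_body].

Lemma upd_hi (T : Type) (f : nat -> T) a v r b : (r < b)%N -> (b <= a)%N ->
  upd f a v r = f r.
Proof. by move=> h1 h2; rewrite updE; case: eqP => // h3; lia. Qed.

Lemma addr_eq N d i i' (j j' : 'I_d) :
  (N + i * d + j == N + i' * d + j')%N = (i == i') && (j == j').
Proof.
rewrite -!addnA eqn_add2l; apply/eqP/andP => [h|[/eqP-> /eqP->] //].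
have dp : (0 < d)%N by case: d j {h j'} => // -[].
have h1 := congr1 (divn^~ d) h; have h2 := congr1 (modn^~ d) h.
rewrite /= !divnMDl // !(divn_small (ltn_ord _)) !addn0 in h1.
rewrite /= !modnMDl !(modn_small (ltn_ord _)) in h2.
by rewrite h1 eqxx; split=> //; apply/eqP/val_inj.
Qed.

Section Dictionary.
Variables (A T : eqType).

(** The loop over the entries counts down, so the columns are listed in the order
    of their last occurrences, beginning with the last one. *)
Fixpoint dict (E : seq (A * T)) : seq T :=
  if E is ij :: E' then
    let c := dict E' in if ij.2 \in c then c else rcons c ij.2
  else [::].

Lemma mem_dict E j : (j \in dict E) = (j \in map snd E).
Proof.
elim: E => //= ij E IH; rewrite inE -IH; case: ifP => h.
  by case: eqP => // ->.
by rewrite mem_rcons inE.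
Qed.

Lemma dict_uniq E : uniq (dict E).
Proof.
by elim: E => //= ij E IH; case: ifPn => // h; rewrite rcons_uniq h.
Qed.

Lemma size_dict E : (size (dict E) <= size E)%N.
Proof. by elim: E => //= ij E IH; case: ifP => _; [exact: leqW|rewrite size_rcons]. Qed.

Variables (R : realType) (B : R).

(** Being 0 off the list, it also serves as the test for membership in it. *)
Definition pw (c : seq T) j : R := if j \in c then B ^+ index j c else 0.

Lemma pw_rcons c j l : j \notin c -> pw (rcons c j) l =
  if l == j then B ^+ size c else pw c l.
Proof.
move=> h; rewrite /pw mem_rcons inE -cats1 index_cat.
case: eqP => [->|/eqP hl] /=; first by rewrite (negbTE h) /= eqxx addn0.
by case: ifP => // hc; rewrite hc.
Qed.
End Dictionary.

Section Tables.
Variables (R : realType) (n d N M : nat) (e p : R) (x : 'I_n -> 'I_d -> R).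
Variables (E : seq ('I_n * 'I_d)) (ij0 : 'I_n * 'I_d).
Hypothesis sizeE : size E = N.
Hypothesis B0 : 0 < radix d N M e.
Let S := scale d N M e.
Let B := radix d N M e.
Let xh := rounded x S.

(** The entries from t on have been processed: they have been replaced by their
    truncated multiples, and the packed rows contain them. *)
Record rows_inv (k t : nat) (cs : seq 'I_d) (s : state R) : Prop := RowsInv {
  ri_regs : regs_ok n d N M e p s;
  ri_idx : nreg s 21%N = k;
  ri_cnt : nreg s 20%N = size cs;
  ri_pow : rreg s 20%N = B ^+ size cs;
  ri_pos : forall k, (k < N)%N -> nmem s (k + k)%N = (nth ij0 E k).1 /\
     nmem s (k + k + 1)%N = (nth ij0 E k).2;
  ri_cols : forall k, (k < size cs)%N -> nmem s (N + N + k)%N = nth ij0.2 cs k;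
  ri_ent : forall k, (k < N)%N -> rmem s k = let ij := nth ij0 E k in
     if (k < t)%N then x ij.1 ij.2 else xh ij.1 ij.2;
  ri_pw : forall j : 'I_d, rmem s (N + 0 * d + j)%N = pw B cs j;
  ri_zero : forall i (j : 'I_d), (0 < i < 6)%N -> rmem s (N + i * d + j)%N = 0;
  ri_rows : forall i : 'I_n, rmem s (N + 6 * d + i)%N =
     \sum_(ij <- drop t E | ij.1 == i) xh ij.1 ij.2 * pw B cs ij.2 }.

Lemma rows_inv_set s k k' t cs :
  rows_inv k t cs s -> rows_inv k' t cs (set_nreg s 21 k').
Proof.
case=> -[h1 h1'] h2 h3 h4 h5 h6 h7 h8 h9 h10; split=> //.
by split=> // r lt; rewrite /= (upd_hi _ _ lt) // h1.
Qed.

Lemma does_rows_body l t s : (t < N)%N ->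
  (forall i j, `|S * x i j| < 2 ^+ l) ->
  rows_inv t.+1 t.+1 (dict (drop t.+1 E)) s ->
  does rows_body (set_nreg s 21 t) (10 * l + 100) (rows_inv t t (dict (drop t E))).
Proof.
move=> tN hl /(@rows_inv_set _ _ t) inv.
have dropE : drop t E = nth ij0 E t :: drop t.+1 E by rewrite -drop_nth ?sizeE.
set cs := dict (drop t.+1 E) in inv; set cs' := dict (drop t E).
set i := (nth ij0 E t).1; set j := (nth ij0 E t).2.
have csE : cs' = if j \in cs then cs else rcons cs j by rewrite /cs' dropE.
apply: (@does_imp _ _ _ (13 + (16 + (5 + ((10 * l + 30) + (13 + 1).+1).+1).+1).+1).+1);
  [by lia|by move=> s'; exact: id|].
case: (set_nreg s 21 t) inv => {s} nr rr nm rm.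
move=> [[/= hN hR] h21 h20 hp20 hpos hcols hent hpw hz hrows].
apply: does_then.
rewrite /load_entry /=.
do 6! step; apply: does_nil.
have n4 := hN 4 isT; have n2 := hN 2 isT; rewrite /cN /= in n2 n4.
have [pos1 pos2] := hpos _ tN.
rewrite n4 n2 h21 pos1 pos2 -/i -/j.
rewrite (_ : rm (N + j)%N = pw B cs j); last by rewrite -hpw addn0.
pose Q1 s1 := [/\ rows_inv t t.+1 cs' s1, nreg s1 23%N = i, nreg s1 24%N = j
   & rreg s1 30%N = pw B cs' j].
apply: (does_seq (Q1 := Q1)).
  have r7 := hR 7 isT; have r14 := hR 14 isT; have n11 := hN 11 isT.
  rewrite /cN /cR /= in r7 r14 n11.
  have posP : (pw B cs j <= 0) = (j \notin cs).
    by rewrite /pw; case: ifP => _; rewrite ?lexx // leNgt exprn_gt0.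
  apply: does_if; rewrite /=; lookup; rewrite r7 posP => hj.
    do 6! step; apply: does_nil.
    rewrite n4 n11 h20 r7 r14 hp20 addr0 -exprSr.
    have csE' : cs' = rcons cs j by rewrite csE (negbTE hj).
    split=> //; last by rewrite /= updE /= csE' pw_rcons // eqxx.
    split=> //=.
    - by split=> r lt; rewrite /= !(upd_hi _ _ lt) // ?hN ?hR.
    - by rewrite updE /= csE' size_rcons addn1.
    - by rewrite updE /= csE' size_rcons.
    - move=> k kN; have [q1 q2] := hpos _ kN; split; rewrite updE; case: eqP => // q; lia.
    - move=> k; rewrite csE' size_rcons nth_rcons ltnS leq_eqVlt updE eqn_add2l.
      by case: eqP => [->|_] /=; [rewrite ltnn|move=> lt; rewrite lt hcols].
    - by move=> k kN; rewrite updE hent //; case: eqP => // q; lia.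
    - move=> l'; have := @addr_eq N d 0 0 l' j; rewrite updE !addn0 /= => ->.
      by rewrite csE' pw_rcons //; case: (l' == j) => //; rewrite -hpw ?addn0.
    - move=> k l' lt; rewrite updE hz //; have := @addr_eq N d k 0 l' j.
      by rewrite addn0 => ->; case: k lt.
    - move=> k; rewrite updE hrows; case: eqP => [q|_]; first by have := ltn_ord j; lia.
      rewrite big_seq_cond [RHS]big_seq_cond; apply: eq_bigr => ij /andP[hij _].
      congr (_ * _); rewrite csE' pw_rcons //; case: eqP => // q.
      by move: hj; rewrite mem_dict -q; case/negP; apply: map_f.
  apply: does_skip => //; have csE' : cs' = cs by rewrite csE; move/negbFE: hj => ->.
  rewrite /Q1 csE'; split=> //; split=> //=.
  by split=> r lt; rewrite /= !(upd_hi _ _ lt) // ?hN ?hR.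
move=> {n4 n2 pos1 pos2 h21 h20 hp20 hpos hcols hent hpw hz hrows hN hR}.
move=> [{}nr {}rr {}nm {}rm] [[[/= hN hR] h21 h20 hp20 hpos hcols hent hpw hz hrows] h23 h24 h30].
apply: does_then; do 2! step; apply: does_nil.
have r7 := hR 7 isT; have r13 := hR 13 isT; have r2 := hR 2 isT; have r8 := hR 8 isT.
rewrite /cR /= in r2 r7 r13 r8; rewrite r13 -/S h21 hent //= ltnSn mulrC -/i -/j.
apply: (does_seq (@does_trunc _ _ l (S * x i j) _ _ _ _ _)); rewrite /=; try (lookup; by []).
move=> _ [rr' [/= -> hrr] h50].
apply: does_then; do 6! step; apply: does_nil; apply: does_skip => //.
have n10 := hN 10 isT; rewrite /cN /= in n10.
rewrite n10 h21 h23 h50 (hrr 30%N) //; lookup.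
have ti k : (k < N)%N -> (k == N + 6 * d + i)%N = false by lia.
rewrite updE [X in if X then _ else _]eq_sym ti // hrows h30.
split=> //=.
- split=> r lt; rewrite /= !(upd_hi _ _ lt) // ?hN // hrr; last by lia.
  by rewrite !(upd_hi _ _ lt) // hR.
- by rewrite !updE /= hrr // !updE.
- move=> k kN; rewrite !updE ti //; case: eqP => [->|/eqP q].
    by rewrite ltnn /xh /rounded -/i -/j.
  by rewrite hent // ltnS leq_eqVlt (negbTE q).
- move=> l'; rewrite !updE hpw; case: eqP => [q|_]; first by have := ltn_ord l'; lia.
  by case: eqP => // q; lia.
- move=> k l' /andP[k0 k6]; rewrite !updE hz ?k0 //.
  have : (k * d + l' < 6 * d)%N.
    have := ltn_ord l'; have : (k * d <= 5 * d)%N by rewrite leq_mul2r orbC -ltnS k6.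
    lia.
  by move=> q; case: eqP => [?|_]; first lia; case: eqP => //; lia.
- move=> k; rewrite !updE eqn_add2l dropE big_cons -/i -/j eq_sym val_eqE.
  case: eqP => [->|_] ; first by rewrite addrC.
  rewrite hrows; case: eqP => // q; lia.
Qed.

Let cols := dict E.

Definition row_sum (i : 'I_n) : R := \sum_(ij <- E | ij.1 == i) xh ij.1 ij.2 * pw B cols ij.2.

(** Second pass: each entry adds its multiple of a packed row to the packed Gram
    column of its own column. *)
Record gram_inv (k t : nat) (s : state R) : Prop := GramInv {
  gi_regs : regs_ok n d N M e p s;
  gi_idx : nreg s 21%N = k;
  gi_cnt : nreg s 20%N = size cols;
  gi_pos : forall k, (k < N)%N -> nmem s (k + k)%N = (nth ij0 E k).1 /\
     nmem s (k + k + 1)%N = (nth ij0 E k).2;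
  gi_cols : forall k, (k < size cols)%N -> nmem s (N + N + k)%N = nth ij0.2 cols k;
  gi_ent : forall k, (k < N)%N -> rmem s k = let ij := nth ij0 E k in xh ij.1 ij.2;
  gi_pw : forall j : 'I_d, rmem s (N + 0 * d + j)%N = pw B cols j;
  gi_zero : forall i (j : 'I_d), (1 < i < 6)%N -> rmem s (N + i * d + j)%N = 0;
  gi_rows : forall i : 'I_n, rmem s (N + 6 * d + i)%N = row_sum i;
  gi_gram : forall j : 'I_d, rmem s (N + 1 * d + j)%N =
    \sum_(ij <- drop t E | ij.2 == j) xh ij.1 ij.2 * row_sum ij.1 }.

Lemma gram_inv_set s k k' t :
  gram_inv k t s -> gram_inv k' t (set_nreg s 21 k').
Proof.
case=> -[h1 h1'] h2 h3 h4 h5 h6 h7 h8 h9 h10; split=> //.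
by split=> // r lt; rewrite /= (upd_hi _ _ lt) // h1.
Qed.

Lemma does_gram_body t s : (t < N)%N -> gram_inv t.+1 t.+1 s ->
  does gram_body (set_nreg s 21 t) 30 (gram_inv t t).
Proof.
move=> tN /(@gram_inv_set _ _ t).
have dropE : drop t E = nth ij0 E t :: drop t.+1 E by rewrite -drop_nth ?sizeE.
set i := (nth ij0 E t).1; set j := (nth ij0 E t).2.
case: (set_nreg s 21 t) => {s} nr rr nm rm.
move=> [[/= hN hR] h21 h20 hpos hcols hent hpw hz hrows hg].
rewrite /gram_body /load_entry /=.
do 12! step; apply: does_nil.
have n4 := hN 4 isT; have n5 := hN 5 isT; have n10 := hN 10 isT.
rewrite /cN /= in n4 n5 n10.
have [pos1 pos2] := hpos _ tN.
rewrite n4 n5 n10 h21 pos1 pos2 -/i -/j hrows hg hent //.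
split=> //=.
- by split=> r lt; rewrite /= !(upd_hi _ _ lt) // ?hN ?hR.
- move=> k kN; rewrite updE hent //; case: eqP => //; lia.
- by move=> l; rewrite updE addr_eq /= hpw.
- by move=> k l /andP[k1 k6]; rewrite updE addr_eq hz ?k1 //; case: eqP k1 => // ->.
- move=> k; rewrite updE; case: eqP => // h; have := ltn_ord j; lia.
- move=> l; rewrite updE addr_eq eqxx /= dropE big_cons -/i -/j eq_sym.
  by case: eqP => [->|_]; rewrite ?hg // addrC.
Qed.

Lemma does_tables l s : (forall i j, `|S * x i j| < 2 ^+ l) ->
  regs_ok n d N M e p s -> nreg s 20%N = 0%N -> rreg s 20%N = 1 ->
  (forall k, (k < N)%N -> nmem s (k + k)%N = (nth ij0 E k).1 /\
     nmem s (k + k + 1)%N = (nth ij0 E k).2) ->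
  (forall k, rmem s k = if (k < N)%N then
      let ij := nth ij0 E k in x ij.1 ij.2 else 0) ->
  does tables s (N * (10 * l + 140) + 20) (fun s' => exists k, gram_inv k 0 s').
Proof.
move=> hl hr hn20 hr20 hpos hmem.
apply: (@does_imp _ _ _ ((N * (10 * l + 100 + 3) + 3) + ((N * (30 + 3) + 3) + 1).+1).+1);
  [by lia|by move=> s'; exact: id|].
apply: (does_seq (Q1 := rows_inv 0 0 (dict (drop 0 E)))).
  apply: (does_down (I := fun t => rows_inv t t (dict (drop t E)))).
  - by case: hr => hN _; rewrite hN.
  - by case: hr => hN _; rewrite hN.
  - apply: (@rows_inv_set _ (nreg s 21)); rewrite drop_oversize ?sizeE //; split=> //.
    + by move=> k kN; rewrite hmem /= kN.
    + by move=> j; rewrite hmem; case: ltnP => // h; lia.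
    + by move=> i j h; rewrite hmem; case: ltnP => // h'; lia.
    + move=> i; rewrite drop_oversize ?sizeE // big_nil hmem.
      by case: ltnP => // h; lia.
  - by move=> i s' [[hN _] -> _ _ _ _ _ _ _ _]; rewrite hN.
  - by move=> i s' lt inv; apply: does_rows_body.
move=> s1; rewrite drop0 => -[h1 h2 h3 h4 h5 h6 h7 h8 h9 h10].
apply: (does_seq (Q1 := gram_inv 0 0)); last first.
  by move=> s2 h; apply: does_skip => //; exists 0%N.
apply: (does_down (I := fun t => gram_inv t t)).
- by case: h1 => hN _; rewrite hN.
- by case: h1 => hN _; rewrite hN.
- apply: (@gram_inv_set _ (nreg s1 21)); split=> //.
  + by move=> i j /andP[i1 i6]; rewrite h9 // i6 (ltnW i1).
  + by move=> i; rewrite h10 drop0.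
  + by move=> j; rewrite h9 // drop_oversize ?sizeE // big_nil.
- by move=> i s' [[hN _] -> _ _ _ _ _ _ _ _]; rewrite hN.
- by move=> i s' lt inv; apply: does_gram_body.
Qed.

End Tables.

(** * Loops over the non-zero columns *)

Definition load_col := [:: NAdd 22 11 21; NLoad 23 22]%N.

Definition restart := down 21 20 (block (load_col ++
  [:: NAdd 24 6 23; RLoad 30 24; NAdd 24 7 23; RStore 24 30;
      NAdd 24 8 23; RStore 24 7]))%N.

Definition packed_product := down 21 20 (block (load_col ++
  [:: NAdd 24 7 23; RLoad 31 24; NAdd 24 5 23; RLoad 32 24;
      RMul 31 31 32; RAdd 30 30 31]))%N.

(** Takes the leading digit y_j off the packed product.  On the way it adds to
    the inner products w . y and w . w and makes the step of the iteration at
    coordinate j. *)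
Definition unpack_body := seqs [::
  block (load_col ++ [:: NAdd 24 2 23; RLoad 33 24; RDiv 50 30 33]);
  If (RLe 7 50) (Op (RAdd 50 50 9)) (Op (RSub 50 50 9));
  trunc_prog;
  block [:: RMul 34 50 33; RSub 30 30 34; NAdd 24 7 23; RLoad 35 24;
    RMul 34 35 50; RAdd 31 31 34; RMul 34 35 35; RAdd 32 32 34;
    NAdd 25 8 23; RLoad 36 25;
    RDiv 50 50 24; RMul 50 8 50; RMul 34 8 36; RSub 50 50 34];
  trunc_prog;
  block [:: RAdd 36 36 50; RStore 24 36; RStore 25 35] ]%N.

Definition save := down 21 20 (block (load_col ++
  [:: NAdd 24 8 23; RLoad 34 24; RDiv 34 34 33; NAdd 24 9 23; RStore 24 34]))%N.

Section LowDigits.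
Variable R : realType.

(** Whatever their signs, the digits below place t amount to less than half of
    B ^ t; so digit t is the integer nearest to the quotient by B ^ t. *)
Lemma low_digits (H : R) (y : nat -> R) t : 0 <= H ->
  (forall k, `|y k| <= H) ->
  2 * `|\sum_(0 <= k < t) y k * (2 * H + 1) ^+ k| < (2 * H + 1) ^+ t.
Proof.
move=> H0 hy; elim: t => [|t IH].
  by rewrite big_nil normr0 mulr0 expr0 ltr01.
rewrite big_nat_recr //= exprS.
set B := 2 * H + 1 in IH *; have Bt : 0 < B ^+ t by rewrite exprn_gt0 // /B; lra.
set s := \sum_(_ <= _ < _) _ in IH *.
have h1 : `|s + y t * B ^+ t| <= `|s| + H * B ^+ t.
  apply: le_trans (ler_normD _ _) _; rewrite lerD2l normrM (gtr0_norm Bt).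
  by rewrite ler_pM2r.
have -> : B * B ^+ t = 2 * (H * B ^+ t) + B ^+ t by rewrite {1}/B; ring.
lra.
Qed.
End LowDigits.

Section Loops.
Variables (R : realType) (n d N M : nat) (e p : R) (xh : 'I_n -> 'I_d -> R).
Variables (cols : seq 'I_d) (j0 j1 : 'I_d).
Hypothesis cols_uniq : uniq cols.
Let S := scale d N M e.
Let B := radix d N M e.

Definition arr (s : state R) i (j : 'I_d) : R := rmem s (N + i * d + j)%N.

Arguments arr : simpl never.

(** Column j1 is that of the first entry: the unit vector there is the first
    candidate for the output. *)
Record env (s : state R) : Prop := Env {
  ev_regs : regs_ok n d N M e p s;
  ev_cnt : nreg s 20%N = size cols;
  ev_cols : forall k, (k < size cols)%N -> nmem s (N + N + k)%N = nth j0 cols k;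
  ev_first : nmem s 1%N = j1;
  ev_pw : arr s 0 =1 pw B cols;
  ev_gram : arr s 1 =1 gram xh (pw B cols) }.

(** The loops over the columns use number registers from 21 on and real registers
    from 30 on as scratch. *)
Definition frame (s s' : state R) :=
  [/\ forall r, (r < 21)%N -> nreg s' r = nreg s r,
      forall r, (r < 30)%N -> rreg s' r = rreg s r & nmem s' = nmem s].

Lemma frame_refl s : frame s s. Proof. by []. Qed.

Lemma frame_set s s' k : frame s s' -> frame s (set_nreg s' 21 k).
Proof. by move=> [h1 h2 h3]; split=> // r lt; rewrite /= (upd_hi _ _ lt) // h1. Qed.

Lemma env_frame s s' : env s -> frame s s' ->
  arr s' 0 =1 arr s 0 -> arr s' 1 =1 arr s 1 -> env s'.
Proof.
move=> [[h1 h1'] h2 h3 h4 h5 h6] [f1 f2 f3] a0 a1; split.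
- by split=> r lt; rewrite ?f1 ?f2 ?h1 ?h1' //; lia.
- by rewrite f1.
- by move=> k lt; rewrite f3 h3.
- by rewrite f3.
- by move=> j; rewrite a0.
- by move=> j; rewrite a1.
Qed.

Lemma env_set s k : env s -> env (set_nreg s 21 k).
Proof. by move=> h; apply: (env_frame h) => //; apply/frame_set/frame_refl. Qed.

(** The loops count down, so these are the columns already visited when t are
    left. *)
Definition treated t j := (t <= index j cols < size cols)%N.

Lemma treated_step t j : (t < size cols)%N ->
  treated t j = (j == nth j0 cols t) || treated t.+1 j.
Proof.
move=> lt; rewrite /treated leq_eqVlt eq_sym andb_orl; congr orb.
apply/andP/eqP => [[/eqP <- h]|->]; first by rewrite nth_index // -index_mem.
by rewrite index_uniq // eqxx lt.
Qed.

Lemma treated_none j : treated (size cols) j = false.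
Proof. by rewrite /treated; apply/negP => /andP[]; lia. Qed.

Lemma treated_all j : treated 0 j = (j \in cols).
Proof. by rewrite /treated /= index_mem. Qed.

Lemma sum_cols (F : 'I_d -> R) : (forall j, j \notin cols -> F j = 0) ->
  \sum_(0 <= k < size cols) F (nth j0 cols k) = \sum_j F j.
Proof.
move=> h; rewrite -(big_nth j0 xpredT F) big_uniq //.
by rewrite [RHS](bigID (mem cols)) /= [X in _ + X]big1 ?addr0.
Qed.

Lemma pw_nth t : (t < size cols)%N -> pw B cols (nth j0 cols t) = B ^+ t.
Proof. by move=> lt; rewrite /pw mem_nth // index_uniq. Qed.

Definition restart_inv s k t (s' : state R) :=
  [/\ env s', nreg s' 21%N = k, frame s s',
    forall j, arr s' 3 j = if treated t j then arr s 2 j else arr s 3 j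
  & (forall j, arr s' 4 j = if treated t j then 0 else arr s 4 j) /\
    (forall i j, i != 3%N -> i != 4%N -> arr s' i j = arr s i j)].

Lemma does_restart s : env s ->
  does restart s (20 * size cols + 10) (fun s' => [/\ env s', frame s s',
    forall j, arr s' 3 j = if j \in cols then arr s 2 j else arr s 3 j
  & (forall j, arr s' 4 j = if j \in cols then 0 else arr s 4 j) /\
    (forall i j, i != 3%N -> i != 4%N -> arr s' i j = arr s i j)]).
Proof.
move=> he; have inv_set k k' t s' : restart_inv s k t s' ->
    restart_inv s k' t (set_nreg s' 21 k').
  by move=> [h1 h2 h3 h4 h5]; split=> //; [exact: env_set|exact: frame_set].
apply: (@does_imp _ _ _ (size cols * (17 + 3) + 3) _ (restart_inv s 0 0)); first by lia.
  move=> s' [h1 h2 h3 h4 [h5 h6]]; split=> //.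
    by move=> j; rewrite h4 treated_all.
  by split=> // j; rewrite h5 treated_all.
apply: (does_down (I := fun t => restart_inv s t t)).
- by rewrite (ev_cnt he).
- by have [-> //] := ev_regs he.
- apply: (@inv_set (nreg s 21)); split=> //; first by move=> j; rewrite treated_none.
  by split=> // j; rewrite treated_none.
- by move=> i s' [h1 -> _ _ _]; have [-> //] := ev_regs h1.
move=> t s' lt /(@inv_set _ t); set j := nth j0 cols t.
case: (set_nreg s' 21 t) => {s'} nr rr nm rm [h1 h2 h3 h4 [h5 h6]]; rewrite /= in h2.
rewrite /load_col /=; do 8! step; apply: does_nil.
have [[/= hN hR] h20 hcols _ _ _] := h1.
have n11 := hN 11 isT; have n6 := hN 6 isT; have n7 := hN 7 isT; have n8 := hN 8 isT.
have r7 := hR 7 isT; rewrite /cN /cR /= in n11 n6 n7 n8 r7.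
rewrite n11 n6 n7 n8 r7 h2 (hcols _ lt) -/j.
set s1 := State _ _ _ _.
have a1 i l : arr s1 i l = if (i == 4%N) && (l == j) then 0 else
   if (i == 3%N) && (l == j) then arr s 2 j else arr (State nr rr nm rm) i l.
  rewrite /arr /= !updE !addr_eq; do 2! case: ifP => // _.
  exact: (h6 2%N).
have f1 : frame s s1.
  move: h3; rewrite /frame /= => -[f1 f2 f3]; split=> // r lt'.
    by rewrite !(upd_hi _ _ lt') // f1.
  by rewrite !(upd_hi _ _ lt') // f2.
split=> //.
- by apply: (env_frame he f1) => l; rewrite a1 /= h6.
- by move=> l; rewrite a1 /= h4 (treated_step _ lt) -/j; case: eqP => [->|].
- split; first by move=> l; rewrite a1 /= h5 (treated_step _ lt) -/j; case: eqP => [->|].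
  by move=> i l i3 i4; rewrite a1 (negbTE i3) (negbTE i4) h6.
Qed.

Definition product_inv s k t (s' : state R) :=
  [/\ env s', nreg s' 21%N = k, frame s s', rmem s' = rmem s
  & rreg s' 30%N = \sum_(t <= k < size cols)
      arr s 3 (nth j0 cols k) * arr s 1 (nth j0 cols k)].

(** The machine adds up w_j times packed column j; by symmetry of the Gram form
    the result contains the coordinates of the product as digits. *)
Lemma does_packed_product s : env s -> rreg s 30%N = 0 ->
  (forall j, j \notin cols -> arr s 3 j = 0) ->
  does packed_product s (20 * size cols + 10) (fun s' =>
    [/\ env s', frame s s', rmem s' = rmem s
    & rreg s' 30%N = \sum_(0 <= k < size cols)
        gram xh (arr s 3) (nth j0 cols k) * B ^+ k]).
Proof.
move=> he hs30 hsupp; have inv_set k k' t s' : product_inv s k t s' ->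
    product_inv s k' t (set_nreg s' 21 k').
  by move=> [h1 h2 h3 h4 h5]; split=> //; [exact: env_set|exact: frame_set].
apply: (@does_imp _ _ _ (size cols * (17 + 3) + 3) _ (product_inv s 0 0)); first by lia.
  move=> s' [h1 h2 h3 h4 h5]; split=> //.
  rewrite h5 (sum_cols (F := fun j => arr s 3 j * arr s 1 j)); last first.
    by move=> j /hsupp ->; rewrite mul0r.
  transitivity (dot (arr s 3) (gram xh (pw B cols))).
    by apply: eq_bigr => j _; rewrite (ev_gram he).
  rewrite gram_sym dotC /dot -(sum_cols (F := fun j => gram xh (arr s 3) j * pw B cols j)).
    by apply: eq_big_nat => k /andP[_ lt]; rewrite pw_nth.
  by move=> j jc; rewrite /pw (negbTE jc) mulr0.
apply: (does_down (I := fun t => product_inv s t t)).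
- by rewrite (ev_cnt he).
- by have [-> //] := ev_regs he.
- by apply: (@inv_set (nreg s 21)); split=> //; rewrite big_geq.
- by move=> i s' [h1 -> _ _ _]; have [-> //] := ev_regs h1.
move=> t s' lt /(@inv_set _ t); set j := nth j0 cols t.
case: (set_nreg s' 21 t) => {s'} nr rr nm rm [h1 h2 h3 h4 h5]; rewrite /= in h2 h4 h5.
rewrite /load_col /=; do 8! step; apply: does_nil.
have [[/= hN hR] h20 hcols _ _ _] := h1.
have n11 := hN 11 isT; have n5 := hN 5 isT; have n7 := hN 7 isT.
rewrite /cN /= in n11 n5 n7.
rewrite n11 n5 n7 h2 (hcols _ lt) -/j h5 h4.
set s1 := State _ _ _ _.
have f1 : frame s s1.
  move: h3; rewrite /frame /= => -[f1 f2 f3]; split=> // r lt'.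
    by rewrite !(upd_hi _ _ lt') // f1.
  by rewrite !(upd_hi _ _ lt') // f2.
split=> //; first by apply: (env_frame he f1).
by rewrite /= updE /= [RHS]big_ltn // addrC.
Qed.

Definition save_inv s k t (s' : state R) :=
  [/\ env s', nreg s' 21%N = k, frame s s', rreg s' 33%N = rreg s 33%N
  & (forall j, arr s' 5 j = if treated t j then arr s 4 j / rreg s 33%N
       else arr s 5 j) /\ (forall i j, i != 5%N -> arr s' i j = arr s i j)].

Lemma does_save s : env s ->
  does save s (20 * size cols + 10) (fun s' => [/\ env s', frame s s',
    forall j, arr s' 5 j = if j \in cols then arr s 4 j / rreg s 33%N
      else arr s 5 j
  & forall i j, i != 5%N -> arr s' i j = arr s i j]).
Proof.
move=> he; have inv_set k k' t s' : save_inv s k t s' ->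
    save_inv s k' t (set_nreg s' 21 k').
  by move=> [h1 h2 h3 h4 h5]; split=> //; [exact: env_set|exact: frame_set].
apply: (@does_imp _ _ _ (size cols * (17 + 3) + 3) _ (save_inv s 0 0)); first by lia.
  move=> s' [h1 h2 h3 h4 [h5 h6]]; split=> //.
  by move=> j; rewrite h5 treated_all.
apply: (does_down (I := fun t => save_inv s t t)).
- by rewrite (ev_cnt he).
- by have [-> //] := ev_regs he.
- apply: (@inv_set (nreg s 21)); split=> //.
  by split=> // j; rewrite treated_none.
- by move=> i s' [h1 -> _ _ _]; have [-> //] := ev_regs h1.
move=> t s' lt /(@inv_set _ t); set j := nth j0 cols t.
case: (set_nreg s' 21 t) => {s'} nr rr nm rm [h1 h2 h3 h4 [h5 h6]].
rewrite /= in h2 h4.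
rewrite /load_col /=; do 7! step; apply: does_nil.
have [[/= hN hR] h20 hcols _ _ _] := h1.
have n11 := hN 11 isT; have n8 := hN 8 isT; have n9 := hN 9 isT.
rewrite /cN /= in n11 n8 n9.
rewrite n11 n8 n9 h2 (hcols _ lt) h4 -/j.
set s1 := State _ _ _ _.
have a1 i l : arr s1 i l = if (i == 5%N) && (l == j) then arr s 4 j / rreg s 33%N
    else arr (State nr rr nm rm) i l.
  rewrite /arr /= !updE !addr_eq; case: ifP => // _.
  by congr (_ / _); exact: (h6 4%N).
have f1 : frame s s1.
  move: h3; rewrite /frame /= => -[f1 f2 f3]; split=> // r lt'.
    by rewrite !(upd_hi _ _ lt') // f1.
  by rewrite !(upd_hi _ _ lt') // f2.
split=> //.
- by apply: (env_frame he f1) => l; rewrite a1 /= h6.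
- split; first by move=> l; rewrite a1 /= h5 (treated_step _ lt) -/j; case: eqP => [->|].
  by move=> i l i5; rewrite a1 (negbTE i5) h6.
Qed.

Section Unpack.
Variables (w pp : 'I_d -> R) (c : R) (l : nat).
Let y := gram xh w.
Hypothesis y_int : forall j, y j \is a Num.int.
Hypothesis y_le : forall j, `|y j| <= digit_bound d N S.
Hypothesis y_log : digit_bound d N S + 1 < 2 ^+ l.
Hypothesis z_log : forall j, `|2 * (y j / c) - 2 * pp j| < 2 ^+ l.

Definition unpack_inv s k t (s' : state R) :=
  [/\ env s', nreg s' 21%N = k, frame s s',
    [/\ rreg s' 30%N = \sum_(0 <= k < t) y (nth j0 cols k) * B ^+ k,
      rreg s' 31%N = \sum_(t <= k < size cols) w (nth j0 cols k) * y (nth j0 cols k)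
    & rreg s' 32%N = \sum_(t <= k < size cols) w (nth j0 cols k) * w (nth j0 cols k)]
  & [/\ forall j, arr s' 3 j = if treated t j then advance xh c w pp j else w j,
      forall j, arr s' 4 j = if treated t j then w j else pp j
    & forall i j, i != 3%N -> i != 4%N -> arr s' i j = arr s i j]].

Lemma unpack_inv_set s k k' t s' : unpack_inv s k t s' ->
    unpack_inv s k' t (set_nreg s' 21 k').
Proof.
by move=> [h1 h2 h3 h4 h5]; split=> //; [exact: env_set|exact: frame_set].
Qed.

Lemma digit_near t : (t < size cols)%N ->
  `|(\sum_(0 <= k < t.+1) y (nth j0 cols k) * B ^+ k) / B ^+ t
    - y (nth j0 cols t)| < 2^-1.
Proof.
move=> lt; have H0 : 0 <= digit_bound d N S by apply: le_trans (y_le j0).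
have := low_digits t H0 (fun k => y_le (nth j0 cols k)).
rewrite -/B; have Bt : 0 < B ^+ t by rewrite exprn_gt0 // /B /radix; lra.
move=> h; rewrite big_nat_recr //= mulrDl mulfK ?gt_eqF // addrK.
rewrite normrM normfV (gtr0_norm Bt) ltr_pdivrMr //; lra.
Qed.

Lemma does_unpack_body s t s' : env s -> rreg s 24%N = c -> (t < size cols)%N ->
  unpack_inv s t.+1 t.+1 s' ->
  does unpack_body (set_nreg s' 21 t) (20 * l + 120) (unpack_inv s t t).
Proof.
move=> he hs24 lt /(@unpack_inv_set _ _ t); set j := nth j0 cols t.
case: (set_nreg s' 21 t) => {s'} nr rr nm rm [h1 h2 h3 [h30 h31 h32] [h4 h5 h6]].
rewrite /= in h2 h30 h31 h32.
have [[/= hN hR] h20 hcols _ _ _] := h1.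
have n11 := hN 11 isT; have n2 := hN 2 isT; have n7 := hN 7 isT; have n8 := hN 8 isT.
rewrite /cN /= in n11 n2 n7 n8.
have r7 := hR 7 isT; have r9 := hR 9 isT; have r2 := hR 2 isT; have r8 := hR 8 isT.
rewrite /cR /= in r7 r9 r2 r8.
have r24 : rr 24%N = c by rewrite -hs24; case: h3 => _ f2 _; rewrite -f2.
apply: (@does_imp _ _ _ (12 + (2 + ((10 * l + 30) + (30 + ((10 * l + 30)
   + (7 + 1).+1).+1).+1).+1).+1).+1); [by lia|by move=> s'; exact: id|].
apply: does_then; rewrite /load_col /=; do 5! step; apply: does_nil.
rewrite n11 n2 h2 (hcols _ lt) -/j h30.
rewrite (_ : rm (N + j)%N = B ^+ t); last first.
  by have := ev_pw h1 j; rewrite /arr /= addn0 pw_nth.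
have near := digit_near lt; rewrite -/j in near.
set z := _ / B ^+ t; rewrite -/z in near.
set rr1 := upd rr 33 (B ^+ t).
apply: (does_seq (Q1 := eq (State (upd (upd (upd nr 22 (N + N + t)) 23 j) 24 (N + j))%N
   (upd (upd rr1 50 z) 50 (if 0 <= z then z + 2^-1 else z - 2^-1)) nm rm))).
  apply: does_if; rewrite /= /rr1; lookup; rewrite r7 => ->;
    apply: does_op; cbv beta iota delta [exec_op set_rreg nreg rreg nmem rmem]; lookup;
    by rewrite r9.
move=> _ <-.
apply: (does_seq (@does_trunc _ _ l (if 0 <= z then z + 2^-1 else z - 2^-1) _ _ _ _ _));
   rewrite /= /rr1; lookup; rewrite ?r7 ?r2 ?r8 //.
  have h : `|z| <= digit_bound d N S + 2^-1.
    have := y_le j; rewrite (_ : z = (z - y j) + y j); last by ring.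
    by move=> h; apply: le_trans (ler_normD _ _) _; lra.
  apply: le_lt_trans y_log; case: ifP => _.
    by apply: le_trans (ler_normD _ _) _; rewrite (ger0_norm (_ : 0 <= 2^-1)); lra.
  by apply: le_trans (ler_normB _ _) _; rewrite (ger0_norm (_ : 0 <= 2^-1)); lra.
move=> _ [rr2 [/= -> hrr2] h50]; rewrite (tr_nearest (y_int j) near) in h50.
apply: does_then; do 14! step; apply: does_nil.
have e8 : rr2 8%N = 2 by rewrite hrr2 // ?updE.
have e24 : rr2 24%N = c by rewrite hrr2 // ?updE.
have e30 : rr2 30%N = \sum_(0 <= k < t.+1) y (nth j0 cols k) * B ^+ k.
  by rewrite hrr2 // ?updE.
have e31 : rr2 31%N = rr 31%N by rewrite hrr2 // ?updE.
have e32 : rr2 32%N = rr 32%N by rewrite hrr2 // ?updE.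
have e33 : rr2 33%N = B ^+ t by rewrite hrr2 // ?updE.
have [w3 p4] : rm (N + 3 * d + j)%N = w j /\ rm (N + 4 * d + j)%N = pp j.
  have := h4 j; have := h5 j; rewrite /arr /= /treated index_uniq // ltnn /=.
  by move=> -> ->.
rewrite n7 n8 h50 e8 e24 e30 e31 e32 e33 w3 p4 h31 h32.
set zz := 2 * _ - 2 * _.
set rr3 := upd _ 50%N zz.
apply: (does_seq (@does_trunc _ _ l zz _ _ _ _ _)); rewrite /=.
- by rewrite /rr3; lookup; rewrite hrr2 // ?updE.
- by rewrite /rr3; lookup; rewrite hrr2 // ?updE.
- by rewrite /rr3; lookup; rewrite hrr2 // ?updE.
- by [].
- exact: z_log.
move=> _ [rr4 [/= -> hrr4] h50'].
apply: does_then; do 3! step; apply: does_nil; apply: does_skip => //.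
have e36 : rr4 36%N = pp j by rewrite hrr4 // /rr3; lookup.
have e35 : rr4 35%N = w j by rewrite hrr4 // /rr3; lookup.
rewrite e36 e35 h50'.
set s1 := State _ _ _ _.
have a1 i k : arr s1 i k = if (i == 4%N) && (k == j) then w j else
   if (i == 3%N) && (k == j) then advance xh c w pp j else arr (State nr rr nm rm) i k.
  by rewrite /arr /= !updE !addr_eq; do 2! case: ifP => // _.
have f1 : frame s s1.
  move: h3; rewrite /frame /= => -[f1 f2 f3]; split=> // r lt'.
    by rewrite !(upd_hi _ _ lt') // f1.
  have r50 : (r < 50)%N by lia.
  rewrite (upd_hi _ _ lt') // hrr4 // /rr3 !(upd_hi _ _ lt') // hrr2 //.
  by rewrite /rr1 !(upd_hi _ _ lt') // f2.
split=> //.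
- by apply: (env_frame he f1) => k; rewrite a1 /= h6.
- split; rewrite /= updE /= hrr4 // /rr3; lookup.
  + by rewrite big_nat_recr //= addrK.
  + by rewrite [RHS]big_ltn // addrC.
  + by rewrite [RHS]big_ltn // addrC.
- split.
  + by move=> k; rewrite a1 /= h4 (treated_step _ lt) -/j; case: eqP => [->|].
  + by move=> k; rewrite a1 /= h5 (treated_step _ lt) -/j; case: eqP => [->|].
  + by move=> i k i3 i4; rewrite a1 (negbTE i3) (negbTE i4) h6.
Qed.

Definition unpack := down 21 20 unpack_body.

Lemma does_unpack s : env s -> rreg s 24%N = c ->
  rreg s 30%N = \sum_(0 <= k < size cols) y (nth j0 cols k) * B ^+ k ->
  rreg s 31%N = 0 -> rreg s 32%N = 0 ->
  arr s 3 =1 w -> arr s 4 =1 pp ->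
  (forall j, j \notin cols -> w j = 0) ->
  does unpack s ((20 * l + 130) * size cols + 10) (fun s' =>
   [/\ env s', frame s s',
      rreg s' 31%N = dot w y /\ rreg s' 32%N = dot w w
    & [/\ forall j, arr s' 3 j = if j \in cols then advance xh c w pp j else w j,
        forall j, arr s' 4 j = if j \in cols then w j else pp j
      & forall i j, i != 3%N -> i != 4%N -> arr s' i j = arr s i j]]).
Proof.
move=> he hs24 hs30 hs31 hs32 hs3 hs4 hsupp.
apply: (@does_imp _ _ _ (size cols * ((20 * l + 120) + 3) + 3) _ (unpack_inv s 0 0)).
- by rewrite mulnC leq_add // leq_mul2r; apply/orP; right; lia.
- move=> s' [h1 h2 h3 [_ h4 h5] [h6 h7 h8]]; split=> //.
    by rewrite h4 h5; split; apply: sum_cols (fun j => w j * _) _ => j /hsupp ->;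
      rewrite mul0r.
  by split=> // j; rewrite ?h6 ?h7 treated_all.
apply: (does_down (I := fun t => unpack_inv s t t)).
- by rewrite (ev_cnt he).
- by have [-> //] := ev_regs he.
- apply: (@unpack_inv_set _ (nreg s 21)); split=> //.
    by split; rewrite ?hs30 // big_geq.
  by split=> // j; rewrite treated_none ?hs3 ?hs4.
- by move=> i s' [h1 -> _ _ _]; have [-> //] := ev_regs h1.
by move=> t s' lt inv; apply: does_unpack_body.
Qed.

End Unpack.
End Loops.
Arguments arr : simpl never.

(** * Bisection for the largest eigenvalue *)

(** Real registers 20 and 21 contain the ends of the bisection interval, 22 the
    guess a, 23 the length of the interval, 24 the divisor c and 25 the growth
    factor.  Success is signalled by raising the growth factor above [Theta],
    which ends the loop; [probe] recognizes it by the lower end having moved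
    to a. *)
Definition pass := seqs [::
  block [:: RAdd 20 22 7; RSqrt 33 32; RAdd 25 19 7]; save]%N.

Definition iteration := seqs [:: block [:: RAdd 30 7 7]; packed_product;
  block [:: RAdd 31 7 7; RAdd 32 7 7]; unpack;
  block [:: RMul 33 17 24; RMul 33 33 32];
  If (RLe 31 33) (Op (RMul 25 25 15)) pass]%N.

Definition probe := seqs [::
  block [:: RAdd 22 20 21; RMul 22 22 9; RMul 24 22 18; RAdd 25 2 7];
  restart;
  While (RLe 25 12) iteration;
  If (RLe 22 20) Skip (Op (RAdd 21 22 7));
  block [:: RSub 23 21 20] ]%N.

Definition search := seqs [::
  block [:: NLoad 22 4; NAdd 22 9 22; RStore 22 2; RAdd 20 7 7; RAdd 21 5 7;
            RSub 23 21 20];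
  While (RLe 16 23) probe;
  block [:: NAdd 0 9 3] ]%N.

Lemma iteration_cost l z :
  ((4 + ((20 * z + 10) + (6 + (((20 * l + 130) * z + 10)
   + (6 + (((8 + ((20 * z + 10) + 1).+1).+1).+1 + 1).+1).+1).+1).+1).+1).+1
  <= (20 * l + 180) * z + 90)%N.
Proof.
have mul20 b : ((20 * l + b) * z = 20 * (l * z) + b * z)%N by ring.
by rewrite !mul20; lia.
Qed.

Lemma probe_cost K b z :
  ((10 + ((20 * z + 10) + ((K * (b + 90).+1 + 1) + (2 + (4 + 1).+1).+1).+1).+1).+1
  <= K * (b + 91) + 20 * z + 50)%N.
Proof. by rewrite -(addnS b 90); lia. Qed.

Lemma search_cost k z l :
  ((14 + ((l * (k + 20 * z + 50).+1 + 1) + (4 + 1).+1).+1).+1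
  <= l * (k + 20 * z + 51) + 40)%N.
Proof. by rewrite -(addnS _ 50); lia. Qed.

Section Search.
Variables (R : realType) (n d N M : nat) (e p : R) (x : 'I_n -> 'I_d -> R).
Variables (cols : seq 'I_d) (j0 j1 : 'I_d) (v u : 'I_d -> R) (nu : R) (l K : nat).
Let S := scale d N M e.
Let th := theta e.
Let W0 := Wbound d M e.
Let xh := rounded x S.
Let rho := 1 + Num.sqrt th.
Let Th := Theta d W0.
Hypothesis cols_uniq : uniq cols.
Hypothesis cols_supp : forall j, j \notin cols -> forall i, x i j = 0.
Hypothesis j1_cols : j1 \in cols.
Hypothesis d1 : (0 < d)%N.
Hypothesis n1 : (0 < n)%N.
Hypothesis N1 : (0 < N)%N.
Hypothesis e0 : 0 < e.
Hypothesis e1 : e <= 1.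
Hypothesis W1 : 1 <= W0.
Hypothesis xle : forall i j, `|x i j| <= 1.
Hypothesis nz : forall j, (\sum_i (x i j != 0)%R <= N)%N.
Hypothesis v_int : forall j, v j \is a Num.int.
Hypothesis v_le : forall j, `|v j| <= W0.
Hypothesis v_dot : dot v v <= th * W0 ^+ 2.
Hypothesis v_supp : forall j, j \notin cols -> v j = 0.
Hypothesis u_le : forall j, `|u j| <= 1.
Hypothesis u_ev : forall w, dot u (gram x w) = nu * dot u w.
Hypothesis nu_le : nu <= n%:R.
Hypothesis l_digit : digit_bound d N S + 1 < 2 ^+ l.
Hypothesis l_step : 4 * N%:R * d%:R * S / th + 2 * S < 2 ^+ l.
Hypothesis l_th : th^-1 < 2 ^+ l.
Hypothesis K_Theta : Th < rho ^+ K.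

Let E := env N M e p xh cols j0 j1.
Let ar := @arr R d N.
Let good := tau d th <= dot u v.

Let th0 : 0 < th.
Proof. by rewrite /th /theta !mulr_gt0. Qed.

Let th1 : th <= 4^-1.
Proof. move: e1; rewrite /th /theta; lra. Qed.

Let rhoE : exists s, [/\ 0 < s, s ^+ 2 = th & rho = 1 + s].
Proof.
by exists (Num.sqrt th); split=> //; rewrite ?sqrtr_gt0 // sqr_sqrtr // ltW.
Qed.

Let rho1 : 1 < rho.
Proof. by have [s [s0 _ ->]] := rhoE; rewrite ltrDl. Qed.

Let SE : S = 8 * d%:R * N%:R * W0 / th.
Proof. by []. Qed.

Let Spos : 0 < S.
Proof. by apply: lt_le_trans (W0_S d1 n1 N1 th0 th1 W1 SE); apply: lt_le_trans W1. Qed.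

Let nR : 1 <= n%:R :> R. Proof. by rewrite ler1n. Qed.

Lemma gram_supp w j : j \notin cols -> gram xh w j = 0.
Proof.
move=> /cols_supp h; apply: big1 => i _.
by rewrite /xh rounded0 ?h // mul0r.
Qed.

Lemma advance_supp c w q j : j \notin cols -> q j = 0 -> advance xh c w q j = 0.
Proof. by move=> h hq; rewrite /advance gram_supp // hq mul0r !mulr0 subrr tr0 addr0. Qed.

Lemma gram_int w j : (forall k, w k \is a Num.int) -> gram xh w j \is a Num.int.
Proof.
move=> h; rewrite /gram rpred_sum // => i _; rewrite rpredM ?tr_int //.
by rewrite rpred_sum // => k _; rewrite rpredM ?tr_int.
Qed.

Definition frame_probe (s s' : state R) :=
  [/\ forall r, (r < 21)%N -> nreg s' r = nreg s r,
      nmem s' = nmem s, rreg s' 21%N = rreg s 21%N, rreg s' 22%N = rreg s 22%N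
    & rreg s' 24%N = rreg s 24%N].

Lemma does_iteration s c : E s -> rreg s 24%N = c ->
  let w := ar s 3 in let q := ar s 4 in
  (forall j, w j \is a Num.int) -> (forall j, `|w j| <= S) ->
  (forall j, `|2 * (gram xh w j / c) - 2 * q j| < 2 ^+ l) ->
  (forall j, j \notin cols -> w j = 0) -> (forall j, j \notin cols -> q j = 0) ->
  does iteration s ((20 * l + 180) * size cols + 90) (fun s' =>
   [/\ E s', frame_probe s s', ar s' 2 =1 ar s 2
   & (dot w (gram xh w) <= (1 - th) * c * dot w w /\
      [/\ rreg s' 20%N = rreg s 20%N, rreg s' 25%N = rreg s 25%N * rho,
        ar s' 3 =1 advance xh c w q, ar s' 4 =1 w & ar s' 5 =1 ar s 5]) \/
     ((1 - th) * c * dot w w < dot w (gram xh w) /\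
      [/\ rreg s' 20%N = rreg s 22%N, rreg s' 25%N = Th + 1,
       forall j, ar s' 5 j = if j \in cols then w j / Num.sqrt (dot w w)
         else ar s 5 j,
       forall j, j \notin cols -> ar s' 3 j = 0 &
       forall j, j \notin cols -> ar s' 4 j = 0])]).
Proof.
move=> hE hc w q w_int w_le z_log w_supp q_supp.
apply: (@does_imp _ _ _ (4 + ((20 * size cols + 10) + (6 + (((20 * l + 130) * size cols + 10)
   + (6 + (((8 + ((20 * size cols + 10) + 1).+1).+1).+1 + 1).+1).+1).+1).+1).+1).+1);
   [exact: iteration_cost|by move=> s'; exact: id|].
have env_hi s' (a : nat) z : (20 <= a)%N -> E s' -> E (set_rreg s' a z).
  move=> ha [h1 h2 h3 h4 h5 h6]; split=> //; case: h1 => g1 g2; split=> // r lt.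
  by rewrite /= (upd_hi _ _ lt) // g2.
have R7 s' : E s' -> rreg s' 7%N = 0 by case=> -[_ ->].
apply: (does_seq (Q1 := eq (set_rreg s 30 0))).
  by step; apply: does_nil; rewrite (R7 _ hE) addr0.
move=> _ <-; set s1 := set_rreg s 30 0.
have E1 : E s1 by exact: env_hi.
apply: (does_seq (does_packed_product cols_uniq E1 _ _)) => //.
move=> s2 [E2 f2 m2 h30].
apply: (does_seq (Q1 := eq (set_rreg (set_rreg s2 31 0) 32 0))).
  by do 2! step; apply: does_nil; rewrite (R7 _ E2) addr0; case: (s2).
move=> _ <-; set s3 := set_rreg _ 32 0.
have E3 : E s3 by apply: (env_hi) => //; apply: env_hi.
have a3 i : ar s3 i =1 ar s i by move=> j; rewrite /ar /arr /= m2.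
apply: (does_seq (does_unpack (w := w) (pp := q) (c := c) (l := l) cols_uniq
  _ _ _ _ E3 _ _ _ _ _ _ _)) => //.
- by move=> j; exact: gram_int.
- by move=> j; exact: (gram_digit d1 n1 N1 th0 th1 W1 SE xle nz).
- by rewrite /= !updE /=; case: f2 => _ -> // _; rewrite /= updE.
move=> s4 [E4 f4 [h31 h32] [h3 h4 hother]].
have f24 r : (r < 30)%N -> rreg s4 r = rreg s r.
  move=> lt; case: f4 => _ -> // _; rewrite /= !(upd_hi _ _ lt) //.
  by case: f2 => _ -> // _; rewrite /= (upd_hi _ _ lt).
have fn4 r : (r < 21)%N -> nreg s4 r = nreg s r.
  by move=> lt; case: f4 => -> // _ _; case: f2 => -> // _ _.
have fm4 : nmem s4 = nmem s by case: f4 => _ _ -> /=; case: f2.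
have h17 : rreg s4 17%N = 1 - th by case: E4 => -[_ ->].
apply: (does_seq (Q1 := eq (set_rreg (set_rreg s4 33 ((1 - th) * c)) 33
   ((1 - th) * c * dot w w)))).
  by do 2! step; apply: does_nil; rewrite h17 h32 f24 // hc; case: (s4).
move=> _ <-; set s5 := set_rreg _ 33 _.
have E5 : E s5 by apply: (env_hi) => //; apply: env_hi.
have a5 i : ar s5 i =1 ar s4 i by [].
apply: does_then.
have r15 : rreg s4 15%N = rho by case: E4 => -[_ ->].
have r19 : rreg s4 19%N = Th + 1 by case: E4 => -[_ ->].
have r22 : rreg s4 22%N = rreg s 22%N by rewrite f24.
have r25 : rreg s4 25%N = rreg s 25%N by rewrite f24.
apply: does_if => /=; rewrite !updE /= h31 => test.
  apply: (does_imp (k := 1%N) _ (fun _ h => h)) => //.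
  apply: does_op => /=; apply: does_skip => //; rewrite !updE /= r15 r25.
  split.
  - exact: (env_hi s5 25%N).
  - by split=> //=; rewrite !updE /= f24.
  - by move=> j; rewrite -[LHS]/(ar s4 2 j) [LHS](hother 2%N) // [LHS](a3 2%N).
  left; split=> //; split; rewrite /= ?updE //= ?f24 //.
  - move=> j; rewrite -[LHS]/(ar s4 3 j) [LHS]h3; case: ifPn => // jc.
    by rewrite w_supp // advance_supp // q_supp.
  - move=> j; rewrite -[LHS]/(ar s4 4 j) [LHS]h4; case: ifPn => // jc.
    by rewrite w_supp // q_supp.
  - by move=> j; rewrite -[LHS]/(ar s4 5 j) [LHS](hother 5%N) // [LHS](a3 5%N).
apply: does_then; do 3! step; apply: does_nil.
have {}r22 : rreg s5 22%N = rreg s 22%N by rewrite /= !updE.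
have {}r19 : rreg s5 19%N = Th + 1 by rewrite /= !updE.
have {}h32 : rreg s5 32%N = dot w w by rewrite /= !updE.
rewrite !(R7 _ E5) !addr0 r22 r19 h32.
set s6 := State _ _ _ _.
have E6 : E s6.
  apply: (env_hi (set_rreg (set_rreg s5 20 (rreg s 22%N)) 33
    (Num.sqrt (dot w w))) 25%N (Th + 1)) => //.
  apply: (env_hi (set_rreg s5 20 (rreg s 22%N)) 33%N (Num.sqrt (dot w w))) => //.
  exact: (env_hi s5 20%N).
apply: (does_seq (does_save cols_uniq E6)) => s7 [E7 f7 h5 ho].
apply: does_skip => //; apply: does_skip => //.
have a6 i : ar s6 i =1 ar s4 i by [].
split=> //.
- case: f7 => g1 g2 g3; split; rewrite ?g2 ?g3 //= ?updE //= ?f24 //.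
  by move=> r lt; rewrite g1 // fn4.
- by move=> j; rewrite [LHS](ho 2%N) // [LHS](hother 2%N) // [LHS](a3 2%N).
right; split; first by rewrite ltNge test.
case: f7 => g1 g2 g3; rewrite !g2 //= !updE //=; split=> //.
- move=> j; rewrite [LHS]h5 /= updE /=; case: ifP => jc.
    by rewrite [X in X / _](h4 j) jc.
  by rewrite [LHS](hother 5%N) // [LHS](a3 5%N).
- move=> j jc; rewrite [LHS](ho 3%N) // [LHS](h3 j) (negbTE jc) w_supp //.
- move=> j jc; rewrite [LHS](ho 4%N) // [LHS](h4 j) (negbTE jc) q_supp //.
Qed.

Definition supported (w : 'I_d -> R) := forall j, j \notin cols -> w j = 0.

(** Half of the final loss is accounted for here, the other half by the interval
    that bisection leaves. *)
Definition quality (o : 'I_d -> R) (lo : R) :=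
  [/\ supported o, dot o o = 1 & lo - 2 * th * n%:R <= dot o (gram x o)].

Lemma quality_normalize a w : th * n%:R / 2 <= a -> a <= n%:R -> supported w ->
  (1 - th) * (a * S ^+ 2) * dot w w < dot w (gram xh w) ->
  quality (fun j => w j / Num.sqrt (dot w w)) a.
Proof.
move=> a_lo a_hi ws hw.
have h := pass_quality d1 n1 N1 th0 th1 W1 SE xle nz a_lo a_hi hw.
have w0 : 0 < dot w w.
  rewrite lt_def dot_ge0 andbT; apply/eqP => z; move: hw; rewrite z mulr0.
  suff -> : dot w (gram xh w) = 0 by rewrite ltxx.
  apply: big1 => j _; suff -> : w j = 0 by rewrite mul0r.
  apply/eqP; rewrite -sqrf_eq0; apply/eqP/le_anti.
  by rewrite sqr_ge0 -z sqr_le_dot.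
set r := Num.sqrt (dot w w).
have r0 : 0 < r by rewrite sqrtr_gt0.
have r2 : r ^+ 2 = dot w w by rewrite sqr_sqrtr // ltW.
have scal (f : 'I_d -> R) : dot (fun j => w j / r) (fun j => f j / r) = dot w f / dot w w.
  rewrite -r2 /dot mulr_suml; apply: eq_bigr => j _.
  by field; rewrite gt_eqF.
split.
- by move=> j /ws ->; rewrite mul0r.
- by rewrite scal divff // gt_eqF.
- have -> : gram x (fun j => w j / r) = fun j => gram x w j / r.
    apply/funext => j; rewrite /gram mulr_suml; apply: eq_bigr => i _.
    by rewrite -mulrA; congr (_ * _); rewrite mulr_suml; apply: eq_bigr => k _; rewrite mulrA.
  by rewrite scal ler_pdivlMr.
Qed.

(** Keeps the arguments of truncation below 2 ^ l, which bounds its cost. *)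
Lemma step_log a w q j : th * n%:R / 2 <= a -> (forall k, `|w k| <= S) ->
  `|q j| <= S -> `|2 * (gram xh w j / (a * S ^+ 2)) - 2 * q j| < 2 ^+ l.
Proof.
move=> a_lo hw hq; apply: le_lt_trans l_step.
have a_th : th / 2 <= a.
  by apply: le_trans a_lo; rewrite ler_pM2r ?invr_gt0 // ler_peMr // ltW.
have a0 : 0 < a by apply: lt_le_trans a_th; rewrite divr_gt0.
have c0 : 0 < a * S ^+ 2 by rewrite mulr_gt0 // exprn_gt0.
have hg := gram_digit d1 n1 N1 th0 th1 W1 SE xle nz j hw.
have h1 : `|gram xh w j / (a * S ^+ 2)| <= 2 * N%:R * d%:R * S / th.
  rewrite normrM normfV (gtr0_norm c0) ler_pdivrMr //; apply: le_trans hg _.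
  rewrite /digit_bound (_ : _ / th * _ = N%:R * d%:R * S ^+ 3 * (2 * a / th)); last by ring.
  apply: ler_peMr; first exact: mulr_ge0 (mulr_ge0 (ler0n _ _) (ler0n _ _)) (exprn_ge0 3 (ltW Spos)).
  by rewrite ler_pdivlMr //; lra.
apply: le_trans (ler_normB _ _) _; rewrite 2!(normrM 2) (ger0_norm (ler0n R 2)).
rewrite (_ : 4 * _ * _ * _ / _ = 2 * (2 * N%:R * d%:R * S / th)); last by ring.
by rewrite lerD // ler_pM2l.
Qed.

Definition search_state (lo hi : R) (s : state R) :=
  [/\ E s, [/\ rreg s 20%N = lo, rreg s 21%N = hi & rreg s 23%N = hi - lo],
     ar s 2 =1 v, quality (ar s 5) lo
   & [/\ supported (ar s 3), supported (ar s 4) & good -> nu < hi + th * n%:R]].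

(** If an iterate passes the test, it is a candidate of quality a.  Otherwise the
    loop ends with a growth factor above [Theta], which is absurd when nu is at
    least a + th * n and the start is good; so a becomes the upper end. *)
Lemma does_probe lo hi s : 0 <= lo -> hi <= n%:R -> th * n%:R <= hi - lo ->
  search_state lo hi s ->
  does probe s (K * ((20 * l + 180) * size cols + 91) + 20 * size cols + 50)
    (fun s' => search_state ((lo + hi) / 2) hi s' \/
               search_state lo ((lo + hi) / 2) s').
Proof.
move=> lo0 hi_n gap [hE [h20 h21 h23] hv ho [sw sq hhi]].
pose a := (lo + hi) / 2; rewrite -/a.
have gp : 0 < th * n%:R by rewrite mulr_gt0 // ltr0n.
have a_lo : th * n%:R / 2 <= a by rewrite /a; lra.
have a_hi : a <= n%:R by rewrite /a; lra.
have lo_a : lo < a by rewrite /a; lra.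
pose c := a * S ^+ 2.
pose big := good /\ a + th * n%:R <= nu.
apply: (@does_imp _ _ _ (10 + ((20 * size cols + 10) +
  ((K * ((20 * l + 180) * size cols + 90).+1 + 1) + (2 + (4 + 1).+1).+1).+1).+1).+1);
  [exact: probe_cost|by move=> s'; exact: id|].
have env_hi s' (b : nat) z : (20 <= b)%N -> E s' -> E (set_rreg s' b z).
  move=> hb [k1 k2 k3 k4 k5 k6]; split=> //; case: k1 => g1 g2; split=> // r lt.
  by rewrite /= (upd_hi _ _ lt) // g2.
pose s1 := set_rreg (set_rreg (set_rreg (set_rreg s 22 (lo + hi)) 22 a) 24 c) 25 1.
apply: (does_seq (Q1 := eq s1)).
  do 4! step; apply: does_nil.
  have [_ hR] := ev_regs hE; rewrite (hR 9%N isT) (hR 18%N isT) (hR 2%N isT) (hR 7%N isT).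
  rewrite h20 h21 /s1 /c /a.
  by case: (s) => nr rr nm rm; rewrite /set_rreg /= /cR /= addr0.
move=> _ <-; have E1 : E s1 by apply: (env_hi) => //; apply: (env_hi) => //; apply: (env_hi) => //; apply: env_hi.
have a1 i : ar s1 i =1 ar s i by [].
apply: (does_seq (does_restart cols_uniq E1)) => s2 [E2 f2 b3 [b4 bo]].
have r2 r : (r < 30)%N -> rreg s2 r = rreg s1 r by case: f2 => _ g _; exact: g.
have a3 : ar s2 3 = v.
  apply/funext => j; rewrite [LHS]b3; case: ifPn => h; first exact: hv.
  by rewrite v_supp //; apply: sw.
have a4 : ar s2 4 = fun=> 0.
  by apply/funext => j; rewrite [LHS]b4; case: ifPn => h //; apply: sq.
have a5 : ar s2 5 = ar s 5 by apply/funext => j; rewrite [LHS]bo.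
have a2 : ar s2 2 = v by apply/funext => j; rewrite [LHS]bo // -hv.
pose D := dot v v.
pose inv := inner_inv x th rho W0 S D a u nu big.
pose A i s' := [/\ rreg s' 20%N = lo, rreg s' 25%N = rho ^+ i, ar s' 5 = ar s 5,
  supported (ar s' 3) /\ supported (ar s' 4) & inv (rho ^+ i) (ar s' 3) (ar s' 4)].
pose P s' := [/\ rreg s' 20%N = a, rreg s' 25%N = Th + 1,
  supported (ar s' 3), supported (ar s' 4) & quality (ar s' 5) a].
pose I i s' := [/\ E s', frame_probe s2 s', ar s' 2 = v & A i s' \/ P s'].
have invI i s' : I i s' -> rreg s' 22%N = a /\ rreg s' 24%N = c.
  move=> [_ [_ _ _ -> ->] _ _]; rewrite !r2 //.
apply: (does_seq (Q1 := fun s' => (exists i, I i s') /\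
   eval_test (RLe 25 12) s' = false)).
  apply: (does_while (I := I)).
    split=> //; left; split; rewrite ?r2 ?expr0 // a3 a4; first by split.
    apply: (inner_init x rho d1 n1 N1 th0 th1 W1 SE a_lo a_hi v_int v_le) => //.
    by case.
  move=> i s' hI /=; have [i22 i24] := invI _ _ hI.
  have [Es' fs' as' AP] := hI.
  have -> : rreg s' 12%N = Th by have [_ ->] := ev_regs Es'.
  case: AP => [[c20 c25 c5 [cw cq] cinv]|[_ -> _ _ _]]; last by rewrite leNgt ltrDl ltr01.
  rewrite c25 => gTh.
  split.
    rewrite ltnNge; apply/negP => Ki; have : rho ^+ K <= rho ^+ i by rewrite ler_eXn2l.
    by rewrite leNgt (le_lt_trans gTh).
  have [wq_int wq_le _ _ _] := cinv.
  have w_le k : `|ar s' 3 k| <= S by case: (wq_le k).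
  apply: (@does_imp _ _ _ _ _ _ _ (leqnn _) _ (does_iteration Es' i24 _ w_le _ cw cq)).
  - move=> s3 [E3 [k1 k2 k3 k4 k5] m2 alt]; split=> //.
    + by case: fs' => g1 g2 g3 g4 g5; split=> [r lt||||]; rewrite ?k1 ?k2 ?k3 ?k4 ?k5 ?g1.
    + by rewrite -as'; apply/funext.
    case: alt => [[nonpass [m20 m25 m3 m4 m5]]|[passed [m20 m25 m5 m3 m4]]].
      have e3 : ar s3 3 = advance xh c (ar s' 3) (ar s' 4) by apply/funext.
      have e4 : ar s3 4 = ar s' 3 by apply/funext.
      left; split.
      * by rewrite m20.
      * by rewrite m25 c25 exprSr.
      * by rewrite -c5; apply/funext.
      * rewrite e3 e4; split=> // j jc; apply: advance_supp => //; exact: cq.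
      rewrite e3 e4 exprSr.
      apply: (inner_step d1 n1 N1 th0 th1 rhoE W1 SE v_dot xle nz a_lo a_hi u_le u_ev _ cinv nonpass).
      by rewrite exprn_ege1 // ltW.
    right; split=> //; first by rewrite m20.
    have -> : ar s3 5 = fun j => ar s' 3 j / Num.sqrt (dot (ar s' 3) (ar s' 3)).
      apply/funext => j; rewrite m5; case: ifPn => // jc.
      by rewrite cw // mul0r c5; case: ho => ->.
    exact: quality_normalize.
  - by move=> j; case: (wq_int j).
  - by move=> j; apply: step_log => //; case: (wq_le j).
move=> s3 [[i hI] /=]; have [i22 i24] := invI _ _ hI.
have [E3 [k1 k2 k3 k4 k5] m2 AP] := hI.
have -> : rreg s3 12%N = Th by have [_ ->] := ev_regs E3.
have i21 : rreg s3 21%N = hi by rewrite k3 r2 // -h21.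
have r7 : rreg s3 7%N = 0 by have [_ ->] := ev_regs E3.
move=> /negbT; rewrite -ltNge => gTh.
case: AP => [[c20 c25 c5 [cw cq] cinv]|[c20 c25 cw cq cqual]].
  apply: (does_seq (Q1 := eq (set_rreg s3 21 a))).
    apply: does_if; rewrite /= c20 i22; first by rewrite leNgt lo_a.
    by move=> _; apply: does_op; rewrite /= i22 r7 addr0.
  move=> _ <-; apply: does_then; do 1! step; apply: does_nil; apply: does_skip => //.
  right; rewrite c20; split=> //.
  - apply: (env_hi (set_rreg s3 21 a) 23%N) => //; exact: (env_hi s3 21%N).
  - by move=> j; rewrite -[RHS](congr1 (fun f => f j) m2).
  - by rewrite (_ : ar _ 5 = ar s 5).
  split=> // hg; have [_ _ _ _ hb] := cinv; rewrite ltNge; apply/negP => hnu.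
  have [_ h _ _ _] : [/\ a + th * n%:R <= nu, rho ^+ i <= Th,
      rho ^+ i * tau d th <= dot u (ar s3 3), 0 <= dot u (ar s3 4)
    & rho * dot u (ar s3 4) <= dot u (ar s3 3)] by apply: hb; split.
  by move: gTh; rewrite c25 ltNge h.
apply: (does_seq (Q1 := eq s3)).
  by apply: does_if; rewrite /= c20 i22 ?lexx // => _; apply: does_skip.
move=> _ <-; apply: does_then; do 1! step; apply: does_nil; apply: does_skip => //.
left; rewrite c20 i21; split=> //.
- exact: (env_hi s3 23%N).
- by move=> j; rewrite -[RHS](congr1 (fun f => f j) m2).
Qed.

Lemma does_search s : E s -> ar s 2 =1 v ->
  (forall i j, (2 < i < 6)%N -> ar s i j = 0) ->
  does search s (l * (K * ((20 * l + 180) * size cols + 91) + 20 * size cols + 51) + 40)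
   (fun s' => let o : 'I_d -> R := fun j => rmem s' (nreg s' 0%N + j)%N in
     dot o o = 1 /\ (good -> nu - 4 * th * n%:R <= dot o (gram x o))).
Proof.
move=> hE hv hz.
have gp : 0 < th * n%:R by rewrite mulr_gt0 // ltr0n.
pose kp := (K * ((20 * l + 180) * size cols + 91) + 20 * size cols + 50)%N.
apply: (@does_imp _ _ _ (14 + ((l * kp.+1 + 1) + (4 + 1).+1).+1).+1);
  [exact: search_cost|by move=> s'; exact: id|].
pose I i s' := exists lo hi, [/\ 0 <= lo, hi <= n%:R, hi - lo = n%:R / 2 ^+ i
  & search_state lo hi s'].
apply: (does_seq (Q1 := I 0%N)).
  move: hE hv hz; case: s => nr rr nm rm hE hv hz.
  do 6! step; apply: does_nil.
  have [[/= hN hR] q2 q3 q4 q5 q6] := hE.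
  have n4 := hN 4 isT; have n9 := hN 9 isT; have n2 := hN 2 isT.
  have r2 := hR 2 isT; have r5 := hR 5 isT; have r7 := hR 7 isT.
  rewrite /cN /cR /= in n4 n9 n2 r2 r5 r7 q4.
  rewrite n4 n9 q4 r2 r5 r7 !addr0.
  set s1 := State _ _ _ _.
  have a1 i j : ar s1 i j = if (i == 5%N) && (j == j1) then 1 else ar (State nr rr nm rm) i j.
    by rewrite /ar /arr /= updE addr_eq.
  have a5 : ar s1 5 = fun j => (j == j1)%:R.
    by apply/funext => j; rewrite a1 /=; case: eqP => // _; rewrite hz.
  exists 0, n%:R; split=> //; first by rewrite subr0 expr0 divr1.
  split=> //.
  - split=> //.
    + by split=> r lt; rewrite /= !(upd_hi _ _ lt) // ?hN ?hR.
    + by move=> j; rewrite [LHS]a1 /=; exact: q5.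
    + by move=> j; rewrite [LHS]a1 /=; exact: q6.
  - by move=> j; rewrite a1 /= hv.
  - rewrite a5; split.
    + by move=> j jc; case: eqP => // jj; move: jc; rewrite jj j1_cols.
    + rewrite /dot (bigD1 j1) //= eqxx mulr1 big1 ?addr0 // => j /negbTE ->.
      by rewrite mul0r.
    + apply: (@le_trans _ _ 0); first by lra.
      by rewrite dot_gram; apply: sumr_ge0 => i _; rewrite -expr2 sqr_ge0.
  - split; [by move=> j _; rewrite a1 /= hz|by move=> j _; rewrite a1 /= hz|].
    by move=> _; apply: le_lt_trans nu_le _; rewrite ltrDl.
move=> s1 I0.
apply: (does_seq (Q1 := fun s' => (exists i, I i s') /\ eval_test (RLe 16 23) s' = false)).
  apply: (does_while (I := I)) => // i s' [lo [hi [lo0 hin gap hs]]] /=.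
  have [Es [h20 h21 h23] _ _ _] := hs.
  have -> : rreg s' 16%N = th * n%:R by have [_ ->] := ev_regs Es.
  rewrite h23 => test; split.
    rewrite ltnNge; apply/negP => li.
    have h1 : (2 : R) ^+ l <= 2 ^+ i by rewrite ler_eXn2l // ltr1n.
    have n0 : 0 < n%:R :> R by rewrite ltr0n.
    move: test; rewrite gap mulrC ler_pM2l // => test.
    have h2 : (2 : R) ^+ i <= th^-1.
      by rewrite -[leLHS]invrK lef_pV2 // posrE invr_gt0 exprn_gt0.
    by move: l_th; rewrite ltNge (le_trans h1 h2).
  have mid : (hi - lo) / 2 = n%:R / 2 ^+ i.+1.
    by rewrite gap exprSr invfM mulrA.
  apply: does_imp (leqnn _) _ (does_probe lo0 hin test hs) => s2 [] hs2.
    exists ((lo + hi) / 2), hi; split=> //; first by lra.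
    by rewrite -mid; lra.
  exists lo, ((lo + hi) / 2); split=> //; first by lra.
  by rewrite -mid; lra.
move=> s2 [[i [lo [hi [lo0 hin gap hs]]]] /=].
have [Es [h20 h21 h23] hv2 hq [_ _ hgood]] := hs.
have -> : rreg s2 16%N = th * n%:R by have [_ ->] := ev_regs Es.
rewrite h23 => /negbT; rewrite -ltNge => small.
apply: does_then; do 1! step; apply: does_nil; apply: does_skip => //.
have [hN _] := ev_regs Es; rewrite /= updE /= !hN // /cN /= addn0.
have [_ q2 q3] := hq.
split; first exact: q2.
move=> /hgood hnu; have : nu - 4 * th * n%:R <= lo - 2 * th * n%:R by lra.
by move=> h; apply: le_trans h q3.
Qed.

End Search.

(** * The random start vector *)

Definition draw_body := seqs [::
  block load_col; Rand 24 12;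
  block [:: ROfNat 30 24; RMul 30 30 10; NAdd 25 6 23; RStore 25 30] ]%N.

Definition draw := down 21 20 draw_body.

Section Mean.
Variables (R : realType) (M : nat).

(** Expectation over m further draws; acc lists the draws already made, the last
    one in front, as the loop over the columns counts down. *)
Fixpoint mean m (f : seq nat -> R) acc : R :=
  if m is m'.+1 then (\sum_(v < M.+1) mean m' f (nat_of_ord v :: acc)) / M.+1%:R
  else f acc.

Let M0 : 0 < M.+1%:R :> R. Proof. by rewrite ltr0n. Qed.

Lemma mean_const m c acc : mean m (fun=> c) acc = c.
Proof.
elim: m acc => //= m IH acc; under eq_bigr do rewrite IH.
by rewrite sumr_const card_ord -[c *+ _]mulr_natr mulfK // gt_eqF.
Qed.

Lemma meanB m f g acc : mean m (fun vs => f vs - g vs) acc =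
  mean m f acc - mean m g acc.
Proof.
by elim: m acc => //= m IH acc; under eq_bigr do rewrite IH; rewrite sumrB mulrBl.
Qed.

Variables (a : nat -> R) (r : R).

(** The probability that |c + a 0 * v 0 + ... + a (m - 1) * v (m - 1)| < r *)
Fixpoint near0 m (c : R) : R :=
  if m is m'.+1 then (\sum_(v < M.+1) near0 m' (c + a m' * (nat_of_ord v)%:R)) / M.+1%:R
  else (`|c| < r)%R%:R.

(** For fixed other draws the events are disjoint: two distinct integer multiples
    of b differ by at least 2 * r. *)
Lemma near0_line m c b : 2 * r <= `|b| ->
  \sum_(v < M.+1) near0 m (c + b * (nat_of_ord v)%:R) <= 1.
Proof.
move=> rb; elim: m c => [|m IH] c /=.
  have [/existsP[v hv]|/existsPn no] := boolP [exists v : 'I_M.+1,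
      `|c + b * (nat_of_ord v)%:R| < r]; last first.
    by rewrite big1 // => v _; rewrite (negbTE (no v)).
  rewrite (bigD1 v) //= hv big1 ?addr0 // => w wv.
  case: ltP => // hw; exfalso.
  have h1 : `|b * ((nat_of_ord w)%:R - (nat_of_ord v)%:R)| < 2 * r.
    rewrite (_ : b * _ = (c + b * (nat_of_ord w)%:R) - (c + b * (nat_of_ord v)%:R)); last by ring.
    by apply: le_lt_trans (ler_normB _ _) _; lra.
  have h2 : 1 <= `|(nat_of_ord w)%:R - (nat_of_ord v)%:R| :> R.
    case: (ltngtP (nat_of_ord w) v) => [lt|lt|q].
    - by rewrite distrC -natrB ?(ltnW lt) // normr_nat ler1n subn_gt0.
    - by rewrite -natrB ?(ltnW lt) // normr_nat ler1n subn_gt0.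
    - by move: wv; rewrite -val_eqE /= q eqxx.
  move: h1; rewrite normrM ltNge => /negP; apply.
  by apply: le_trans rb _; rewrite ler_peMr.
rewrite -mulr_suml exchange_big /= ler_pdivrMr // mul1r.
apply: (@le_trans _ _ (\sum_(v < M.+1) (1 : R))); last by rewrite sumr_const card_ord.
apply: ler_sum => w _; apply: le_trans (IH (c + a m * (nat_of_ord w)%:R)).
by rewrite le_eqVlt; apply/orP; left; apply/eqP/eq_bigr => v _; congr near0; ring.
Qed.

(** Conditionally on the draws other than number k, at most one of its M + 1
    values is bad. *)
Lemma near0_le m c k : (k < m)%N -> 2 * r <= `|a k| -> near0 m c <= M.+1%:R^-1.
Proof.
move=> + ak; elim: m c => //= m IH c; rewrite ltnS leq_eqVlt => /orP[/eqP <-|km].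
  by rewrite ler_pdivrMr // mulVf ?gt_eqF // near0_line.
rewrite ler_pdivrMr // mulVf ?gt_eqF //.
apply: (@le_trans _ _ (\sum_(v < M.+1) M.+1%:R^-1)); first by apply: ler_sum => v _; exact: IH.
by rewrite sumr_const card_ord -[_ *+ _]mulr_natr mulVf // gt_eqF.
Qed.

Definition linear_form (vs : seq nat) : R :=
  \sum_(0 <= k < size vs) a k * (nth 0%N vs k)%:R.

Lemma mean_near0 m acc :
  mean m (fun vs => (`|linear_form vs| < r)%R%:R) acc =
  near0 m (\sum_(0 <= k < size acc) a (m + k)%N * (nth 0%N acc k)%:R).
Proof.
elim: m acc => [|m IH] acc //=.
congr (_ / _); apply: eq_bigr => v _; rewrite IH; congr near0.
rewrite /= big_nat_recl // addn0 addrC; congr (_ + _).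
by apply: eq_bigr => k _; rewrite addSnnS.
Qed.

End Mean.

Section Draw.
Variables (R : realType) (n d N M : nat) (e p : R) (xh : 'I_n -> 'I_d -> R).
Variables (cols : seq 'I_d) (j0 j1 : 'I_d).
Hypothesis cols_uniq : uniq cols.
Let E := env N M e p xh cols j0 j1.
Let ar := @arr R d N.

Lemma Pr_le1 (Ev : state R -> Prop) T K s : Pr Ev T K s <= 1.
Proof.
elim: T K s => [|T IH] [|c K] s //=; rewrite ?ler01 ?lern1 ?leq_b1 //.
case: c => [|o|a b|c1 c2|t c1 c2|t c1]; rewrite ?IH //.
rewrite ler_pdivrMr ?ltr0n // mul1r.
apply: (@le_trans _ _ (\sum_(v < (nreg s b).+1) (1 : R))); first exact: ler_sum.
by rewrite sumr_const card_ord.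
Qed.

(** The factor M spreads the values of one coordinate by more than 2 * tau. *)
Definition start (vs : seq nat) (j : 'I_d) : R :=
  if j \in cols then (nth 0%N vs (index j cols))%:R * M%:R else 0.

Definition draw_inv s k t (vs : seq nat) (s' : state R) :=
  [/\ E s', nreg s' 21%N = k, (size vs + t)%N = size cols /\ all (leq^~ M) vs,
    forall j, ar s' 2 j = if treated cols t j
      then (nth 0%N vs (index j cols - t))%:R * M%:R else ar s 2 j
  & forall i j, i != 2%N -> ar s' i j = ar s i j].

Lemma draw_inv_set s k k' t vs s' : draw_inv s k t vs s' ->
  draw_inv s k' t vs (set_nreg s' 21 k').
Proof. by move=> [h1 h2 h3 h4 h5]; split=> //; exact: env_set. Qed.

Lemma Pr_draw_body s t vs s' Ev K T0 q : (t < size cols)%N ->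
  draw_inv s t.+1 t.+1 vs s' ->
  (forall v s'' T, (v <= M)%N -> (T0 <= T)%N -> draw_inv s t t (v :: vs) s'' ->
     q v <= Pr Ev T K s'') ->
  forall T, (T0 + 20 <= T)%N ->
  (\sum_(v < M.+1) q (nat_of_ord v)) / M.+1%:R <=
    Pr Ev T (draw_body :: K) (set_nreg s' 21 t).
Proof.
move=> lt /(@draw_inv_set _ _ t); set j := nth j0 cols t.
case: (set_nreg s' 21 t) => {s'} nr rr nm rm [h1 h2 [h3 h3'] h4 h5] IH T hT.
rewrite /= in h2.
have [[/= hN hR] h20 hcols _ _ _] := h1.
have n11 := hN 11 isT; have n6 := hN 6 isT; have n12 := hN 12 isT.
rewrite /cN /= in n11 n6 n12.
have r10 := hR 10 isT; rewrite /cR /= in r10.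
have first_part : does (block load_col) (State nr rr nm rm) 5
    (eq (State (upd (upd nr 22 (N + N + t)) 23 j)%N rr nm rm)).
  by do 2! step; apply: does_nil; rewrite n11 h2 (hcols _ lt).
have [s1 [k1 [k1_le run1 s1E]]] := first_part.
move: s1E run1 => <- run1 {s1 first_part}.
have -> : T = (k1 + (T - k1 - 3).+2).+1 by lia.
rewrite [Pr _ _ _ _]/= run1 /= !updE /= n12.
rewrite ler_pM2r ?invr_gt0 ?ltr0n //; apply: ler_sum => v _.
pose s2 := State (upd (upd (upd nr 22 (N + N + t)) 23 j) 24 v)%N rr nm rm.
have second : does (block [:: ROfNat 30 24; RMul 30 30 10; NAdd 25 6 23; RStore 25 30]%N)
    s2 9 (draw_inv s t t (nat_of_ord v :: vs)).
  rewrite /s2; do 4! step; apply: does_nil; rewrite n6 r10.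
  set s3 := State _ _ _ _.
  have a3 i l : ar s3 i l = if (i == 2%N) && (l == j) then (nat_of_ord v)%:R * M%:R
      else ar (State nr rr nm rm) i l.
    by rewrite /ar /arr /= updE addr_eq.
  split.
  - have f3 : frame (State nr rr nm rm) s3.
      by split=> // r ltr; rewrite /= !(upd_hi _ _ ltr).
    by apply: (env_frame cols_uniq h1 f3) => l; exact: a3.
  - by rewrite /= !updE.
  - by rewrite /= -h3 addSnnS h3' -ltnS ltn_ord.
  - move=> l; rewrite a3 /= h4 (treated_step j0 cols_uniq _ lt) -/j.
    case: eqP => [->|ne] /=; first by rewrite index_uniq // subnn.
    rewrite /treated; case: ifP => // /andP[tl _].
    by rewrite -(subnSK tl).
  - by move=> i l i2; rewrite a3 (negbTE i2) h5.
have [s3 [k3 [k3_le run3 inv3]]] := second.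
have -> : (T - k1 - 3)%N = (k3 + (T - k1 - 3 - k3 - 2).+1).+1 by lia.
rewrite [Pr _ _ _ _]/= run3 /=.
by apply: IH inv3; [rewrite -ltnS ltn_ord|lia].
Qed.

(** A lower bound for each outcome suffices, also for halting, as probabilities
    are at most 1. *)
Lemma Pr_draw s Ev K T0 (f : seq nat -> R) : E s ->
  (forall vs s' T, (T0 <= T)%N -> E s' -> size vs = size cols ->
     all (leq^~ M) vs ->
     (forall j, ar s' 2 j = if j \in cols then start vs j else ar s 2 j) ->
     (forall i j, i != 2%N -> ar s' i j = ar s i j) -> f vs <= Pr Ev T K s') ->
  forall T, (T0 + 30 * size cols + 10 <= T)%N ->
  mean M (size cols) f [::] <= Pr Ev T (draw :: K) s.
Proof.
move=> hE hK T hT.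
have hreg s' : E s' -> nreg s' 4%N = 1%N /\ nreg s' 3%N = 0%N.
  by move=> h; have [hN _] := ev_regs h; rewrite !hN.
have loop t vs s' T' : (t <= size cols)%N -> draw_inv s t t vs s' ->
    (T0 + 30 * t + 5 <= T')%N ->
    mean M t f vs <= Pr Ev T' (While (NLe 4 21)
      (Seq (Op (NSub 21 21 4)) draw_body) :: K)%N s'.
  elim: t vs s' T' => [|t IH] vs s' T' tc inv hT'.
    have [h1 h2 [h3 h3'] h4 h5] := inv; have [q4 _] := hreg _ h1.
    have -> : T' = T'.-1.+1 by lia.
    rewrite /= q4 h2 /=; apply: hK => //; first by lia.
      by rewrite -h3 addn0.
    by move=> j; rewrite h4 treated_all /start; case: ifP => // _; rewrite subn0.
  have [h1 h2 _ _ _] := inv; have [q4 _] := hreg _ h1.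
  have -> : T' = (T' - 3).+3 by lia.
  rewrite /= q4 h2 /= q4 h2 subn1 /=.
  apply: (Pr_draw_body (T0 := (T0 + 30 * t + 5)%N) (q := fun v => mean M t f (v :: vs)) tc inv).
    by move=> v s'' T'' vM hT'' inv''; apply: IH => //; exact: ltnW.
  by lia.
have -> : T = (T - 2).+2 by lia.
have [_ q3] := hreg _ hE.
rewrite [Pr _ _ _ _]/= q3 (ev_cnt hE) addn0.
apply: loop => //; last by lia.
apply: (@draw_inv_set _ (nreg s 21)); split=> // j.
by rewrite treated_none.
Qed.

End Draw.

(** * The algorithm on an instance *)

Definition algorithm := seqs [:: setup; tables; draw; search].

Section Entries.
Variables (R : realType) (d n : nat) (x : 'I_n -> 'cV[R]_d).

Lemma mem_entries ij : (ij \in entries x) = (x ij.1 ij.2 0 != 0).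
Proof.
rewrite mem_filter; case: eqP => //= _.
by case: ij => i j; apply: allpairs_f; rewrite mem_enum.
Qed.

Lemma entries_uniq : uniq (entries x).
Proof.
apply: filter_uniq; apply: allpairs_uniq; rewrite ?enum_uniq //.
by move=> [i j] [i' j'] _ _ [-> ->].
Qed.

Lemma sum_entries (F : 'I_n * 'I_d -> R) (P : pred ('I_n * 'I_d)) :
  (forall ij, x ij.1 ij.2 0 = 0 -> F ij = 0) ->
  \sum_(ij <- entries x | P ij) F ij = \sum_(ij | P ij) F ij.
Proof.
move=> h; rewrite big_mkcond big_uniq ?entries_uniq //=.
rewrite [LHS]big_mkcond [RHS]big_mkcond; apply: eq_bigr => ij _.
by rewrite mem_entries; case: eqP => //= h0; case: ifP => // _; rewrite h.
Qed.

Lemma nth_flatten_pairs (A : Type) (a0 : A) (f g : A -> nat) (s : seq A) k :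
  (k < size s)%N ->
  nth 0%N (flatten [seq [:: f a; g a] | a <- s]) (k + k) = f (nth a0 s k) /\
  nth 0%N (flatten [seq [:: f a; g a] | a <- s]) (k + k + 1) = g (nth a0 s k).
Proof.
elim: s k => // a s IH [|k] //= lt; have [h1 h2] := IH k lt.
by rewrite addnS /= addn1 /= -addn1; split.
Qed.

Lemma entry_le i j : enorm (x i) <= 1 -> `|x i j 0| <= 1.
Proof.
move=> h; apply: le_trans h; rewrite /enorm -sqrtr_sqr ler_wsqrtr //.
by rewrite (bigD1 j) //= lerDl sumr_ge0 // => k _; rewrite sqr_ge0.
Qed.

Lemma column_count j : (\sum_i (x i j 0 != 0)%R <= nnz x)%N.
Proof.
rewrite /nnz -(card_uniqP entries_uniq).
rewrite -big_mkcond /= sum1_card.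
rewrite -(card_imset _ (f := fun i : 'I_n => (i, j))); last by move=> i k [].
apply: subset_leq_card; apply/fintype.subsetP => ij /imsetP[i]; rewrite unfold_in /= => hi ->.
by rewrite mem_entries.
Qed.

Lemma dot_quad (w : 'cV[R]_d) :
  quad (second_moment x) w =
  n%:R^-1 * dot (fun j => w j 0) (gram (fun i j => x i j 0) (fun j => w j 0)).
Proof.
rewrite /quad /second_moment -scalemxAr -scalemxAl mxE; congr (_ * _).
rewrite dot_gram mulmx_sumr mulmx_suml summxE; apply: eq_bigr => i _.
rewrite (_ : _ *m _ *m w = (w^T *m x i) *m ((x i)^T *m w)); last by rewrite !mulmxA.
rewrite mxE big_ord1 !mxE.
by congr (_ * _); apply: eq_bigr => j _; rewrite !mxE // mulrC.
Qed.

(** Sup norm 1 limits the effect of truncation on the component along u, and the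
    coordinate equal to 1 provides the spread of that component at random
    start. *)
Lemma top_vector l1 : (0 < n)%N -> (forall i, enorm (x i) <= 1) ->
  eigenvalue (second_moment x) l1 ->
  exists (u : 'I_d -> R) (j : 'I_d), [/\ u j = 1, forall k, `|u k| <= 1,
    forall w, dot u (gram (fun i j => x i j 0) w) = n%:R * l1 * dot u w
  & n%:R * l1 <= n%:R].
Proof.
move=> n0 hx /eigenvalueP[v hv v0].
have nR : 0 < n%:R :> R by rewrite ltr0n.
have [j _ jmax] : exists2 j, true & forall k, `|v 0 k| <= `|v 0 j|.
  have /rV0Pn[k0 _] := v0.
  have := @arg_maxP _ _ _ k0 xpredT (fun k => `|v 0 k|) isT.
  by move=> [j _ hj]; exists j => // k; exact: hj.
have vj : v 0 j != 0.
  apply: contraNneq v0 => vj; apply/eqP/rowP => k; rewrite mxE; apply/eqP.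
  by rewrite -normr_le0 -(normr0 R) -vj jmax.
pose u k := v 0 k / v 0 j.
have u_ev w : dot u (gram (fun i j => x i j 0) w) = n%:R * l1 * dot u w.
  have col k : \sum_l v 0 l * \sum_i x i l 0 * x i k 0 = n%:R * l1 * v 0 k.
    have /rowP/(_ k) := hv; rewrite /second_moment -scalemxAr !mxE -mulrA => <-.
    rewrite mulVKf ?gt_eqF //; apply: eq_bigr => l _; rewrite summxE; congr (_ * _).
    by apply: eq_bigr => i _; rewrite mxE big_ord1 !mxE.
  rewrite /dot; under eq_bigr do rewrite gram_coef mulr_sumr.
  rewrite exchange_big mulr_sumr; apply: eq_bigr => k _ /=.
  transitivity ((\sum_l v 0 l * \sum_i x i l 0 * x i k 0) * (w k / v 0 j)).
    by rewrite mulr_suml; apply: eq_bigr => l _; rewrite /u; ring.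
  by rewrite col /u; ring.
exists u, j; split=> //; first by rewrite /u divff.
  by move=> k; rewrite normrM normfV ler_pdivrMr ?normr_gt0 // mul1r.
have uu : 0 < dot u u.
  apply: lt_le_trans (sqr_le_dot u j); rewrite /u divff // expr1n //.
rewrite -(ler_pM2r uu) -u_ev dot_gram.
apply: (@le_trans _ _ (\sum_(i < n) dot u u)); last by rewrite sumr_const card_ord mulr_natl.
apply: ler_sum => i _; rewrite -expr2; apply: le_trans (dot_sqr_le (fun j => x i j 0) u) _.
rewrite ler_piMl ?dot_ge0 //.
by have := hx i; rewrite /enorm -[X in _ <= X]sqrtr1 ler_sqrt.
Qed.

End Entries.

Lemma time_split (a b c f k1 k2 t : nat) : (k1 <= c)%N -> (k2 <= b + 20)%N ->
  (t = a + f + 10 + (b + 20) + c + 3)%N ->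
  (t = (k1 + (k2 + (t - k1 - k2 - 3).+1).+1).+1)%N /\
  (a + f + 10 <= t - k1 - k2 - 3)%N.
Proof. by move=> h1 h2 h3; split; lia. Qed.

Section Assembly.
Variables (R : realType) (d n : nat) (x : 'I_n -> 'cV[R]_d) (eps p l1 : R).
Variables (l K : nat).
Let N := nnz x.
Let e := Num.min eps 1.
Let th := theta e.
Let xf i j := x i j 0.
Let cols := dict (entries x).
Let bound := start_bound d e p.
Hypothesis dn : (d < n)%N.
Hypothesis N0 : (0 < N)%N.
Hypothesis eps0 : 0 < eps.
Hypothesis p0 : 0 < p.
Hypothesis hx : forall i, enorm (x i) <= 1.
Hypothesis ev1 : eigenvalue (second_moment x) l1.
Hypothesis l_bound : bound < 2 ^+ l.
Hypothesis l_th : th^-1 < 2 ^+ l.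
Hypothesis l_digit : forall M : nat, M%:R <= 2 * bound ->
  digit_bound d N (scale d N M e) + 1 < 2 ^+ l.
Hypothesis l_step : forall M : nat, M%:R <= 2 * bound ->
  4 * N%:R * d%:R * scale d N M e / th + 2 * scale d N M e < 2 ^+ l.
Hypothesis K_Theta : forall M : nat, M%:R <= 2 * bound ->
  Theta d (Wbound d M e) < (1 + Num.sqrt th) ^+ K.

Definition search_time :=
  (l * (K * ((20 * l + 180) * size cols + 91) + 20 * size cols + 51) + 40)%N.

Definition total_time := (search_time + 2 + 30 * size cols + 10 +
  (N * (10 * l + 140) + 20) + (6 * l + 110) + 3)%N.

Definition success (s : state R) :=
  let w : 'cV[R]_d := output d s in
  enorm w = 1 /\ l1 - eps <= quad (second_moment x) w.

Lemma cols_size_N : (size cols <= N)%N.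
Proof. exact: size_dict. Qed.

Lemma cols_size_d : (size cols <= d)%N.
Proof. by rewrite -(card_uniqP (dict_uniq _)) -[X in (_ <= X)%N]card_ord max_card. Qed.

Lemma cols_off j i : j \notin cols -> xf i j = 0.
Proof.
rewrite mem_dict => h; apply/eqP; apply: contraNT h => h.
by apply/mapP; exists (i, j); rewrite // mem_entries.
Qed.

Lemma gram_env ij0 M k s :
  gram_inv N M e p xf (entries x) ij0 k 0 s ->
  env N M e p (rounded xf (scale d N M e)) cols ij0.2 (nth ij0 (entries x) 0).2 s.
Proof.
move=> [h1 h2 h3 h4 h5 h6 h7 h8 h9 h10]; split=> //.
- by have [_] := h4 0%N N0; rewrite addn0.
- move=> j; rewrite /arr h10 drop0 sum_entries; last first.
    by move=> ij h; rewrite rounded0 ?mul0r.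
  rewrite /gram -(pair_big_dep xpredT (fun i k => k == j)
    (fun i k => rounded xf (scale d N M e) i k * row_sum N M e xf (entries x) i)) /=.
  apply: eq_bigr => i _; rewrite big_pred1_eq; congr (_ * _).
  rewrite /row_sum sum_entries; last by move=> ij h; rewrite rounded0 ?mul0r.
  rewrite (eq_bigl (fun q : 'I_n * 'I_d => pred1 i q.1 && true)); last first.
    by move=> q; rewrite andbT.
  rewrite -(pair_big_dep (pred1 i) (fun _ _ => true)
    (fun i k => rounded xf (scale d N M e) i k * pw (radix d N M e) cols k)) /=.
  by rewrite big_pred1_eq.
Qed.

Lemma success_of_search s : (0 < n)%N -> 
  (let o : 'I_d -> R := fun j => rmem s (nreg s 0%N + j)%N in
   dot o o = 1 /\ n%:R * l1 - 4 * th * n%:R <= dot o (gram xf o)) -> success s.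
Proof.
move=> n0 [h1 h2]; set o := fun j => _ in h1 h2.
have oE : (fun j => output d s j 0) = o by apply/funext => j; rewrite mxE.
split.
  rewrite /enorm -[RHS]sqrtr1 -h1; congr Num.sqrt; apply: eq_bigr => j _.
  by rewrite mxE expr2.
rewrite dot_quad oE mulrC ler_pdivlMr ?ltr0n //; apply: le_trans h2.
rewrite mulrBl [l1 * _]mulrC lerD2l lerN2 mulrC [X in _ <= X]mulrC ler_pM2l ?ltr0n //.
have : e <= eps by rewrite ge_min lexx.
by rewrite /th /theta; lra.
Qed.

Variables (u : 'I_d -> R).
Hypothesis u_le : forall k, `|u k| <= 1.
Hypothesis u_ev : forall w, dot u (gram xf w) = n%:R * l1 * dot u w.
Hypothesis nu_le : n%:R * l1 <= n%:R.

Let n0 : (0 < n)%N. Proof. exact: leq_ltn_trans dn. Qed.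

Let e0 : 0 < e. Proof. by rewrite /e lt_min eps0 ltr01. Qed.

Let e1 : e <= 1. Proof. by rewrite ge_min lexx orbT. Qed.

Let th0 : 0 < th. Proof. by rewrite /th /theta !mulr_gt0. Qed.

Let th4 : th <= 4^-1. Proof. by move: e1; rewrite /th /theta; lra. Qed.

Lemma dim_gt0 : (0 < d)%N.
Proof.
rewrite lt0n; apply/eqP => d0; move: N0; rewrite /N /nnz.
case E0 : (entries x) => [//|ij s] _; case: ij {s E0} => _ j.
by move: (nat_of_ord j) (ltn_ord j); rewrite d0.
Qed.

(** The analysis wants a component along u above [tau]; if it is below - [tau],
    the vector - u serves as well. *)
Lemma search_from_draws M ij0 vs s : bound < M%:R -> M%:R <= 2 * bound ->
  size vs = size cols -> all (leq^~ M) vs ->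
  env N M e p (rounded xf (scale d N M e)) cols ij0.2 (nth ij0 (entries x) 0).2 s ->
  @arr R d N s 2 =1 start R M cols vs ->
  (forall i j, (2 < i < 6)%N -> @arr R d N s i j = 0) ->
  does search s search_time (fun s' =>
    let o : 'I_d -> R := fun j => rmem s' (nreg s' 0%N + j)%N in
    dot o o = 1 /\ (tau d th <= `|dot u (start R M cols vs)| ->
      n%:R * l1 - 4 * th * n%:R <= dot o (gram xf o))).
Proof.
move=> M_lo M_hi vs_size vs_le hE hv hz.
set v := start R M cols vs in hv *.
have d0 := dim_gt0.
have dR : 1 <= d%:R :> R by rewrite ler1n.
have dth : 4 <= d%:R / th by rewrite ler_pdivlMr //; move: th4; lra.
have M1 : 1 <= M%:R :> R.
  apply: ltW; apply: le_lt_trans M_lo; rewrite /bound /start_bound -/th -mulrA.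
  have : 0 < p^-1 by rewrite invr_gt0.
  by lra.
have MM1 : 1 <= M%:R * M%:R :> R by rewrite mulr_ege1.
have WE : Wbound d M e = M%:R * M%:R * (d%:R / th) by rewrite /Wbound mulrA.
have v_ge0 j : 0 <= v j <= M%:R * M%:R.
  rewrite /v /start; case: ifP => hj; last by rewrite lexx mulr_ge0.
  rewrite mulr_ge0 //= ler_wpM2r // ler_nat.
  by have /allP := vs_le; apply; rewrite mem_nth // vs_size index_mem.
have v_le j : `|v j| <= M%:R * M%:R by have /andP[h1 h2] := v_ge0 j; rewrite ger0_norm.
pose u' : 'I_d -> R := if tau d th <= dot u v then u else fun k => - u k.
have u'_le k : `|u' k| <= 1 by rewrite /u'; case: ifP => _; rewrite ?normrN.
have dotN f : dot (fun k => - u k) f = - dot u f.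
  by rewrite /dot -sumrN; apply: eq_bigr => k _; rewrite mulNr.
have u'_ev w : dot u' (gram xf w) = n%:R * l1 * dot u' w.
  by rewrite /u'; case: ifP => _; rewrite ?dotN u_ev ?mulrN.
apply: (does_imp (leqnn _) _ (does_search (x := xf) (v := v) (u := u') (nu := n%:R * l1)
  (l := l) (K := K) (dict_uniq _) _ _ d0 n0 N0 e0 e1 _ _ _ _ _ _ _ u'_le u'_ev nu_le
  (l_digit M_hi) (l_step M_hi) l_th (K_Theta M_hi) hE hv hz)).
- move=> s' [h1 h2]; split=> // ht; apply: h2; rewrite /u' -/th.
  case: ifPn => // nt; rewrite dotN; move: ht; rewrite ler_normr => /orP[ht|//].
  by rewrite ht in nt.
- by move=> j hj i; apply: cols_off.
- rewrite mem_dict; apply/mapP; exists (nth ij0 (entries x) 0) => //.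
  by rewrite mem_nth.
- by rewrite WE; nra.
- by move=> i j; apply: entry_le.
- by move=> j; apply: column_count.
- by move=> j; rewrite /v /start; case: ifP => _; rewrite ?rpredM ?natr_int ?int_num0.
- by move=> j; apply: le_trans (v_le j) _; rewrite WE; nra.
- apply: (@le_trans _ _ (\sum_(j < d) (M%:R * M%:R) * (M%:R * M%:R))).
    apply: ler_sum => j _; have /andP[h1 h2] := v_ge0 j; exact: ler_pM.
  rewrite sumr_const card_ord -[_ *+ d]mulr_natl WE; set m := M%:R * M%:R in MM1 *.
  rewrite (_ : theta e * _ = m * m * (d%:R * (d%:R / th))); last first.
    by rewrite -/th; field; rewrite gt_eqF.
  rewrite mulrC; apply: ler_wpM2l; first by rewrite mulr_ge0 //; lra.
  by apply: ler_peMr; lra.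
- by move=> j hj; rewrite /v /start (negbTE hj).
Qed.

(** Everything but the draws is deterministic, so that the probability of an event
    is at least the expectation of any lower bound that depends only on the
    draws; both halting and success are obtained from this. *)
Lemma algorithm_lower (Ev : state R -> Prop) (f : nat -> seq nat -> R) :
  (forall M vs s', bound < M%:R -> size vs = size cols ->
    (let o : 'I_d -> R := fun j => rmem s' (nreg s' 0%N + j)%N in
     dot o o = 1 /\ (tau d th <= `|dot u (start R M cols vs)| ->
      n%:R * l1 - 4 * th * n%:R <= dot o (gram xf o))) ->
    f M vs <= (`[< Ev s' >])%:R) ->
  exists M : nat, bound < M%:R /\
    mean M (size cols) (f M) [::] <= Pr Ev total_time [:: algorithm] (input x eps p).
Proof.
move=> hf.
have d0 := dim_gt0.
have [ij0 ij0E] : exists ij, ij \in entries x.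
  by move: N0; rewrite /N /nnz; case: (entries x) => // ij s _; exists ij; rewrite inE eqxx.
have [s1 [k1 [k1_le run1 [M [/andP[M_lo M_hi] regs n20 r20 [nm1 rm1]]]]]] :=
  @does_setup R n d N l eps p (input x eps p) d0 N0 eps0 p0 l_bound (frefl _) (frefl _).
exists M; split=> //.
have d4 : 4 <= d%:R / th.
  have : 1 <= d%:R :> R by rewrite ler1n.
  by rewrite ler_pdivlMr //; move: th4; lra.
have M1 : 1 <= M%:R :> R.
  apply: ltW; apply: le_lt_trans M_lo; rewrite /bound /start_bound -/th -mulrA.
  have : 0 < p^-1 by rewrite invr_gt0.
  by lra.
have W1 : 1 <= Wbound d M e.
  rewrite /Wbound -/th -mulrA -/th.
  have : 1 <= M%:R * M%:R :> R by rewrite mulr_ege1.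
  by nra.
have SE : scale d N M e = 8 * d%:R * N%:R * Wbound d M e / th by [].
have WS := W0_S d0 n0 N0 th0 th4 W1 SE.
have S0 : 0 < scale d N M e by apply: lt_le_trans WS; apply: lt_le_trans W1.
have DB : 0 <= digit_bound d N (scale d N M e).
  exact: mulr_ge0 (mulr_ge0 (ler0n _ _) (ler0n _ _)) (exprn_ge0 3 (ltW S0)).
have B0 : 0 < radix d N M e by rewrite /radix; lra.
have [s2 [k2 [k2_le run2 [k gi]]]] : does tables s1 (N * (10 * l + 140) + 20)
    (fun s' => exists k, gram_inv N M e p xf (entries x) ij0 k 0 s').
  apply: does_tables => //.
  - move=> i j; rewrite normrM (gtr0_norm S0).
    apply: (@le_lt_trans _ _ (scale d N M e)); first by rewrite ler_piMr ?entry_le // ltW.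
    apply: le_lt_trans (l_step M_hi).
    have : 0 <= 4 * N%:R * d%:R * scale d N M e / th.
      by rewrite divr_ge0 ?(ltW th0) // mulr_ge0 ?(ltW S0) // !mulr_ge0.
    by lra.
  - by move=> j jN; rewrite nm1; exact: nth_flatten_pairs.
  - move=> j; rewrite rm1 /=; case: ltnP => hj; first by rewrite (nth_map ij0).
    by rewrite nth_default // size_map.
have E2 := gram_env gi.
have [T_eq T_le] := time_split k1_le k2_le (erefl total_time).
rewrite T_eq.
rewrite [Pr _ _ _ _]/= run1 [Pr _ _ _ _]/= run2 [Pr _ _ _ _]/=.
apply: (@Pr_draw R n d N M e p _ cols _ _ (dict_uniq _) s2 Ev _ (search_time + 2) _ E2 _ _ T_le).
move=> vs s' T hT E' vs_size vs_le h2 ho.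
have hz i (j : 'I_d) : (1 < i < 6)%N -> arr N s2 i j = 0 by move=> h; have := gi_zero gi j h.
have [|i j hi|s3 [k3 [k3_le run3 post]]] :=
  @search_from_draws M ij0 vs s' M_lo M_hi vs_size vs_le E'.
- by move=> j; rewrite h2; case: ifPn => // jc; rewrite hz // /start (negbTE jc).
- rewrite ho ?hz //; first by case/andP: hi => h1 ->; rewrite ltnW.
  by case: eqP hi => // ->.
have -> : T = (k3 + (T - k3 - 2).+1).+1.
  by move: search_time k3_le hT => t k3_le hT; clear -k3_le hT; lia.
by rewrite /= run3 /=; apply: le_trans (hf _ _ _ M_lo vs_size post) _; case: (_ - _)%N.
Qed.

End Assembly.

(** * Halting and success *)

Section Probability.
Variables (R : realType) (d n : nat) (x : 'I_n -> 'cV[R]_d) (eps p l1 : R).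
Variables (l K : nat).
Let N := nnz x.
Let e := Num.min eps 1.
Let th := theta e.
Let xf i j := x i j 0.
Let cols := dict (entries x).
Let bound := start_bound d e p.
Hypothesis dn : (d < n)%N.
Hypothesis N0 : (0 < N)%N.
Hypothesis eps0 : 0 < eps.
Hypothesis p0 : 0 < p.
Hypothesis hx : forall i, enorm (x i) <= 1.
Hypothesis ev1 : eigenvalue (second_moment x) l1.
Hypothesis l_bound : bound < 2 ^+ l.
Hypothesis l_th : th^-1 < 2 ^+ l.
Hypothesis l_digit : forall M : nat, M%:R <= 2 * bound ->
  digit_bound d N (scale d N M e) + 1 < 2 ^+ l.
Hypothesis l_step : forall M : nat, M%:R <= 2 * bound ->
  4 * N%:R * d%:R * scale d N M e / th + 2 * scale d N M e < 2 ^+ l.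
Hypothesis K_Theta : forall M : nat, M%:R <= 2 * bound ->
  Theta d (Wbound d M e) < (1 + Num.sqrt th) ^+ K.

Let n0 : (0 < n)%N. Proof. exact: leq_ltn_trans dn. Qed.

Lemma algorithm_halts : halts_within algorithm (total_time x l K) (input x eps p).
Proof.
have [u [j [_ u_le u_ev nu_le]]] := top_vector n0 hx ev1.
have [|M [_ h]] := @algorithm_lower R d n x eps p l1 l K dn N0 eps0 p0 hx l_bound
  l_th l_digit l_step K_Theta u u_le u_ev nu_le (fun=> True) (fun _ _ => 1).
  by move=> *; rewrite asboolT.
apply/le_anti; rewrite Pr_le1 /=; apply: le_trans h.
by rewrite mean_const.
Qed.

Lemma linear_form_dot M (vs : seq nat) (u : 'I_d -> R) j0 : size vs = size cols ->
  linear_form (fun k => u (nth j0 cols k) * M%:R) vs = dot u (start R M cols vs).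
Proof.
move=> vs_size; rewrite /linear_form vs_size.
rewrite /dot -(sum_cols j0 (dict_uniq (entries x))); last first.
  by move=> j jc; rewrite /start (negbTE jc) mulr0.
apply: eq_big_nat => k /andP[_ lt].
by rewrite /start mem_nth // index_uniq ?dict_uniq //; ring.
Qed.

Lemma algorithm_succeeds : 1 - p <=
  Pr (success x eps l1) (total_time x l K) [:: algorithm] (input x eps p).
Proof.
have [u [j [uj u_le u_ev nu_le]]] := top_vector n0 hx ev1.
have lower := @algorithm_lower R d n x eps p l1 l K dn N0 eps0 p0 hx l_bound
  l_th l_digit l_step K_Theta u u_le u_ev nu_le (success x eps l1).
have e0 : 0 < e by rewrite /e lt_min eps0 ltr01.
have th0 : 0 < th by rewrite /th /theta !mulr_gt0.
have nR : 0 < n%:R :> R by rewrite ltr0n.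
(* If the eigenvalue is not positive, every unit vector is good enough. *)
have [nu0|nu0] := leP (n%:R * l1) 0.
  have [|M [_ h]] := lower (fun _ _ => 1).
    move=> M vs s _ _ [h1 _]; rewrite asboolT //.
    apply: success_of_search => //; split=> //.
    apply: (@le_trans _ _ 0); first by rewrite lerBlDr (le_trans nu0) // add0r !mulr_ge0 // ltW.
    by rewrite dot_gram; apply: sumr_ge0 => i _; rewrite -expr2 sqr_ge0.
  by apply: le_trans h; rewrite mean_const lerBlDr lerDl ltW.
(* An eigenvector for a non-zero eigenvalue vanishes on the zero columns, so one
   of the draws belongs to the coordinate equal to 1. *)
have jc : j \in cols.
  apply: contraLR nu0 => jc; rewrite -leNgt.
  have := u_ev (fun k => (k == j)%:R).
  have pick (f : 'I_d -> R) : dot f (fun k => (k == j)%:R) = f j.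
    rewrite /dot (bigD1 j) //= eqxx mulr1 big1 ?addr0 // => k /negbTE ->.
    by rewrite mulr0.
  rewrite pick uj mulr1 => <-; rewrite dot_gram big1 // => i _.
  have z : xf i j = 0 by exact: cols_off.
  by rewrite [X in _ * X](pick (xf i)) z mulr0.
pose jk := index j cols.
pose a M k := u (nth j cols k) * M%:R.
have [|M [M_lo h]] := lower (fun M vs =>
    1 - (`|linear_form (a M) vs| < tau d th)%R%:R).
  move=> M vs s M_lo vs_size [h1 h2].
  rewrite linear_form_dot //; case: ltP => far; first by rewrite subrr.
  by rewrite subr0 asboolT //; apply: success_of_search => //; split=> //; exact: h2.
apply: le_trans h; rewrite meanB mean_const lerD2l lerN2 mean_near0 /= big_nil.
have M0 : 0 < M.+1%:R :> R by rewrite ltr0n.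
have dth : 0 <= 4 * d%:R / th by rewrite divr_ge0 ?mulr_ge0 // ltW.
have M_p : p^-1 <= M.+1%:R.
  rewrite -natr1; have : start_bound d e p < M%:R by [].
  by rewrite /start_bound -/th; lra.
apply: (@le_trans _ _ M.+1%:R^-1).
  apply: (@near0_le R M (a M) (tau d th) _ _ jk); first by rewrite index_mem.
  rewrite /a nth_index // uj mul1r normr_nat ltW //.
  apply: le_lt_trans M_lo; rewrite /start_bound -/th /tau.
  have : 0 < p^-1 by rewrite invr_gt0.
  by rewrite mulrA mulrA -natrM; lra.
by rewrite -[leRHS]invrK lef_pV2 // posrE invr_gt0.
Qed.
End Probability.

Local Open Scope classical_set_scope.
Local Open Scope ring_scope.

(** * Magnitudes of the parameters *)

(** The left-hand side is [total_time] for z non-zero columns. *)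
Lemma time_arith K l z z' N : (90 <= l)%N -> (0 < K)%N -> (0 < z')%N ->
  (z <= z')%N -> (z' <= N)%N ->
  (l * (K * ((20 * l + 180) * z + 91) + 20 * z + 51) + 40 + 2 + 30 * z + 10 +
    (N * (10 * l + 140) + 20) + (6 * l + 110) + 3
  <= 27 * (K * (l * l) * z') + 21 * (N * l))%N.
Proof.
move=> l90 K0 z0 zz zN.
have h1 : ((20 * l + 180) * z + 91 <= 24 * (l * z'))%N.
  have : (90 * z' <= l * z')%N by rewrite leq_mul2r l90 orbT.
  have : (l * z <= l * z')%N by rewrite leq_mul2l zz orbT.
  by rewrite mulnDl -mulnA; lia.
have h2 : (K * ((20 * l + 180) * z + 91) <= 24 * (K * (l * z')))%N.
  by rewrite (mulnCA 24) leq_mul2l h1 orbT.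
have h3 : (l * z' <= K * (l * z'))%N by rewrite leq_pmull.
have h4 : (90 * z' <= l * z')%N by rewrite leq_mul2r l90 orbT.
have h5 : (K * ((20 * l + 180) * z + 91) + 20 * z + 51 <= 25 * (K * (l * z')))%N by lia.
have h6 : (l * (K * ((20 * l + 180) * z + 91) + 20 * z + 51) <= 25 * (K * (l * l) * z'))%N.
  rewrite (_ : 25 * (K * (l * l) * z') = l * (25 * (K * (l * z'))))%N; last by ring.
  by rewrite leq_mul2l h5 orbT.
have h7 : (90 * (K * (l * z')) <= K * (l * l) * z')%N.
  rewrite (_ : K * (l * l) * z' = l * (K * (l * z')))%N; last by ring.
  by rewrite leq_mul2r l90 orbT.
have h8 : (90 * N <= N * l)%N by rewrite mulnC leq_mul2l l90 orbT.
have h9 : (l <= N * l)%N by rewrite leq_pmull //; lia.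
have -> : (N * (10 * l + 140) = 10 * (N * l) + 140 * N)%N by ring.
move: h3 h4 h6 h7 h8 h9; clear h1 h2 h5.
move: (l * (K * ((20 * l + 180) * z + 91) + 20 * z + 51))%N (K * (l * l) * z')%N
  (K * (l * z'))%N (l * z')%N (N * l)%N => a1 a2 a3 a4 a5.
by lia.
Qed.

Section Magnitudes.
Variable R : realType.

Lemma ln2_gt0 : 0 < ln (2 : R).
Proof. by rewrite ln_gt0 // ltr1n. Qed.

Definition log2_up (z : R) : nat := (Num.truncn (ln z / ln 2)).+1.

Lemma log2_upP (z : R) : 0 < z -> z <= 2 ^+ log2_up z.
Proof.
move=> z0; rewrite -ler_ln ?posrE ?exprn_gt0 // lnXn // -[X in _ <= X]mulr_natl.
by rewrite -ler_pdivrMr ?ln2_gt0 // ltW // truncnS_gt.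
Qed.

Lemma log2_up_le (z : R) : 1 <= z -> (log2_up z)%:R <= ln z / ln 2 + 1.
Proof.
move=> z1; rewrite /log2_up -natr1 lerD2r truncn_le.
by apply: divr_ge0; [exact: ln_ge0|exact/ltW/ln2_gt0].
Qed.

Lemma bernoulli (s : R) k : 0 <= s -> 1 + k%:R * s <= (1 + s) ^+ k.
Proof.
move=> s0; elim: k => [|k IH]; first by rewrite mul0r addr0 expr0.
rewrite exprS -natr1; have := ler_wpM2l (_ : 0 <= 1 + s) IH.
have : 0 <= k%:R * s * s by rewrite !mulr_ge0.
by move=> h1 h2; apply: le_trans (h2 _); [nra|lra].
Qed.

Definition doubling_steps (s : R) : nat := (Num.truncn s^-1).+1.

Lemma doubling_stepsP (s : R) : 0 < s -> 2 <= (1 + s) ^+ doubling_steps s.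
Proof.
move=> s0; apply: le_trans (bernoulli _ (ltW s0)).
have : s^-1 < (doubling_steps s)%:R by exact: truncnS_gt.
rewrite -(ltr_pM2r s0) mulVf ?gt_eqF //; lra.
Qed.

Lemma doubling_steps_le (s : R) : 0 < s -> s <= 1 ->
  (doubling_steps s)%:R <= 2 / s.
Proof.
move=> s0 s1; rewrite /doubling_steps -natr1.
have h : (Num.truncn s^-1)%:R <= s^-1 by rewrite truncn_le invr_ge0 ltW.
have : 1 <= s^-1 by rewrite -invr1 lef_pV2 ?posrE.
by rewrite mulr_natl mulr2n; lra.
Qed.

(** All parameters of the algorithm are at most powers of any Y that is at least
    the sum of 2, d, 1 / eps, 1 / p and N.  The exponents are generous. *)
Section Sizes.
Variables (d N M : nat) (eps p Y : R).
Let e := Num.min eps 1.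
Let th := theta e.
Hypothesis d0 : (0 < d)%N.
Hypothesis N0 : (0 < N)%N.
Hypothesis eps0 : 0 < eps.
Hypothesis p0 : 0 < p.
Hypothesis YZ : 2 + d%:R + eps^-1 + p^-1 + N%:R <= Y.
Hypothesis MY : M%:R <= 2 * start_bound d e p.

Let e0 : 0 < e. Proof. by rewrite /e lt_min eps0 ltr01. Qed.

Let th0 : 0 < th. Proof. by rewrite /th /theta !mulr_gt0. Qed.

Let ie : 0 < eps^-1. Proof. by rewrite invr_gt0. Qed.
Let ip : 0 < p^-1. Proof. by rewrite invr_gt0. Qed.
Let dR : 1 <= d%:R :> R. Proof. by rewrite ler1n. Qed.
Let NR : 1 <= N%:R :> R. Proof. by rewrite ler1n. Qed.

Lemma Y_ge2 : 2 <= Y.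
Proof. by move: ie ip dR NR YZ; lra. Qed.

Let Y0 : 0 < Y. Proof. by apply: lt_le_trans Y_ge2. Qed.

Let Yle a b : (a <= b)%N -> Y ^+ a <= Y ^+ b.
Proof. by move=> ab; rewrite ler_weXn2l //; move: Y_ge2; lra. Qed.

Let le_mul (a b : R) i j : 0 <= a -> a <= Y ^+ i -> 0 <= b -> b <= Y ^+ j ->
  a * b <= Y ^+ (i + j).
Proof. by move=> a0 h1 b0 h2; rewrite exprD ler_pM. Qed.

Let d_Y : d%:R <= Y ^+ 1.
Proof. by rewrite expr1; move: ie ip dR NR YZ; lra. Qed.
Let N_Y : N%:R <= Y ^+ 1.
Proof. by rewrite expr1; move: ie ip dR NR YZ; lra. Qed.
Let p_Y : p^-1 <= Y ^+ 1.
Proof. by rewrite expr1; move: ie ip dR NR YZ; lra. Qed.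

Let c4_Y : (4 : R) <= Y ^+ 2.
Proof. by have := Y_ge2; rewrite expr2; nra. Qed.

Let c8_Y : (8 : R) <= Y ^+ 3.
Proof.
rewrite (_ : 8 = 4 * 2); last by rewrite -natrM.
by apply: (le_mul (i := 2) (j := 1)) => //; rewrite expr1 Y_ge2.
Qed.

Lemma th_Y : th^-1 <= Y ^+ 3.
Proof.
have -> : th^-1 = 4 * e^-1.
  by rewrite /th /theta; field; rewrite gt_eqF.
apply: (le_mul (i := 2) (j := 1)) => //; first by rewrite invr_ge0 ltW.
rewrite expr1 /e /Num.min; case: ifP => _; first by move: ie ip dR NR YZ; lra.
by rewrite invr1; have := Y_ge2; lra.
Qed.

Let ith : 0 <= th^-1. Proof. by rewrite invr_ge0 ltW. Qed.

Lemma start_Y : start_bound d e p <= Y ^+ 7.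
Proof.
have h1 : 4 * d%:R / th <= Y ^+ 6.
  apply: (le_mul (i := 3) (j := 3)) => //; last exact: th_Y.
  exact: (le_mul (i := 2) (j := 1)).
have h2 : p^-1 <= Y ^+ 6 by apply: le_trans p_Y (Yle _).
rewrite /start_bound -/th exprS; have := Y_ge2.
have : 0 < Y ^+ 6 by rewrite exprn_gt0.
by nra.
Qed.

Let M_Y : M%:R <= Y ^+ 8.
Proof.
apply: le_trans MY _; rewrite exprS ler_pM //.
- apply: addr_ge0; last exact: ltW.
  by rewrite -/th !mulr_ge0.
- exact: Y_ge2.
- exact: start_Y.
Qed.

Let W_ge0 : 0 <= Wbound d M e.
Proof. by rewrite /Wbound -/th !mulr_ge0. Qed.

Lemma Wbound_Y : Wbound d M e <= Y ^+ 20.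
Proof.
rewrite /Wbound -/th; apply: (le_mul (i := 17) (j := 3)) => //; last exact: th_Y.
apply: (le_mul (i := 16) (j := 1)) => //.
exact: (le_mul (i := 8) (j := 8)).
Qed.

Lemma Theta_Y : Theta d (Wbound d M e) < Y ^+ 23.
Proof.
rewrite /Theta; apply: (@le_lt_trans _ _ (Y ^+ 22)); last first.
  by rewrite ltr_eXn2l //; have := Y_ge2; lra.
apply: (le_mul (i := 2) (j := 20)) => //; last exact: Wbound_Y.
apply: (le_mul (i := 1) (j := 1)) => //.
by rewrite expr1 Y_ge2.
Qed.

Let S_ge0 : 0 <= scale d N M e.
Proof. by rewrite /scale -/th !mulr_ge0. Qed.

Lemma scale_Y : scale d N M e <= Y ^+ 28.
Proof.
rewrite /scale -/th; apply: (le_mul (i := 25) (j := 3)) => //;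
  [exact: mulr_ge0| |exact: th_Y].
apply: (le_mul (i := 5) (j := 20)) => //; last exact: Wbound_Y.
apply: (le_mul (i := 4) (j := 1)) => //.
exact: (le_mul (i := 3) (j := 1)).
Qed.

Lemma digit_Y : digit_bound d N (scale d N M e) + 1 < Y ^+ 90.
Proof.
have h : digit_bound d N (scale d N M e) <= Y ^+ 86.
  rewrite /digit_bound; apply: (le_mul (i := 2) (j := 84)) => //.
  - exact: (le_mul (i := 1) (j := 1)).
  - exact: exprn_ge0.
  - by rewrite (exprM Y 28 3) lerXn2r ?nnegrE ?scale_Y ?exprn_ge0 ?(ltW Y0).
have h1 : 1 <= Y ^+ 86 by rewrite exprn_ege1 //; have := Y_ge2; lra.
apply: (@lt_le_trans _ _ (Y ^+ 88)); last exact: Yle.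
have -> : Y ^+ 88 = Y ^+ 2 * Y ^+ 86 by rewrite -exprD.
have := c4_Y; nra.
Qed.

Lemma step_Y : 4 * N%:R * d%:R * scale d N M e / th + 2 * scale d N M e < Y ^+ 90.
Proof.
have h1 : 4 * N%:R * d%:R * scale d N M e / th <= Y ^+ 35.
  apply: (le_mul (i := 32) (j := 3)) => //; [exact: mulr_ge0| |exact: th_Y].
  apply: (le_mul (i := 4) (j := 28)) => //; last exact: scale_Y.
  apply: (le_mul (i := 3) (j := 1)) => //.
  exact: (le_mul (i := 2) (j := 1)).
have h2 : 2 * scale d N M e <= Y ^+ 35.
  apply: le_trans (_ : _ <= Y ^+ (1 + 28)) (Yle _) => //.
  by apply: le_mul => //; [rewrite expr1 Y_ge2|exact: scale_Y].
apply: (@lt_le_trans _ _ (Y ^+ 37)); last exact: Yle.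
have -> : Y ^+ 37 = Y ^+ 2 * Y ^+ 35 by rewrite -exprD.
have := c4_Y; have : 0 < Y ^+ 35 by rewrite exprn_gt0.
by nra.
Qed.

End Sizes.
End Magnitudes.

(** * The time bound *)

Section Budget.
Variable R : realType.
Implicit Types (d N : nat) (eps p : R).

(** With Y = 2 ^ [size_exp] the arguments of truncation are below Y ^ 90 =
    2 ^ [cost_exp], and [inner_steps] steps make the growth factor reach
    Y ^ 23, which is more than [Theta]. *)
Definition size_exp d N eps p : nat :=
  log2_up (2 + d%:R + eps^-1 + p^-1 + N%:R).

Definition cost_exp d N eps p : nat := (90 * size_exp d N eps p)%N.

Definition doublings eps : nat :=
  doubling_steps (Num.sqrt (theta (Num.min eps 1))).

Definition inner_steps d N eps p : nat :=
  (doublings eps * (23 * size_exp d N eps p))%N.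

Definition time_bound d N eps p : nat :=
  let l := cost_exp d N eps p in
  (27 * (inner_steps d N eps p * (l * l) * minn d N) + 21 * (N * l))%N.

Definition log_factor d eps p : R := ln (2 + d%:R + eps^-1 + p^-1).

Definition budget d N eps : R :=
  N%:R `^ (3%:R / 4%:R) * d%:R `^ (1%:R / 4%:R) / Num.sqrt eps.

Lemma budget_gt0 d N eps : (0 < d)%N -> (0 < N)%N -> 0 < eps -> 0 < budget d N eps.
Proof.
by move=> d0 N0 eps0; rewrite /budget divr_gt0 ?sqrtr_gt0 // mulr_gt0 // powR_gt0 // ltr0n.
Qed.

Lemma log_factor_ge d eps p : 0 < eps -> 0 < p -> ln 2 <= log_factor d eps p.
Proof.
move=> eps0 p0; have := ler0n R d; have : 0 < eps^-1 by rewrite invr_gt0.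
have : 0 < p^-1 by rewrite invr_gt0.
move=> h1 h2 h3; rewrite /log_factor ler_ln ?posrE //; lra.
Qed.

Lemma run_within_time_bound d n (x : 'I_n -> 'cV[R]_d) eps p l1 :
  (d < n)%N -> (0 < nnz x)%N -> 0 < eps -> 0 < p ->
  (forall i, enorm (x i) <= 1) -> eigenvalue (second_moment x) l1 ->
  exists T : nat, [/\ (T <= time_bound d (nnz x) eps p)%N,
    halts_within algorithm T (input x eps p)
  & 1 - p <= Pr (success x eps l1) T [:: algorithm] (input x eps p)].
Proof.
move=> dn N0 eps0 p0 hx ev1; set N := nnz x in N0 *.
have d0 : (0 < d)%N by apply: (@dim_gt0 R d n x).
pose e := Num.min eps 1.
have e0 : 0 < e by rewrite /e lt_min eps0 ltr01.
have s0 : 0 < Num.sqrt (theta e) by rewrite sqrtr_gt0 /theta !mulr_gt0.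
have [Y [YZ Yl YK]] : exists Y : R, [/\ 2 + d%:R + eps^-1 + p^-1 + N%:R <= Y,
    2 ^+ cost_exp d N eps p = Y ^+ 90
  & Y ^+ 23 <= (1 + Num.sqrt (theta e)) ^+ inner_steps d N eps p].
  exists (2 ^+ size_exp d N eps p); split.
  - apply: log2_upP; have : 0 < eps^-1 by rewrite invr_gt0.
    have : 0 < p^-1 by rewrite invr_gt0.
    by have := ler0n R d; have := ler0n R N; lra.
  - by rewrite /cost_exp mulnC exprM.
  - rewrite /inner_steps exprM -exprM mulnC lerXn2r ?nnegrE ?exprn_ge0 ?addr_ge0 //.
    exact: doubling_stepsP.
have l90 : (90 <= cost_exp d N eps p)%N by rewrite /cost_exp leq_pmulr.
have K0 : (0 < inner_steps d N eps p)%N by rewrite /inner_steps !muln_gt0.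
rewrite /time_bound.
move: (cost_exp d N eps p) (inner_steps d N eps p) Yl YK l90 K0 => l K Yl YK l90 K0.
have Y2 := Y_ge2 d0 N0 eps0 p0 YZ.
have Y1 : 1 < Y by apply: lt_le_trans Y2; rewrite ltr1n.
have lt_Y k : (k < 90)%N -> Y ^+ k < Y ^+ 90 by rewrite (ltr_eXn2l Y1).
have hb : start_bound d e p < 2 ^+ l.
  by rewrite Yl; apply: le_lt_trans (lt_Y 7%N _) => //; apply: start_Y N0 eps0 p0 YZ.
have ht : (theta e)^-1 < 2 ^+ l.
  by rewrite Yl; apply: le_lt_trans (lt_Y 3%N _) => //; apply: th_Y d0 N0 eps0 p0 YZ.
have hd (M : nat) : M%:R <= 2 * start_bound d e p ->
    digit_bound d N (scale d N M e) + 1 < 2 ^+ l.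
  by rewrite Yl => hM; apply: digit_Y d0 N0 eps0 p0 YZ hM.
have hs (M : nat) : M%:R <= 2 * start_bound d e p ->
    4 * N%:R * d%:R * scale d N M e / theta e + 2 * scale d N M e < 2 ^+ l.
  by rewrite Yl => hM; apply: step_Y d0 N0 eps0 p0 YZ hM.
have hK (M : nat) : M%:R <= 2 * start_bound d e p ->
    Theta d (Wbound d M e) < (1 + Num.sqrt (theta e)) ^+ K.
  by move=> hM; apply: lt_le_trans (Theta_Y d0 N0 eps0 p0 YZ hM) YK.
exists (total_time x l K); split.
- rewrite /total_time /search_time -/N.
  apply: time_arith => //.
  + by rewrite leq_min d0.
  + by rewrite leq_min cols_size_N cols_size_d.
  + exact: geq_minr.
- exact: (algorithm_halts dn N0 eps0 p0 hx ev1).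
- exact: (algorithm_succeeds dn N0 eps0 p0 hx ev1).
Qed.

Definition log_const : R := 5 / ln 2.

Definition time_const : R :=
  (27 * (23 * (90 * 90) * 4) + 21 * 90) * log_const ^+ 3.

Lemma quarter_power (a : R) : 0 < a -> exists A, [/\ 0 < A, A ^+ 4 = a,
  a `^ (1%:R / 4%:R) = A & a `^ (3%:R / 4%:R) = A ^+ 3].
Proof.
move=> a0; exists (a `^ (1%:R / 4%:R)); split=> //; first exact: powR_gt0.
  by rewrite -powR_mulrn ?powR_ge0 // -powRrM mul1r mulVf ?powRr1 ?ltW // pnatr_eq0.
by rewrite -powR_mulrn ?powR_ge0 // -powRrM; congr (_ `^ _); field.
Qed.

Lemma small_sqr d N (eps : R) : (0 < N)%N -> 0 < eps ->
  eps <= Num.sqrt (d%:R / N%:R) -> eps ^+ 2 * N%:R <= d%:R.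
Proof.
move=> N0 eps0 small; rewrite -ler_pdivlMr ?ltr0n // -[leRHS]sqr_sqrtr ?divr_ge0 //.
by apply: lerXn2r small; rewrite nnegrE ?sqrtr_ge0 // ltW.
Qed.

(** This is where the smallness of eps enters: it makes N polynomial in d and
    eps^-1, and its logarithm is absorbed by theirs. *)
Lemma size_exp_le d N eps p : (0 < d)%N -> (0 < N)%N -> 0 < eps -> 0 < p ->
  eps <= Num.sqrt (d%:R / N%:R) ->
  (size_exp d N eps p)%:R <= log_const * log_factor d eps p.
Proof.
move=> d0 N0 eps0 p0 small.
have ie : 0 < eps^-1 by rewrite invr_gt0.
have ip : 0 < p^-1 by rewrite invr_gt0.
have small2 := small_sqr N0 eps0 small.
have dN2 : N%:R <= d%:R * (eps^-1) ^+ 2.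
  by rewrite exprVn ler_pdivlMr ?exprn_gt0 // mulrC.
have L2 := log_factor_ge d eps0 p0.
have [dZ eZ Z2] : [/\ d%:R <= 2 + d%:R + eps^-1 + p^-1,
    eps^-1 <= 2 + d%:R + eps^-1 + p^-1 & 2 <= 2 + d%:R + eps^-1 + p^-1].
  by have := ler0n R d; split; lra.
rewrite /size_exp; move: dZ eZ Z2 L2; rewrite /log_factor.
move: (2 + d%:R + eps^-1 + p^-1) => Z dZ eZ Z2 L2.
have Z0 : 0 < Z by lra.
have Z1 : 1 <= Z by lra.
have NR := ler0n R N; have ln2 := ln2_gt0 R.
have N_Z : N%:R <= Z ^+ 3.
  apply: le_trans dN2 _; rewrite [Z ^+ 3]exprS; apply: ler_pM => //.
    by rewrite exprn_ge0 // ltW.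
  by apply: lerXn2r eZ; rewrite nnegrE ltW.
have Z4 : Z + N%:R <= Z ^+ 4.
  have : Z ^+ 3 * 2 <= Z ^+ 4 by rewrite [leRHS]exprSr ler_pM2l ?exprn_gt0.
  have : Z ^+ 1 <= Z ^+ 3 by rewrite ler_weXn2l.
  by rewrite expr1; lra.
apply: le_trans (log2_up_le _) _; first by lra.
have lnZ : ln (Z + N%:R) <= 4 * ln Z.
  by rewrite mulr_natl -lnXn // ler_ln ?posrE ?exprn_gt0 //; lra.
rewrite /log_const mulrAC ler_pdivlMr // mulrDl mul1r divfK ?gt_eqF //.
by lra.
Qed.

Lemma time_bound_le d N eps p : (0 < d)%N -> (0 < N)%N -> 0 < eps -> 0 < p ->
  eps <= Num.sqrt (d%:R / N%:R) ->
  (time_bound d N eps p)%:R <=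
    time_const * log_factor d eps p ^+ 3 * budget d N eps.
Proof.
move=> d0 N0 eps0 p0 small.
have dR : 1 <= d%:R :> R by rewrite ler1n.
have NR : 1 <= N%:R :> R by rewrite ler1n.
have ie : 0 < eps^-1 by rewrite invr_gt0.
have ip : 0 < p^-1 by rewrite invr_gt0.
set L := log_factor d eps p; set Bd := budget d N eps.
have ln2 := ln2_gt0 R.
have L2 : ln 2 <= L by exact: log_factor_ge.
have lam_le : (size_exp d N eps p)%:R <= log_const * L by exact: size_exp_le.
have lc1 : 1 <= log_const * L.
  by rewrite /log_const mulrAC ler_pdivlMr //; lra.
have [A [A0 A4 A1 A3]] := quarter_power (lt_le_trans ltr01 NR).
have [D [D0 D4 D1 _]] := quarter_power (lt_le_trans ltr01 dR).
have small2 := small_sqr N0 eps0 small.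
have BdE : Bd = A ^+ 3 * D / Num.sqrt eps by rewrite /Bd /budget A3 D1.
have sq0 : 0 < Num.sqrt eps by rewrite sqrtr_gt0.
have sqA : Num.sqrt eps * A <= D.
  rewrite -(@ler_pXn2r _ 4) ?nnegrE ?mulr_ge0 ?(ltW A0) ?(ltW D0) ?(ltW sq0) // exprMn A4 D4.
  by rewrite (exprM _ 2 2) sqr_sqrtr ?(ltW eps0).
have N_Bd : N%:R <= Bd.
  rewrite BdE ler_pdivlMr // -A4 exprSr -mulrA ler_pM2l ?exprn_gt0 //.
  by rewrite mulrC.
have min_AD : (minn d N)%:R <= A ^+ 3 * D.
  have [DA|AD] := leP D A.
    apply: (@le_trans _ _ d%:R); first by rewrite ler_nat geq_minl.
    rewrite -D4 exprSr ler_pM2r // lerXn2r ?nnegrE ?(ltW A0) ?(ltW D0) ?(ltW DA) //.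
  apply: (@le_trans _ _ N%:R); first by rewrite ler_nat geq_minr.
  by rewrite -A4 exprSr ler_pM2l ?exprn_gt0 // ltW.
(* The number of steps is limited by min(eps, 1); when eps > 1 the bound on N
   alone suffices. *)
have q_Bd : (doublings eps)%:R * (minn d N)%:R <= 4 * Bd.
  pose e := Num.min eps 1.
  have e0 : 0 < e by rewrite /e lt_min eps0 ltr01.
  have e1 : e <= 1 by rewrite ge_min lexx orbT.
  have sE : Num.sqrt (theta e) = Num.sqrt e / 2.
    rewrite /theta -mulrA -expr2 sqrtrM ?(ltW e0) // sqrtr_sqr ger0_norm //.
  have se0 : 0 < Num.sqrt e by rewrite sqrtr_gt0.
  have se1 : Num.sqrt e <= 1 by rewrite -sqrtr1 ler_sqrt.
  have q_le : (doublings eps)%:R <= 4 / Num.sqrt e.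
    apply: le_trans (doubling_steps_le _ _) _; rewrite -/e sE.
    - by rewrite divr_gt0.
    - by lra.
    - by rewrite le_eqVlt; apply/orP; left; apply/eqP; field; rewrite gt_eqF.
  apply: (@le_trans _ _ (4 / Num.sqrt e * (minn d N)%:R)); first exact: ler_wpM2r.
  rewrite -mulrA ler_pM2l // mulrC ler_pdivrMr //.
  have [eps1|eps1] := leP eps 1.
    have -> : e = eps by rewrite /e min_l.
    by rewrite BdE divfK ?gt_eqF.
  have -> : e = 1 by rewrite /e min_r // ltW.
  by rewrite sqrtr1 mulr1; apply: le_trans N_Bd; rewrite ler_nat geq_minr.
have Bd0 : 0 < Bd by exact: budget_gt0.
set lam := (size_exp d N eps p)%:R in lam_le.
have lam0 : 0 <= lam by exact: ler0n.
have lam3 : lam ^+ 3 <= (log_const * L) ^+ 3 by rewrite lerXn2r ?nnegrE //; lra.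
have lam1 : lam <= (log_const * L) ^+ 3.
  by apply: le_trans lam_le _; rewrite -[leLHS]expr1 ler_weXn2l.
have -> : (time_bound d N eps p)%:R = 27 * (23 * (90 * 90)) * lam ^+ 3 *
    ((doublings eps)%:R * (minn d N)%:R) + 21 * 90 * lam * N%:R :> R.
  by rewrite /time_bound /inner_steps /cost_exp natrD !natrM -/lam; ring.
have -> : time_const * L ^+ 3 * Bd =
    27 * (23 * (90 * 90)) * (log_const * L) ^+ 3 * (4 * Bd) +
    21 * 90 * (log_const * L) ^+ 3 * Bd.
  by rewrite /time_const; ring.
have k1 : 0 < 27 * (23 * (90 * 90)) :> R by rewrite !mulr_gt0.
have k2 : 0 < 21 * 90 :> R by rewrite mulr_gt0.
by apply: lerD; apply: ler_pM => //; rewrite ?mulr_ge0 ?exprn_ge0 ?ler_pM2l ?(ltW k1) ?(ltW k2).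
Qed.

End Budget.

Theorem theorem1p4 (R : realType) :
  exists (P : prog) (k : nat),
  forall (d n N : nat -> nat) (eps p : nat -> R),
    (forall m, (d m < n m)%N) ->
    (forall m, (0 < N m)%N) ->
    (forall m, 0 < eps m) ->
    (forall m, 0 < p m) ->
    eps =o_\oo (fun m => Num.sqrt ((d m)%:R / (N m)%:R)) ->
  exists C : R,
  forall (m : nat) (x : 'I_(n m) -> 'cV[R]_(d m)) (l1 : R),
    (forall i, enorm (x i) <= 1) ->
    nnz x = N m ->
    largest_eigenvalue (second_moment x) l1 ->
  exists T : nat,
    [/\ T%:R <= C * ln (2 + (d m)%:R + (eps m)^-1 + (p m)^-1) ^+ k
                * ((N m)%:R `^ (3%:R / 4%:R) * (d m)%:R `^ (1%:R / 4%:R)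
                   / Num.sqrt (eps m)),
        halts_within P T (input x (eps m) (p m))
      & 1 - p m <=
        Pr (fun s => let w : 'cV[R]_(d m) := output (d m) s in
              enorm w = 1 /\ l1 - eps m <= quad (second_moment x) w)
           T [:: P] (input x (eps m) (p m)) ].
Proof.
exists algorithm, 3%N => d n N eps p dn N0 eps0 p0 /eqoP/(_ 1 ltr01) [m0 _ small].
pose ratio m := (time_bound (d m) (N m) (eps m) (p m))%:R /
  (log_factor (d m) (eps m) (p m) ^+ 3 * budget (d m) (N m) (eps m)) : R.
have const_ge0 : 0 <= time_const R.
  have ln2 := ln2_gt0 R.
  rewrite /time_const; apply: mulr_ge0; first by rewrite addr_ge0 ?mulr_ge0.
  by rewrite exprn_ge0 // divr_ge0 // ltW.
(* Before m0, where eps may still exceed sqrt (d / N), the constant majorizes the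
   finitely many ratios of the time to the bound. *)
exists (time_const R + \sum_(m < m0) `|ratio m|) => m x l1 hx xN [ev1 _].
have d0 : (0 < d m)%N by apply: (@dim_gt0 R _ _ x); rewrite xN.
have [T [T_le halts succeeds]] : exists T : nat,
    [/\ (T <= time_bound (d m) (N m) (eps m) (p m))%N,
      halts_within algorithm T (input x (eps m) (p m))
    & 1 - p m <= Pr (success x (eps m) l1) T [:: algorithm] (input x (eps m) (p m))].
  by rewrite -xN; apply: run_within_time_bound; rewrite ?xN.
exists T; split=> //.
have T_le' : T%:R <= (time_bound (d m) (N m) (eps m) (p m))%:R :> R by rewrite ler_nat.
apply: le_trans T_le' _.
rewrite -/(log_factor (d m) (eps m) (p m)) -/(budget (d m) (N m) (eps m)).
have L0 : 0 < log_factor (d m) (eps m) (p m).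
  by apply: lt_le_trans (ln2_gt0 R) (log_factor_ge _ _ _).
have B0 : 0 < budget (d m) (N m) (eps m) by exact: budget_gt0.
have LB0 : 0 < log_factor (d m) (eps m) (p m) ^+ 3 * budget (d m) (N m) (eps m).
  by rewrite mulr_gt0 // exprn_gt0.
rewrite -mulrA; have [m_small|m_large] := ltnP m m0.
  rewrite -ler_pdivrMr // -/(ratio m); apply: le_trans (ler_norm _) _.
  rewrite (bigD1 (Ordinal m_small)) //= addrCA lerDl.
  by rewrite addr_ge0 // sumr_ge0.
have /= := small m m_large; rewrite mul1r gtr0_norm // ger0_norm ?sqrtr_ge0 // => h.
apply: le_trans (time_bound_le d0 (N0 m) (eps0 m) (p0 m) h) _.
by rewrite -mulrA ler_pM2r // lerDl sumr_ge0.
Qed.
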